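(* Suppose that conditions (A1), (A2), (A3) of the context hold, and let $t\in\mathbb{C}$ with $0<|t|<t_{\mathrm{sing}}$ (so that $\nu_t=(T_t)_\#\nu_0$). The transport map $T_t$ is optimal between $\nu_0$ and $\nu_t$ if and only if $\nu_0$ is the uniform measure on some disk centered at the origin, in which case the curve $(\nu_t)_{t\in[0,1]}$ (in the space of probability measures) is a Wasserstein geodesic.
   Context: Let $P_n(z)=\sum_{k=0}^n\xi_k a_{k;n}z^k$ with: (A1) $\xi_0,\xi_1,\ldots$ are i.i.d. complex-valued, non-degenerate (not almost surely constant) random variables with $\mathbb{E}\log(1+|\xi_0|)<\infty$. (A2) $a_{k;n}$ are deterministic complex coefficients such that for some continuous $g:[0,1]\to\mathbb{R}$, $\lim_{n\to\infty}\sup_{0\le k\le n}\left|\frac1n\log|a_{k;n}|-g\left(\frac kn\right)\right|=0$; moreover $g$ is concave and its left derivative satisfies $g'_-(1)>-\infty$. (A3) $g$ is infinitely differentiable on $(0,1)$ and $g''(\alpha)<0$ for all $\alpha\in(0,1)$. With $g'(0):=\lim_{\alpha\downarrow0}g'(\alpha)\in(-\infty,+\infty]$ and $g'(1):=\lim_{\alpha\uparrow1}g'(\alpha)$: if $g'(0)=+\infty$, then additionally $\lim_{\alpha\downarrow0}\alpha e^{g'(\alpha)}=0$. For $z\in\mathbb{C}$, $\alpha_0(z)=\alpha_0(|z|)$ is the unique maximizer over $\alpha\in[0,1]$ of $g(\alpha)+\alpha\log|z|$. For real $t\ge0$ the transport map is $T_t(w)=w+t\frac{\alpha_0(w)}{w}$,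 $w\ne0$. For complex $t=|t|e^{i\phi}$, $\phi\in(-\pi,\pi]$, the transport map is the rotated map $T_t(w)=e^{i\phi/2}\,T_{|t|}(w)$. Further, $t_{\mathrm{sing}}=\left(\sup_{s\in(e^{-g'(0)},e^{-g'(1)})}\left|\left(\alpha_0(s)/s\right)'\right|\right)^{-1}$ (with $e^{-\infty}=0$, $1/\infty=0$). For $t\in\mathbb{C}$, $\nu_t$ is the limit in probability (weak topology) of the empirical zero distributions (each zero, with multiplicity, gets weight $1/\deg$) of $\exp\{-\frac{t}{2n}\partial_z^2\}P_n$. The measure $\nu_0$ is rotationally invariant with $\nu_0(\{|z|<r\})=\alpha_0(r)$. For $t\neq 0$, $\nu_t$ is the unique compactly supported probability measure with logarithmic potential $\int\log|z-y|\,\nu_t(dy)=\sup_{\alpha\in[0,1]}f_t(\alpha,z)-g(1)$, $z\in\mathbb{C}$, where $f_t(\alpha,z)=g(\alpha)+\alpha\log\sqrt{|t|\alpha}+\alpha\Psi(z/\sqrt{t\alpha})$ for $\alpha\in(0,1]$, $f_t(0,z)=g(0)$, and $\Psi(z)=\frac14\operatorname{Re}(z^2-z\sqrt{z^2-4})+\log\left|\frac{z+\sqrt{z^2-4}}{2}\right|-\frac12$ with $\sqrt{z^2-4}$ holomorphic on $\mathbb{C}\setminus[-2,2]$ and $\sim z$ at infinity. For compactly supported probability measures $\mu,\nu$ on $\mathbb{C}$, $W_2^2(\mu,\nu)=\inf_q\int_{\mathbb{C}^2}|z-w|^2\,q(dz,dw)$ over all couplings $q$ of $\mu$ and $\nu$.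 A map $T$ is an optimal transport map between $\mu$ and $\nu$ if $(\mathrm{Id},T)_\#\mu$ is a coupling of $\mu$ and $\nu$ attaining this infimum. A curve $(\mu_t)_{t\in[0,1]}$ of distributions is a (constant speed) Wasserstein geodesic if $W_2(\mu_s,\mu_t)=|t-s|\,W_2(\mu_0,\mu_1)$ for all $s,t\in[0,1]$.
   Formalization: For complex t the transport map is taken as e^{iφ/2}T_{|t|}(e^{-iφ/2}w) (as printed, optimality fails unless t>0); the geodesic claim is proved for s↦ν_{st} with the given t, and for (ν_s), s in [0,1], only when t_sing≥1, since it fails for t_sing<1. *)

(* Defs.v *)
From HB Require Import structures.
From mathcomp Require Import all_boot all_order all_algebra.
From mathcomp Require Import all_classical all_reals all_analysis.
From mathcomp.real_closed Require Import complex.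

Set Implicit Arguments.
Unset Strict Implicit.
Unset Printing Implicit Defensive.

Import Order.TTheory GRing.Theory Num.Theory.
Import numFieldNormedType.Exports.

Local Open Scope classical_set_scope.
Local Open Scope ring_scope.
Local Open Scope complex_scope.

(** Algebra takes place in [R[i]].  Measures and topology live on [R * R], which
carries the Borel sigma-algebra and Lebesgue measure of the plane. *)

Section plane.
Context {R : realType}.
Implicit Types z w : R[i].

Definition toC (x : R * R) : R[i] := x.1 +i* x.2.
Definition ofC z : R * R := (complex.Re z, complex.Im z).

Definition modc z : R := Normc.normc z.

Definition expi (theta : R) : R[i] := cos theta +i* sin theta.

Definition argc z : R :=
  xget 0 [set phi | - pi < phi <= pi /\ z = (modc z)%:C * expi phi].

(** [sqrtc] is the principal square root, so this product is continuous across
]-oo, -2[ (both factors change sign); it is holomorphic off [-2, 2] and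
equivalent to [z] at infinity.  On [-2, 2] it takes its boundary values from
the upper half-plane; the real parts in [Psi] agree from both sides there. *)
Definition sqrt_z2m4 z : R[i] := sqrtc (z - 2%:R) * sqrtc (z + 2%:R).

Definition Psi z : R :=
  4^-1 * complex.Re (z ^+ 2 - z * sqrt_z2m4 z)
  + ln (modc ((z + sqrt_z2m4 z) / 2%:R)) - 2^-1.

End plane.

Section assumptions.
Context {R : realType}.

Definition mutually_independent d (Omega : measurableType d)
    (P : probability Omega R) (X : nat -> Omega -> R * R) : Prop :=
  forall (s : seq nat) (A : nat -> set (R * R)),
    uniq s -> (forall k, measurable (A k)) ->
    P (\bigcap_(k in [set` s]) (X k @^-1` A k)) =
      (\prod_(k <- s) P (X k @^-1` A k))%E.

Definition identically_distributed d (Omega : measurableType d)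
    (P : probability Omega R) (X : nat -> Omega -> R * R) : Prop :=
  forall k (A : set (R * R)), measurable A ->
    P (X k @^-1` A) = P (X 0%N @^-1` A).

Definition assumption_A1 d (Omega : measurableType d)
    (P : probability Omega R) (xi : nat -> Omega -> R[i]) : Prop :=
  [/\ forall k, measurable_fun setT (ofC \o xi k),
      mutually_independent P (fun k => ofC \o xi k),
      identically_distributed P (fun k => ofC \o xi k),
      ~ (exists c : R[i], {ae P, forall w, xi 0%N w = c})
    & ('E_P[fun w => ln (1 + modc (xi 0%N w))] < +oo)%E ].

Definition concave_on01 (g : R -> R) : Prop :=
  forall x y l : R, 0 <= x <= 1 -> 0 <= y <= 1 -> 0 <= l <= 1 ->
    l * g x + (1 - l) * g y <= g (l * x + (1 - l) * y).

(** A vanishing coefficient makes the maximum infinite, since [lne 0 = -oo].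
For a concave [g], continuous at 1, the difference quotients at 1 from the left
converge in [-oo, +oo[, hence the last clause says that the left derivative is
not -oo. *)
Definition assumption_A2 (a : nat -> nat -> R[i]) (g : R -> R) : Prop :=
  [/\ {within `[0, 1], continuous g},
      (fun n : nat =>
         \big[maxe/0]_(k < n.+1)
            `| (n%:R^-1)%R%:E * lne (modc (a k n))%:E - (g (k%:R / n%:R)%R)%:E |)%E
        @ \oo --> 0%E,
      concave_on01 g
    & exists l : R, (fun x => (g x - g 1) / (x - 1)) @ 1^'- --> l ].

Definition dg0 (g : R -> R) : \bar R := lim ((fun a => (derive1 g a)%:E) @ 0^'+).
Definition dg1 (g : R -> R) : \bar R := lim ((fun a => (derive1 g a)%:E) @ 1^'-).

Definition assumption_A3 (g : R -> R) : Prop :=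
  [/\ forall (n : nat) (x : R), 0 < x < 1 -> derivable (derive1n n g) x 1,
      forall x : R, 0 < x < 1 -> derive1n 2 g x < 0
    & dg0 g = +oo%E -> (fun a => a * expR (derive1 g a)) @ 0^'+ --> (0 : R) ].

End assumptions.

Section transport.
Context {R : realType}.
Implicit Types (g : R -> R) (t z w : R[i]).

(** With [lne 0 = -oo] and [0 * -oo = 0] this also yields [alpha0 g 0 = 0]. *)
Definition alpha0 g (r : R) : R :=
  xget 0 [set a | 0 <= a <= 1 /\ forall b : R, 0 <= b <= 1 ->
    ((g b)%:E + b%:E * lne r%:E <= (g a)%:E + a%:E * lne r%:E)%E].

Definition transport_real g (t : R) w : R[i] :=
  w + (t * alpha0 g (modc w))%:C / w.

(** The real map of time [|t|] seen in the frame rotated by [argc t / 2]; away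
from 0 this is [w + t * alpha0(|w|) / w].  Omitting the inner rotation changes
nothing for [t > 0] and, for every [t], gives the same image of a rotation
invariant measure; but for other [t] the result is never the gradient of a
function, hence never an optimal map. *)
Definition transport_map g t w : R[i] :=
  expi (argc t / 2) * transport_real g (modc t) (expi (- (argc t / 2)) * w).

Definition t_sing g : \bar R :=
  ((ereal_sup [set (`| derive1 (fun u : R => alpha0 g u / u) s |%R)%:E |
      s in [set s : R | expeR (- dg0 g) < s%:E < expeR (- dg1 g)]])^-1)%E.

End transport.

Section zeros.
Context {R : realType}.

Definition random_poly (Omega : Type) (xi : nat -> Omega -> R[i])
    (a : nat -> nat -> R[i]) (n : nat) (w : Omega) : {poly R[i]} :=
  \poly_(k < n.+1) (xi k w * a k n).

(** [exp (- t / (2 n) * (d/dz)^2) p]; the derivatives of order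
[2 j >= size p] vanish. *)
Definition heat_flow (n : nat) (t : R[i]) (p : {poly R[i]}) : {poly R[i]} :=
  \sum_(j < size p)
    (((- t / (2 * n)%:R) ^+ j) / j`!%:R) *: derivn j.*2 p.

Definition zeros (p : {poly R[i]}) : seq R[i] :=
  sval (closed_field_poly_normal p).

(** This is the null measure when [p] is constant. *)
Definition empirical_zeros (p : {poly R[i]}) : {measure set (R * R) -> \bar R} :=
  mscale (((size p).-1%:R)^-1)%:nng
    (msum (fun k => dirac (ofC (zeros p)`_k)) (size (zeros p))).

Definition cvg_weakly_in_probability d (Omega : measurableType d)
    (P : probability Omega R)
    (mu : nat -> Omega -> {measure set (R * R) -> \bar R})
    (nu : probability (R * R)%type R) : Prop :=
  forall f : R * R -> R, continuous f -> (exists M : R, forall x, `|f x| <= M) ->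
  forall eps : R, 0 < eps ->
    (fun n => P [set w |
        eps < `| \int[mu n w]_x f x - \int[nu]_x f x |]) @ \oo --> 0%E.

Definition rotation_invariant (nu : probability (R * R)%type R) : Prop :=
  forall (theta : R) (A : set (R * R)), measurable A ->
    nu [set x | A (ofC (expi theta * toC x))] = nu A.

Definition compactly_supported (nu : probability (R * R)%type R) : Prop :=
  exists2 K : set (R * R), compact K & nu (~` K) = 0%E.

Definition log_potential (nu : probability (R * R)%type R) (z : R[i]) : \bar R :=
  (\int[nu]_y lne (modc (z - toC y))%:E)%E.

Definition ft (g : R -> R) (t : R[i]) (alpha : R) (z : R[i]) : R :=
  if alpha == 0 then g 0 else
  g alpha + alpha * ln (Num.sqrt (modc t * alpha))
  + alpha * Psi (z / sqrtc (t * alpha%:C)).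

Definition has_heat_potential (g : R -> R) (t : R[i])
    (nu : probability (R * R)%type R) : Prop :=
  compactly_supported nu /\
  forall z, log_potential nu z =
    (ereal_sup [set (ft g t alpha z)%:E | alpha in `[0%R, 1%R]] - (g 1)%:E)%E.

Definition limiting_zero_distributions d (Omega : measurableType d)
    (P : probability Omega R) (xi : nat -> Omega -> R[i])
    (a : nat -> nat -> R[i]) (g : R -> R)
    (nu : R[i] -> probability (R * R)%type R) : Prop :=
  [/\ forall t, cvg_weakly_in_probability P
        (fun n w => empirical_zeros (heat_flow n t (random_poly xi a n w)))
        (nu t),
      rotation_invariant (nu 0),
      forall r : R, 0 <= r ->
        nu 0 [set x | modc (toC x) < r] = (alpha0 g r)%:E,
      forall t, t != 0 -> has_heat_potential g t (nu t)
    & forall t, t != 0 -> forall mu : probability (R * R)%type R,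
        has_heat_potential g t mu ->
        forall A : set (R * R), measurable A -> mu A = nu t A ].

End zeros.

Section wasserstein.
Context {R : realType}.
Implicit Types mu nu : probability (R * R)%type R.
Local Open Scope ereal_scope.

Definition coupling mu nu (q : probability ((R * R) * (R * R))%type R) : Prop :=
  (forall A : set (R * R), measurable A -> q (A `*` setT) = mu A) /\
  (forall A : set (R * R), measurable A -> q (setT `*` A) = nu A).

Definition transport_cost (q : probability ((R * R) * (R * R))%type R) : \bar R :=
  \int[q]_x (modc (toC x.1 - toC x.2) ^+ 2)%:E.

Definition W2sq mu nu : \bar R :=
  ereal_inf [set transport_cost q | q in coupling mu nu].

Definition W2 mu nu : \bar R := sqrte (W2sq mu nu).

Definition optimal_transport_map (T : R[i] -> R[i]) mu nu : Prop :=
  let idT (x : R * R) := (x, ofC (T (toC x))) in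
  measurable_fun setT idT /\
  exists q : probability ((R * R) * (R * R))%type R,
    [/\ forall B, measurable B -> q B = pushforward mu idT B,
        coupling mu nu q
      & transport_cost q = W2sq mu nu].

Definition wasserstein_geodesic (mu : R -> probability (R * R)%type R) : Prop :=
  forall s t : R, (0 <= s <= 1)%R -> (0 <= t <= 1)%R ->
    W2 (mu s) (mu t) = `|t - s|%:E * W2 (mu 0%R) (mu 1%R).

Definition uniform_on_centered_disk mu : Prop :=
  exists2 r : R, (0 < r)%R &
    let D := [set x : R * R | (modc (toC x) < r)%R] in
    let leb2 := (lebesgue_measure \x lebesgue_measure)%E in
    forall A : set (R * R), measurable A -> mu A = leb2 (A `&` D) / leb2 D.

End wasserstein.

(* Main.v *)
(** If [nu 0] is uniform on the disk of radius [b], then [alpha0 r = r ^ 2 / b ^ 2] on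
[0, b], which determines [g] and turns the transport map into the real linear map
[w + (t / b ^ 2) * conj w].  By Jensen's formula on every circle, the potential at
[z] of the image of [nu 0] under this map is the integral over [0, 1] of the positive
part of the derivative of [ft g t _ z], hence the supremum that characterizes [nu t].
In coordinates rotated by half the argument of [t] all these linear maps are diagonal
with nonnegative entries, so that the displacement between any two of them is optimal.

Conversely, an optimal map is cyclically monotone.  Along the boundary of a polar
rectangle with radii [r1] and [r2] and with an angle of [pi / 2], subdivided finely in
the angular direction only, cyclical monotonicity yields
[modc t * r1 * r2 * `|k r2 - k r1| <= 2 * (r2 - r1) ^+ 2] with [k r = alpha0 r / r ^+ 2].
Hence [k] is constant, and the rotation invariant measure [nu 0] is uniform. *)

Require Import Defs.
From HB Require Import structures.
From mathcomp Require Import all_boot all_order all_algebra.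
From mathcomp Require Import all_classical all_reals all_analysis.
From mathcomp.real_closed Require Import complex.
From mathcomp Require Import measurable_realfun ring lra.

Set Implicit Arguments.
Unset Strict Implicit.
Unset Printing Implicit Defensive.

Import Order.TTheory GRing.Theory Num.Theory.
Import numFieldNormedType.Exports.

Local Open Scope classical_set_scope.
Local Open Scope ring_scope.
Local Open Scope complex_scope.

(** In the uniform case the bound by [t_sing g] enters as [modc t <= b ^ 2]: it keeps the smaller
    factor [1 - modc t / b ^ 2] of the linear map nonnegative and one of the two zeros in Jensen's
    formula inside the closed unit disk. The logarithm of the modulus of the other zero is the slope
    of the concave function [ft g t _ z], because both come from the same Joukowsky root. Optimality
    rests on one inequality per coordinate: a coupling of the laws of [al X] and [be X], with
    [al, be >= 0], costs at least [(al - be) ^ 2] times the second moment of [X]. In the converse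
    the obstacle is that an optimal map is controlled only almost everywhere, while a cycle consists
    of many related points. The cycle is therefore random: two independent points of law [nu 0]
    provide two radii and one direction, and every vertex again has law [nu 0]. *)

Section real_analysis.
Context {R : realType}.

(** Summing over [n] equal subintervals bounds [`|phi b - phi a|] by
[(b - a) * (om b - om a) / n]. *)
Lemma eq_of_variation_bound (phi om : R -> R) (a b : R) : a <= b ->
  (forall x y, a <= x -> x <= y -> y <= b ->
     `|phi y - phi x| <= (y - x) * (om y - om x)) ->
  phi a = phi b.
Proof.
move=> ab H.
have bound n : `|phi b - phi a| * n.+1%:R <= (b - a) * (om b - om a).
  pose d := (b - a) / n.+1%:R.
  have d0 : 0 <= d by rewrite divr_ge0// subr_ge0.
  have dn : n.+1%:R * d = b - a by rewrite mulrC divfK.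
  have step k : (k <= n.+1)%N ->
      `|phi (a + k%:R * d) - phi a| <= d * (om (a + k%:R * d) - om a).
    elim: k => [|k IH] kn; first by rewrite mul0r addr0 !subrr normr0 mulr0.
    have kd : a + k.+1%:R * d = a + k%:R * d + d by rewrite -natr1; ring.
    have akd : a <= a + k%:R * d by rewrite lerDl mulr_ge0.
    have kb : a + k.+1%:R * d <= b.
      rewrite -lerBrDl -dn; apply: ler_wpM2r => //.
      by rewrite ler_nat.
    have := H (a + k%:R * d) (a + k.+1%:R * d) akd _ kb.
    rewrite {1 3}kd lerDl => /(_ d0).
    rewrite [X in _ <= X * _ -> _](_ : _ = d); last by ring.
    have := IH (ltnW kn); set u := phi _; set v := phi _.
    move=> h1 h2; rewrite -(subrKA u) addrC.
    apply: le_trans (ler_normD _ _) _.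
    rewrite addrC; lra.
  have := step n.+1 (leqnn _); rewrite dn [a + _]addrC subrK.
  by rewrite -ler_pdivlMr// mulrAC.
apply/eqP; rewrite eq_sym -subr_eq0 -normr_eq0; apply/contraT => h.
have p0 : 0 < `|phi b - phi a| by rewrite lt_def h normr_ge0.
set c := (b - a) * (om b - om a) in bound.
have := bound (Num.bound (c / `|phi b - phi a|)).
rewrite -ler_pdivlMl// mulrC => hb.
have := archi_boundP (x := c / `|phi b - phi a|).
have c0 : 0 <= c by apply: le_trans (bound 0%N); rewrite mulr1.
move=> /(_ (divr_ge0 c0 (ltW p0))) hc.
rewrite mulrC in hb.
by have := lt_le_trans hc (le_trans _ hb); rewrite ltxx ler_nat leqnSn => ->.
Qed.

Lemma ln_leB1 (x : R) : 0 < x -> ln x <= x - 1.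
Proof. by move=> x0; have := @le_ln1Dx R (x - 1); rewrite subrKC; apply; lra. Qed.

Lemma ln_geBV (x : R) : 0 < x -> 1 - x^-1 <= ln x.
Proof.
move=> x0; have := @ln_leB1 x^-1; rewrite invr_gt0 lnV ?posrE// => /(_ x0); lra.
Qed.

Lemma nonneg_of_derive_ge0 (f df : R -> R) :
  (forall x : R, 1 <= x -> is_derive x 1 f (df x)) ->
  (forall x : R, 1 <= x -> 0 <= df x) ->
  f 1 = 0 -> forall x : R, 1 <= x -> 0 <= f x.
Proof.
move=> Df d0 f1 x x1; rewrite -f1.
apply: (@ger0_derive1_ndecry R f 1) => //.
- by move=> y; rewrite in_itv/= andbT => /ltW /Df [].
- by move=> y; rewrite in_itv/= andbT => /ltW y1; rewrite derive1E; have [_ ->] := Df _ y1; exact: d0.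
- apply: derivable_within_continuous => y; rewrite in_itv/= andbT.
  by move=> /Df [].
Qed.

(** With [y = exp s] this is [s <= sinh s]. The difference of the two sides has derivative
    [(1 - 1 / y) ^ 2 / 2]. *)
Lemma ln_le_sinh (y : R) : 1 <= y -> ln y <= (y - y^-1) / 2.
Proof.
move=> y1; rewrite -subr_ge0.
apply: (@nonneg_of_derive_ge0 (fun y => (y - y^-1) / 2 - ln y)
   (fun y => (1 - y^-1) ^+ 2 / 2)) y1 => {y}.
- move=> x x1; have x0 : 0 < x by lra.
  have xn : x != 0 by rewrite gt_eqF.
  have h1 := is_derive1_ln x0.
  have h2 : is_derive x 1 (fun y : R => y^-1) _ := is_deriveV xn (is_derive_id x 1).
  apply: is_derive_eq; rewrite /GRing.scale/=; field.
  by [].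
- by move=> x _; rewrite divr_ge0// sqr_ge0.
- by rewrite ln1 invr1; ring.
Qed.

(** With [x = exp (2 s)] this is [tanh s <= s] for [s >= 0]. *)
Lemma ln_ge_tanh (x : R) : 1 <= x -> 2 * (x - 1) / (x + 1) <= ln x.
Proof.
move=> x1; rewrite -subr_ge0.
apply: (@nonneg_of_derive_ge0 (fun y => ln y - 2 * (y - 1) / (y + 1))
   (fun y => (y - 1) ^+ 2 / (y * (y + 1) ^+ 2))) x1 => {x}.
- move=> x x1; have x0 : 0 < x by lra.
  have xn : x != 0 by rewrite gt_eqF.
  have xn1 : x + 1 != 0 by rewrite gt_eqF//; lra.
  have h1 := is_derive1_ln x0.
  have h3 : is_derive x 1 (fun y : R => y + 1) 1.
    by apply: is_derive_eq; rewrite addr0.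
  have h2 : is_derive x 1 (fun y : R => (y + 1)^-1) _ := @is_deriveV _ (fun y => y + 1) x 1 _ xn1 h3.
  apply: is_derive_eq; rewrite /GRing.scale/=; field.
  by rewrite xn xn1.
- by move=> x x1; rewrite divr_ge0// ?sqr_ge0// mulr_ge0 ?sqr_ge0//; lra.
- by rewrite ln1; ring.
Qed.

End real_analysis.

(** * Laws of maps and measurability of complex functions *)

Section law.
Context {R : realType} {d d' : measure_display} {T : measurableType d}
  {T' : measurableType d'}.
Implicit Types (P : probability T R) (f : T -> T').

Lemma eq_probability_integral (P Q : probability T R) (F : T -> \bar R) :
  (forall A, measurable A -> P A = Q A) ->
  (\int[P]_x F x = \int[Q]_x F x)%E.
Proof. by move=> PQ; apply: (eq_measure_integral Q) => A mA _; exact: PQ. Qed.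

(** The bundled measurable function needed for an image measure is packed here once; later proofs
    see only the values on sets and the integrals of nonnegative functions. *)
Lemma law_subproof P f (mf : measurable_fun setT f) :
  {Q : probability T' R | (forall A, Q A = P (f @^-1` A)) /\
    forall F : T' -> \bar R, measurable_fun [set: T'] F ->
      (forall y, 0 <= F y)%E -> (\int[Q]_y F y = \int[P]_x F (f x))%E}.
Proof.
exists (distribution P (HB.pack_for {mfun T >-> T'} f
  (isMeasurableFun.Build _ _ _ _ f mf))); split => // F mF F0.
by rewrite ge0_integral_distribution.
Qed.

Definition law P f (mf : measurable_fun setT f) : probability T' R :=
  sval (law_subproof P mf).

Lemma lawE P f (mf : measurable_fun setT f) A : law P mf A = P (f @^-1` A).
Proof. by rewrite /law; case: law_subproof => Q [/= -> _]. Qed.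

Lemma integral_law P f (mf : measurable_fun setT f) (F : T' -> \bar R) :
  measurable_fun [set: T'] F -> (forall y, 0 <= F y)%E ->
  (\int[law P mf]_y F y = \int[P]_x F (f x))%E.
Proof. by rewrite /law; case: law_subproof => Q [/= _]; apply. Qed.

End law.

Section complex_measurability.
Context {R : realType} {d : measure_display} {T : measurableType d}.
Implicit Types f g : T -> R[i].

Definition cmeasurable f := measurable_fun setT (ofC \o f).

Lemma cmeasurableP f : cmeasurable f <->
  measurable_fun setT (fun x => complex.Re (f x)) /\
  measurable_fun setT (fun x => complex.Im (f x)).
Proof. exact: measurable_fun_pairP. Qed.

Lemma cmeasurable_cst c : cmeasurable (fun=> c).
Proof. by apply/cmeasurableP; split; exact: measurable_cst. Qed.

Lemma cmeasurableC (h : T -> R) : measurable_fun setT h ->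
  cmeasurable (fun x => (h x)%:C).
Proof. by move=> mh; apply/cmeasurableP; split => //; exact: measurable_cst. Qed.

Lemma cmeasurableD f g : cmeasurable f -> cmeasurable g ->
  cmeasurable (fun x => f x + g x).
Proof.
move=> /cmeasurableP[f1 f2] /cmeasurableP[g1 g2]; apply/cmeasurableP; split.
- by under eq_fun do rewrite raddfD; exact: measurable_funD.
- by under eq_fun do rewrite raddfD; exact: measurable_funD.
Qed.

Lemma cmeasurableN f : cmeasurable f -> cmeasurable (fun x => - f x).
Proof.
move=> /cmeasurableP[f1 f2]; apply/cmeasurableP; split.
- by under eq_fun do rewrite raddfN; exact: measurableT_comp.
- by under eq_fun do rewrite raddfN; exact: measurableT_comp.
Qed.

Lemma ReM (z w : R[i]) : complex.Re (z * w) =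
  complex.Re z * complex.Re w - complex.Im z * complex.Im w.
Proof. by case: z w => [a b] [u v]. Qed.

Lemma ImM (z w : R[i]) : complex.Im (z * w) =
  complex.Re z * complex.Im w + complex.Im z * complex.Re w.
Proof. by case: z w => [a b] [u v]. Qed.

Lemma cmeasurableM f g : cmeasurable f -> cmeasurable g ->
  cmeasurable (fun x => f x * g x).
Proof.
move=> /cmeasurableP[f1 f2] /cmeasurableP[g1 g2]; apply/cmeasurableP; split.
- by under eq_fun do rewrite ReM; apply: measurable_funB; exact: measurable_funM.
- by under eq_fun do rewrite ImM; apply: measurable_funD; exact: measurable_funM.
Qed.

Lemma measurable_modc f : cmeasurable f ->
  measurable_fun setT (fun x => modc (f x)).
Proof.
move=> /cmeasurableP[f1 f2].
rewrite [X in measurable_fun _ X](_ : _ = fun x =>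
  Num.sqrt (complex.Re (f x) ^+ 2 + complex.Im (f x) ^+ 2)); last first.
  by apply/funext => x; rewrite /modc; case: (f x).
apply: measurableT_comp.
  by apply: continuous_measurable_fun; exact: sqrt_continuous.
by apply: measurable_funD; exact: measurable_funX.
Qed.

Lemma cmeasurable_conjc f : cmeasurable f -> cmeasurable (fun x => conjc (f x)).
Proof.
move=> /cmeasurableP[f1 f2]; apply/cmeasurableP; split.
- by rewrite (_ : (fun x => _) = (fun x => complex.Re (f x)))//; apply/funext => x; case: (f x).
- rewrite (_ : (fun x => _) = (fun x => - complex.Im (f x))); last by apply/funext => x; case: (f x).
  exact: measurableT_comp.
Qed.

End complex_measurability.

Arguments modc {R} z : simpl never.
Arguments toC {R} x : simpl never.

Section complex_modulus.
Context {R : realType}.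
Implicit Types (z w : R[i]).

Lemma ofCK : cancel (@ofC R) toC.
Proof. by case. Qed.

Lemma toCK : cancel (@toC R) ofC.
Proof. by case. Qed.

Lemma cmeasurable_toC : cmeasurable (@toC R).
Proof. by rewrite /cmeasurable (_ : _ \o _ = id)//; apply/funext; case. Qed.

Lemma ReD z w : complex.Re (z + w) = complex.Re z + complex.Re w.
Proof. by case: z w => [a b] [u v]. Qed.

Lemma ImD z w : complex.Im (z + w) = complex.Im z + complex.Im w.
Proof. by case: z w => [a b] [u v]. Qed.

Lemma ReN z : complex.Re (- z) = - complex.Re z.
Proof. by case: z. Qed.

Lemma ImN z : complex.Im (- z) = - complex.Im z.
Proof. by case: z. Qed.

Lemma Re_nat n : complex.Re (n%:R : R[i]) = n%:R.
Proof. by rewrite -(rmorph_nat (real_complex R)). Qed.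

Lemma Im_nat n : complex.Im (n%:R : R[i]) = 0.
Proof. by rewrite -(rmorph_nat (real_complex R)). Qed.

Lemma sqr_modc z : modc z ^+ 2 = complex.Re z ^+ 2 + complex.Im z ^+ 2.
Proof. by case: z => a b; rewrite /modc/= sqr_sqrtr// addr_ge0 ?sqr_ge0. Qed.

Lemma modc_ge0 z : 0 <= modc z.
Proof. by case: z => a b; rewrite /modc/= sqrtr_ge0. Qed.

Lemma modcM z w : modc (z * w) = modc z * modc w.
Proof. exact: Normc.normcM. Qed.

Lemma modcV z : modc z^-1 = (modc z)^-1.
Proof. exact: Normc.normcV. Qed.

Lemma modcN z : modc (- z) = modc z.
Proof. exact: normcN. Qed.

Lemma modcX z n : modc (z ^+ n) = modc z ^+ n.
Proof.
by elim: n => [|n IH]; rewrite ?expr0 ?[modc 1]Normc.normc1// !exprS modcM IH.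
Qed.

Lemma modc0 : modc (0 : R[i]) = 0.
Proof. exact: Normc.normc0. Qed.

Lemma modc1 : modc (1 : R[i]) = 1.
Proof. exact: Normc.normc1. Qed.

Lemma modc_eq0 z : (modc z == 0) = (z == 0).
Proof. by apply/eqP/eqP => [/Normc.eq0_normc//|->]; exact: modc0. Qed.

Lemma modc_gt0 z : (0 < modc z) = (z != 0).
Proof. by rewrite lt_def modc_ge0 andbT modc_eq0. Qed.

Lemma modcD z w : modc (z + w) <= modc z + modc w.
Proof. exact: le_normcD. Qed.

Lemma modcC (r : R) : modc r%:C = `|r|.
Proof. by rewrite /modc/= expr0n addr0 sqrtr_sqr. Qed.

Lemma modcJ z : modc (conjc z) = modc z.
Proof. by case: z => a b; rewrite /modc/= sqrrN. Qed.

Lemma mulcJ z : z * conjc z = (modc z ^+ 2)%:C.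
Proof.
rewrite sqr_modc; case: z => a b /=; apply/eqP; rewrite eq_complex/=; apply/andP.
by split; apply/eqP; ring.
Qed.

Lemma invcJ z : z^-1 = conjc z * ((modc z ^+ 2)^-1)%:C.
Proof.
have [->|z0] := eqVneq z 0; first by rewrite invr0 rmorph0 mul0r.
apply: (mulfI z0); rewrite mulrA mulfV// mulcJ -rmorphM mulfV//.
by rewrite expf_neq0// modc_eq0.
Qed.

Lemma modc_expi (th : R) : modc (expi th) = 1.
Proof. by rewrite /modc/= cos2Dsin2 sqrtr1. Qed.

Lemma expiD (a b : R) : expi (a + b) = expi a * expi b.
Proof. by rewrite /expi cosD sinD; simpc; rewrite [in sin a * _ + _]addrC. Qed.

Lemma expi0 : expi (0 : R) = 1.
Proof. by rewrite /expi cos0 sin0. Qed.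

Lemma expi_pihalf : expi (pi / 2 : R) = 'i.
Proof. by rewrite /expi cos_pihalf sin_pihalf. Qed.

Lemma expiMn (a : R) n : expi (n%:R * a) = expi a ^+ n.
Proof.
by elim: n => [|n IH]; rewrite ?mul0r ?expi0// -natr1 mulrDl mul1r expiD IH exprSr.
Qed.

Lemma unit_expi z : modc z = 1 -> exists2 th : R, - pi < th <= pi & z = expi th.
Proof.
case: z => a b z1; have := sqr_modc (a +i* b); rewrite z1 expr1n/= => ab.
have a1 : -1 <= a <= 1.
  by rewrite -ler_norml -(expr_le1 (n := 2))// real_normK ?num_real// ab lerDl sqr_ge0.
have sb : Num.sqrt (1 - a ^+ 2) = `|b|.
  by rewrite -sqrtr_sqr ab; congr Num.sqrt; ring.
have pi0 := pi_gt0 R.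
have [b0|b0] := leP 0 b.
  exists (acos a).
    by rewrite acos_lepi// andbT (lt_le_trans _ (acos_ge0 a1))// oppr_lt0.
  by rewrite /expi acosK// sin_acos// sb ger0_norm.
(* [a = -1] would force [b = 0]. Excluding it keeps the angle [- acos a] strictly above [- pi]. *)
have am1 : -1 < a <= 1.
  case/andP: a1 => + ->; rewrite le_eqVlt => /orP[/eqP aN1|->//].
  by move: ab sb; rewrite -aN1 sqrrN expr1n subrr sqrtr0 => _ /esym/eqP; rewrite normr_eq0 lt_eqF.
exists (- acos a).
  rewrite ltrN2 acos_ltpi//= lerNl (le_trans _ (acos_ge0 a1))// oppr_le0.
  exact: pi_ge0.
by rewrite /expi cosN sinN acosK// sin_acos// sb ltr0_norm// opprK.
Qed.

Lemma argcP z : z = (modc z)%:C * expi (argc z).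
Proof.
rewrite /argc; case: xgetP => [phi -> []//|] H; exfalso.
have [z0|z0] := eqVneq z 0.
  by apply: (H 0); rewrite /= z0 modc0 rmorph0 mul0r pi_ge0 oppr_lt0 pi_gt0.
have [th thp zE] : exists2 th : R, - pi < th <= pi & z / (modc z)%:C = expi th.
  apply: unit_expi; rewrite modcM modcV modcC ger0_norm ?modc_ge0//.
  by rewrite divff// modc_eq0.
apply: (H th); split => //; rewrite -zE mulrCA divff ?mulr1//.
by rewrite (inj_eq (@complexI _) _ 0) modc_eq0.
Qed.

End complex_modulus.

(** * Rotation invariant measures in polar coordinates *)

Section rotations.
Context {R : realType}.
Implicit Types (mu : probability (R * R)%type R) (s : R[i]).

Definition rot s (x : R * R) : R * R := ofC (s * toC x).

Definition modp (x : R * R) : R * R := ofC (modc (toC x))%:C.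

(** The value 1 at the origin makes it unimodular everywhere. Equivariance under rotations then
    fails at 0, which is why the origin is assumed to be a null set below. *)
Definition sgnc (z : R[i]) : R[i] := if z == 0 then 1 else z / (modc z)%:C.

Lemma modc_sgnc z : modc (sgnc z) = 1.
Proof.
rewrite /sgnc; case: eqVneq => [_|z0]; first exact: modc1.
by rewrite modcM modcV modcC ger0_norm ?modc_ge0// divff// modc_eq0.
Qed.

Lemma sgncM s z : modc s = 1 -> z != 0 -> sgnc (s * z) = s * sgnc z.
Proof.
move=> s1 z0; have s0 : s != 0 by rewrite -modc_eq0 s1 oner_eq0.
by rewrite /sgnc mulf_eq0 (negbTE s0) (negbTE z0)/= modcM s1 mul1r mulrA.
Qed.

Lemma sgncE z : z = (modc z)%:C * sgnc z.
Proof.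
rewrite /sgnc; case: eqVneq => [->|z0]; first by rewrite modc0 mulr1.
by rewrite mulrCA divff ?mulr1// (inj_eq (@complexI _) _ 0) modc_eq0.
Qed.

Lemma measurable_modc_toC : measurable_fun setT (fun x : R * R => modc (toC x)).
Proof. exact: measurable_modc (@cmeasurable_toC R). Qed.

Lemma measurable_modc_set d (T : measurableType d) (f : T -> R[i]) (B : set R) :
  cmeasurable f -> measurable B -> measurable [set x | B (modc (f x))].
Proof.
by move=> mf mB; rewrite -[X in measurable X]setTI; exact: (measurable_modc mf).
Qed.

Lemma measurable_rot s : measurable_fun setT (rot s).
Proof.
apply: (@cmeasurableM _ _ _ (fun=> s)); first exact: cmeasurable_cst.
exact: cmeasurable_toC.
Qed.

Lemma cmeasurable_sgnc : cmeasurable (fun x : R * R => sgnc (toC x)).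
Proof.
rewrite /cmeasurable (_ : _ \o _ = fun x : R * R => if modc (toC x) == 0
    then ofC 1 else ofC (toC x * (expR (- ln (modc (toC x))))%:C)); last first.
  apply/funext => x; rewrite /sgnc /= modc_eq0; case: eqVneq => // x0.
  by rewrite -fmorphV expRN lnK// posrE modc_gt0.
apply: measurable_fun_ifT; last 2 first.
- exact: measurable_cst.
- apply: (@cmeasurableM _ _ _ (@toC R)); first exact: cmeasurable_toC.
  apply: cmeasurableC; apply: measurableT_comp; first exact: measurable_expR.
  apply: measurableT_comp => //; apply: measurableT_comp => //.
  exact: measurable_modc_toC.
- by apply: measurable_fun_eqr => //; exact: measurable_modc_toC.
Qed.

Lemma rotation_invariant_preimage mu s A : rotation_invariant mu -> modc s = 1 ->
  measurable A -> mu (rot s @^-1` A) = mu A.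
Proof. by move=> mur /unit_expi[th _ ->] mA; rewrite -(mur th A mA). Qed.

Lemma integral_rot mu s (F : R * R -> \bar R) : rotation_invariant mu ->
  modc s = 1 -> measurable_fun setT F -> (forall x, 0 <= F x)%E ->
  (\int[mu]_x F (rot s x) = \int[mu]_x F x)%E.
Proof.
move=> mur s1 mF F0; rewrite -(integral_law mu (measurable_rot s))//.
by apply: eq_probability_integral => A mA; rewrite lawE rotation_invariant_preimage.
Qed.

(** For a rotation invariant [mu] without mass at 0 this is the uniform law on the unit circle,
    obtained from [mu] itself instead of from arc length. *)
Definition circle_law mu : probability (R * R)%type R := law mu cmeasurable_sgnc.

Lemma circle_law_unit mu : circle_law mu [set x | modc (toC x) != 1] = 0%E.
Proof.
rewrite lawE (_ : _ @^-1` _ = set0) ?measure0//.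
by apply/seteqP; split => // x /=; rewrite ofCK modc_sgnc eqxx.
Qed.

Lemma negligible_ae_eq mu (B : set (R * R)) (T : Type) (f g : R * R -> T) :
  measurable B -> mu B = 0%E -> (forall x, ~ B x -> f x = g x) ->
  ae_eq mu setT f g.
Proof.
move=> mB B0 H; exists B; split => // x /=.
by apply: contra_notP => /H fg _.
Qed.

Lemma measure_eq_mod_null mu (A B N : set (R * R)) :
  measurable A -> measurable B -> measurable N -> mu N = 0%E ->
  (forall x, ~ N x -> A x <-> B x) -> mu A = mu B.
Proof.
move=> mA mB mN N0 AB.
have diffN C : measurable C -> mu C = mu (C `\` N).
  move=> mC; rewrite (measureDI mu mC mN) [X in (_ + X)%E](_ : _ = 0%E) ?adde0//.
  by apply: subset_measure0 N0 => //; exact: measurableI.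
rewrite (diffN _ mA) (diffN _ mB); congr (mu _).
by apply/seteqP; split => x /= [+ xN]; move/AB: (xN) => ABx /ABx.
Qed.

Lemma measurable_origin : measurable [set (0 : R * R)].
Proof.
rewrite (_ : [set 0] = [set x | [set 0] (modc (toC x))]).
  by apply: measurable_modc_set => //; exact: cmeasurable_toC.
apply/seteqP; split => x /=; first by move=> ->; rewrite -[X in toC X]/(ofC 0) ofCK modc0.
by move=> /eqP; rewrite modc_eq0 => /eqP x0; rewrite -[x]toCK x0.
Qed.

Lemma circle_law_rotation_invariant mu : rotation_invariant mu ->
  mu [set 0] = 0%E -> rotation_invariant (circle_law mu).
Proof.
move=> mur mu0 th A mA; rewrite !lawE.
have mrA : measurable [set x : R * R | A (rot (expi th) x)].
  by rewrite -[X in measurable X]setTI; exact: (@measurable_rot (expi th)).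
have msA (B : set (R * R)) : measurable B -> measurable ((fun x => ofC (sgnc (toC x))) @^-1` B).
  by move=> mB; rewrite -[X in measurable X]setTI; exact: cmeasurable_sgnc.
rewrite -[RHS](rotation_invariant_preimage mur (modc_expi th)); last exact: msA.
apply: (measure_eq_mod_null _ _ measurable_origin mu0).
- exact: (msA _ mrA).
- by rewrite -[X in measurable X]setTI; apply: measurable_rot => //; exact: msA.
- move=> x x0; rewrite /= /rot !ofCK sgncM ?modc_expi//.
  by apply: contra_notN x0 => /eqP x0; rewrite -[x]toCK x0.
Qed.

Lemma measurable_mulplane : measurable_fun setT
  (fun p : (R * R) * (R * R) => rot (toC p.1) p.2).
Proof.
by apply: cmeasurableM; apply: measurableT_comp (@cmeasurable_toC R) _.
Qed.

Section polar.
Variable mu : probability (R * R)%type R.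
Hypotheses (mur : rotation_invariant mu) (mu0 : mu [set 0] = 0%E).
Variable F : R * R -> \bar R.
Hypotheses (mF : measurable_fun [set: R * R] F) (F0 : forall x, (0 <= F x)%E).

(** Rotating by a unimodular [y] does not change the integral; averaging over [y] and exchanging the
    integrals by Tonelli gives the claim. *)
Lemma integral_polar :
  (\int[mu]_x F x = \int[mu]_x \int[circle_law mu]_y F (rot (toC y) x))%E.
Proof.
rewrite -(fubini_tonelli (m1 := circle_law mu) (m2 := mu)
  (fun p => F (rot (toC p.1) p.2)))//=; last first.
  exact: measurableT_comp measurable_mulplane.
transitivity (\int[circle_law mu]_y \int[mu]_x F x)%E.
  by rewrite integral_cst// [X in (_ * X)%E]probability_setT mule1.
apply: ae_eq_integral => //.
  apply: (@measurable_fun_fubini_tonelli_F _ _ _ _ _ mu (fun p => F (rot (toC p.1) p.2))) => //.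
  exact: measurableT_comp measurable_mulplane.
apply: (negligible_ae_eq _ (circle_law_unit mu)).
  rewrite (_ : [set _ | _] = [set x | (~` [set 1]) (modc (toC x))]).
    apply: measurable_modc_set; first exact: cmeasurable_toC.
    exact: measurableC.
  by apply/seteqP; split => x /= /eqP.
move=> y /= /negP; rewrite negbK => /eqP y1.
by rewrite -(integral_rot mur y1).
Qed.

(** The inner average absorbs the phase of [x], so that only its modulus remains and the angle is
    independent of the radius. *)
Lemma integral_polar_modc :
  (\int[mu]_x F x =
   \int[mu]_x \int[circle_law mu]_y F (rot (toC y) (modp x)))%E.
Proof.
rewrite integral_polar; apply: eq_integral => x _.
have lr := circle_law_rotation_invariant mur mu0.
rewrite -(integral_rot lr (modc_sgnc (toC x)) (F := fun y => F (rot (toC y) (modp x))))//.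
  apply: eq_integral => y _; rewrite /rot !ofCK [in LHS](sgncE (toC x)).
  by congr (F (ofC _)); ring.
apply: measurableT_comp => //; apply: cmeasurableM.
- exact: cmeasurable_toC.
- exact: cmeasurable_cst.
Qed.

End polar.

End rotations.

(** * Jensen's formula on the circle *)

Section integral_bounds.
Context {R : realType} {d : measure_display} {T : measurableType d}.
Variable P : probability T R.

Lemma integrable_of_bound (f : T -> R) (C : R) : measurable_fun setT f ->
  (forall x, `|f x| <= C) -> P.-integrable setT (EFin \o f).
Proof.
move=> mf fC; apply: measurable_bounded_integrable => //.
  by rewrite [X in (X < _)%E]probability_setT ltry.
exists C; split; first exact: num_real.
by move=> y Cy x _ /=; apply: le_trans (fC x) (ltW Cy).
Qed.

Lemma normr_Rintegral_le (f : T -> R) (C : R) : measurable_fun setT f ->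
  (forall x, `|f x| <= C) -> `|\int[P]_x f x| <= C.
Proof.
move=> mf fC; have fi := integrable_of_bound mf fC.
apply: le_trans (le_normr_Rintegral _ fi) _ => //.
have -> : C = \int[P]_(x in setT) C.
  by rewrite Rintegral_cst// [X in fine X]probability_setT mulr1.
apply: le_Rintegral => //.
  by apply: (integrable_of_bound (C := C)); [exact: measurableT_comp|move=> x; rewrite normr_id].
by apply: (integrable_of_bound (C := `|C|)) => //; exact: measurable_cst.
Qed.

Lemma measurable_lne_EFin (f : T -> R) : measurable_fun setT f ->
  measurable_fun setT (fun x => lne (f x)%:E).
Proof.
move=> mf; rewrite (_ : (fun x => _) = fun x => if f x <= 0 then -oo%E else (ln (f x))%:E).
  apply: measurable_fun_ifT => //; first exact: measurable_fun_ler.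
  by apply/measurable_EFinP; exact: measurableT_comp.
apply/funext => x; case: ifPn => [h|]; first by rewrite le0_lneNy.
by rewrite -ltNge => h; rewrite lne_EFin.
Qed.

End integral_bounds.

Section jensen.
Context {R : realType} {d : measure_display} {T : measurableType d}.
Variables (P : probability T R) (u : T -> R[i]).
Hypotheses (mu : cmeasurable u) (u1 : forall x, modc (u x) = 1).
Hypothesis urot : forall s, modc s = 1 -> forall F : R * R -> \bar R,
  measurable_fun setT F -> (forall y, (0 <= F y)%E) ->
  (\int[P]_x F (rot s (ofC (u x))) = \int[P]_x F (ofC (u x)))%E.

Let cmeasurable_u (s : R[i]) : cmeasurable (fun x => s * u x).
Proof. by apply: cmeasurableM => //; exact: cmeasurable_cst. Qed.

(** The invariance hypothesis speaks of nonnegative integrands only. Adding [C] makes [f]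
    nonnegative on the circle, and the maximum with 0 does so on the rest of the plane. *)
Lemma Rintegral_rotate (s : R[i]) (f : R[i] -> R) (C : R) : modc s = 1 ->
  measurable_fun setT (f \o @toC R) ->
  (forall z, modc z = 1 -> `|f z| <= C) ->
  \int[P]_x f (s * u x) = \int[P]_x f (u x).
Proof.
move=> s1 mf fC.
have mfs (v : T -> R[i]) : cmeasurable v -> measurable_fun setT (fun x => f (v x)).
  move=> mv; rewrite (_ : (fun x => _) = (f \o @toC R) \o (ofC \o v)).
    exact: measurableT_comp.
  by apply/funext => x /=; rewrite ofCK.
have shift (v : T -> R[i]) : cmeasurable v -> (forall x, modc (v x) = 1) ->
    (\int[P]_x (Num.max 0 (f (v x) + C))%:E = (\int[P]_x f (v x) + C)%:E)%E.
  move=> mv v1; under eq_integral.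
    move=> x _; rewrite max_r; last first.
      by have := fC _ (v1 x); rewrite ler_norml -subr_ge0 opprK => /andP[].
    over.
  have fi : P.-integrable setT (EFin \o (fun x => f (v x))).
    by apply: (integrable_of_bound P (C := C)); [exact: mfs|move=> x; exact: fC].
  under eq_integral do rewrite EFinD.
  rewrite integralD//; last first.
    by apply: (integrable_of_bound P (C := `|C|)) => //; exact: measurable_cst.
  rewrite EFinD integral_cst// [X in (_ + _ * X)%E]probability_setT mule1.
  by rewrite /Rintegral fineK//; exact: integrable_fin_num.
pose F (y : R * R) := (Num.max 0 (f (toC y) + C))%:E.
have mF : measurable_fun setT F.
  apply/measurable_EFinP; apply: measurable_maxr; first exact: measurable_cst.
  by apply: measurable_funD => //; exact: measurable_cst.
have := urot s1 mF; rewrite /F => /(_ (fun y => ltac:(by rewrite lee_fin le_max lexx))).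
under eq_integral do rewrite /rot !ofCK.
under [in RHS]eq_integral do rewrite ofCK.
rewrite !shift//; last by move=> x; rewrite modcM s1 u1 mulr1.
by move=> [] /addIr.
Qed.

Let Iln N b : R := \int[P]_x ln (modc (u x ^+ N - b)).

(** The distance lies between [1 - modc b] and [1 + modc b], and the latter is at most the inverse
    of the former. *)
Lemma ln_dist_unit_bound (z b : R[i]) : modc z = 1 -> modc b < 1 ->
  `|ln (modc (z - b))| <= - ln (1 - modc b).
Proof.
move=> z1 b1.
have lo : 1 - modc b <= modc (z - b).
  by rewrite lerBlDr -z1 -{1}(subrK b z); exact: modcD.
have hi : modc (z - b) <= 1 + modc b by rewrite -z1 -[modc b]modcN; exact: modcD.
have p0 : 0 < 1 - modc b by rewrite subr_gt0.
rewrite ler_norml opprK ler_ln ?posrE ?lo//=; last exact: lt_le_trans lo.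
rewrite -lnV ?posrE// ler_ln ?posrE ?invr_gt0//; last exact: lt_le_trans lo.
apply: le_trans hi _; rewrite -[leRHS]mul1r ler_pdivlMr//.
by have := sqr_ge0 (modc b); have := modc_ge0 b; nra.
Qed.

Lemma cmeasurableX d' (T' : measurableType d') (f : T' -> R[i]) n :
  cmeasurable f -> cmeasurable (fun x => f x ^+ n).
Proof.
move=> mf; elim: n => [|n IH]; first exact: cmeasurable_cst.
under [X in cmeasurable X]eq_fun do rewrite exprS.
exact: cmeasurableM.
Qed.

Lemma measurable_ln_dist d' (T' : measurableType d') (f : T' -> R[i]) b :
  cmeasurable f -> measurable_fun setT (fun x => ln (modc (f x - b))).
Proof.
move=> mf; apply: measurableT_comp => //; apply: measurable_modc.
by apply: cmeasurableD => //; exact: cmeasurable_cst.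
Qed.

(** [z ^ 2N - b ^ 2] is the product of [z ^ N - b] and [z ^ N + b]; rotating [z] by
an [N]-th root of -1 exchanges the two factors. *)
Lemma Iln_double N b : (0 < N)%N -> modc b < 1 ->
  Iln (N.*2) (b ^+ 2) = 2 * Iln N b.
Proof.
move=> N0 b1.
have ub x : modc (u x ^+ N) = 1 by rewrite modcX u1 expr1n.
have mI c : measurable_fun setT (fun x => ln (modc (u x ^+ N - c))).
  by apply: measurable_ln_dist; exact: cmeasurableX.
have iI c : modc c < 1 -> P.-integrable setT (EFin \o (fun x => ln (modc (u x ^+ N - c)))).
  move=> c1; apply: (integrable_of_bound P (C := - ln (1 - modc c))) => // x.
  exact: ln_dist_unit_bound.
have posd c x : modc c < 1 -> 0 < modc (u x ^+ N - c).
  move=> c1; rewrite modc_gt0 subr_eq0; apply: contraTneq c1 => <-.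
  by rewrite ub ltxx.
have -> : Iln N.*2 (b ^+ 2) = Iln N b + Iln N (- b).
  rewrite /Iln -RintegralD//; [|exact: iI|by apply: iI; rewrite modcN].
  apply: eq_Rintegral => x _; rewrite -lnM ?posrE ?posd ?modcN// -modcM.
  by congr (ln (modc _)); rewrite -muln2 exprM; ring.
pose s : R[i] := expi (pi / N%:R).
have sN : s ^+ N = -1.
  rewrite -expiMn mulrCA divff ?mulr1 ?pnatr_eq0 -?lt0n//.
  by rewrite /expi cospi sinpi; apply/eqP; rewrite eq_complex/= oppr0 !eqxx.
have -> : Iln N (- b) = Iln N b; last by ring.
rewrite /Iln -(@Rintegral_rotate s (fun z => ln (modc (z ^+ N - b))) (- ln (1 - modc b))).
- apply: eq_Rintegral => x _; rewrite exprMn sN; congr ln.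
  by rewrite -modcN; congr modc; ring.
- exact: modc_expi.
- apply: measurable_ln_dist; apply: cmeasurableX; exact: cmeasurable_toC.
- by move=> z z1; apply: ln_dist_unit_bound => //; rewrite modcX z1 expr1n.
Qed.

(** Iterated doubling gives [2 ^ k] times the mean as the mean for exponent [2 ^ k] and point
    [a ^ (2 ^ k)]. As these points stay in the disk of radius [modc a], all those means obey the
    same bound [C], so the original one vanishes. *)
Lemma mean_ln_dist_lt1 a : modc a < 1 -> \int[P]_x ln (modc (u x - a)) = 0.
Proof.
move=> a1.
have pow k : modc (a ^+ (2 ^ k)) <= modc a.
  by rewrite modcX; apply: ler_iXnr => //; [rewrite expn_gt0|exact: modc_ge0|exact: ltW].
have E k : Iln (2 ^ k) (a ^+ (2 ^ k)) = (2 ^+ k) * Iln 1 a.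
  elim: k => [|k IH]; first by rewrite expn0 expr0 mul1r expr1.
  rewrite expnSr muln2 -muln2 exprM muln2 Iln_double ?expn_gt0//; last exact: le_lt_trans a1.
  by rewrite IH exprS mulrA.
set C := - ln (1 - modc a).
have B k : `|Iln (2 ^ k) (a ^+ (2 ^ k))| <= C.
  apply: normr_Rintegral_le; first by apply: measurable_ln_dist; exact: cmeasurableX.
  move=> x; apply: le_trans (ln_dist_unit_bound _ _) _.
  - by rewrite modcX u1 expr1n.
  - exact: le_lt_trans a1.
  - by rewrite lerN2 ler_ln ?posrE ?subr_gt0 ?lerD2l ?lerN2//; exact: le_lt_trans a1.
rewrite -[LHS]/(\int[P]_x ln (modc (u x ^+ 1 - a))) -/(Iln 1 a).
apply/eqP/contraT => I0.
have p0 : 0 < `|Iln 1 a| by rewrite normr_gt0.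
have := archi_boundP (x := C / `|Iln 1 a|).
have C0 : 0 <= C by apply: le_trans (B 0%N).
move=> /(_ (divr_ge0 C0 (ltW p0))); set k := Num.bound _.
have := B k; rewrite E normrM ger0_norm ?exprn_ge0// -ler_pdivlMr// => h1 h2.
have := lt_le_trans h2 (le_trans _ h1); rewrite ltxx => -> //.
by rewrite -natrX ler_nat ltnW// ltn_expl.
Qed.

(** Inversion in the unit circle; it reduces an exterior point to an interior one. *)
Lemma dist_reflect (z a : R[i]) : modc z = 1 -> a != 0 ->
  modc (z - a) = modc a * modc (z - conjc a^-1).
Proof.
move=> z1 a0; have -> : modc (z - conjc a^-1) = modc (conjc z - a^-1).
  by rewrite -modcJ; congr modc; rewrite rmorphB/= conjcK.
rewrite -modcM -[RHS]mul1r -z1 -modcM -modcN; congr modc.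
have zz : z * conjc z = 1 by rewrite mulcJ z1 expr1n.
rewrite mulrBr mulfV// mulrBr mulr1 mulrCA zz; ring.
Qed.

Lemma mean_ln_dist_gt1 a : 1 < modc a ->
  (forall x, `|ln (modc (u x - a))| <= ln (modc a) - ln (1 - (modc a)^-1)) /\
  \int[P]_x ln (modc (u x - a)) = ln (modc a).
Proof.
move=> a1; have a0 : a != 0 by rewrite -modc_gt0; exact: lt_trans a1.
have p0 : 0 < modc a by exact: lt_trans a1.
have b1 : modc (conjc a^-1) < 1 by rewrite modcJ modcV invf_lt1.
have E x : ln (modc (u x - a)) = ln (modc a) + ln (modc (u x - conjc a^-1)).
  rewrite dist_reflect// lnM ?posrE// modc_gt0 subr_eq0.
  by apply: contraTneq b1 => <-; rewrite u1 ltxx.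
have B x := ln_dist_unit_bound (u1 x) b1; rewrite modcJ modcV in B.
split=> [x|].
  rewrite E; apply: le_trans (ler_normD _ _) _; rewrite ger0_norm ?lerD2l//.
  exact/ln_ge0/ltW.
under eq_Rintegral do rewrite E.
rewrite RintegralD//.
- rewrite mean_ln_dist_lt1// addr0 Rintegral_cst//.
  by rewrite [X in fine X]probability_setT mulr1.
- by apply: (integrable_of_bound P (C := `|ln (modc a)|)) => //; exact: measurable_cst.
- apply: (integrable_of_bound P (C := - ln (1 - (modc a)^-1))) => //.
  exact: measurable_ln_dist.
Qed.

Lemma integral_lne_dist_neq1 a : modc a != 1 ->
  P.-integrable setT (fun x => lne (modc (u x - a))%:E) /\
  (\int[P]_x lne (modc (u x - a))%:E = (ln (Num.max 1 (modc a)))%:E)%E.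
Proof.
move=> a1; have nz x : 0 < modc (u x - a).
  by rewrite modc_gt0 subr_eq0; apply: contraNneq a1 => <-; rewrite u1.
have -> : (fun x => lne (modc (u x - a))%:E) = EFin \o (fun x => ln (modc (u x - a))).
  by apply/funext => x; rewrite lne_EFin.
have [C BC] : exists C, forall x, `|ln (modc (u x - a))| <= C.
  move: a1; rewrite neq_lt => /orP[a1|a1].
    by exists (- ln (1 - modc a)) => x; exact: ln_dist_unit_bound.
  by eexists; exact: (mean_ln_dist_gt1 a1).1.
have I : P.-integrable setT (EFin \o (fun x => ln (modc (u x - a)))).
  by apply: integrable_of_bound BC; exact: measurable_ln_dist.
split => //.
rewrite -[LHS]fineK; last exact: integrable_fin_num.
congr EFin; rewrite -/(Rintegral _ _ _).
move: a1; rewrite neq_lt => /orP[a1|a1].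
  by rewrite max_l ?ltW// ln1 mean_ln_dist_lt1.
by rewrite max_r ?ltW// (mean_ln_dist_gt1 a1).2.
Qed.

Lemma modc_dist_homo (z a : R[i]) (r s : R) : modc z = 1 -> modc a = 1 ->
  1 <= r -> r <= s -> modc (z - r%:C * a) <= modc (z - s%:C * a).
Proof.
move=> z1 a1 r1 rs; rewrite -(ler_pXn2r (n := 2)) ?nnegrE ?modc_ge0//.
move: z1 a1; case: z => z1 z2; case: a => a1 a2 hz ha.
have := sqr_modc (z1 +i* z2); have := sqr_modc (a1 +i* a2).
rewrite hz ha expr1n/= => h1 h2; rewrite !sqr_modc/=.
have h3 := sqr_ge0 (z1 - a1); have h4 := sqr_ge0 (z2 - a2).
have h5 : a1 * z1 + a2 * z2 <= 1 by lra.
(* The difference of the squared distances is [(s - r) * (s + r - 2 <a, z>)], and the scalar product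
   [<a, z>] is at most 1, hence at most [r]. *)
rewrite -subr_ge0 [X in 0 <= X](_ : _ = (s - r) * (s + r - 2 * (a1 * z1 + a2 * z2)) ); last first.
  have -> : (s - r) * (s + r - 2 * (a1 * z1 + a2 * z2)) = (s ^+ 2 - r ^+ 2) * (a1 ^+ 2 + a2 ^+ 2) -
    2 * (s - r) * (a1 * z1 + a2 * z2) by rewrite -h1; ring.
  ring.
by apply: mulr_ge0; lra.
Qed.

(** A point on the circle is approached radially from outside, by [r n * a]. The distances to [u x]
    decrease to their limit and are at most [1 + 2 = 3], so [ln 3] minus their logarithms is
    nonnegative and increasing, and monotone convergence applies, with limit [+oo] where
    [u x = a]. *)
Lemma integral_lne_dist_eq1 a : modc a = 1 ->
  P.-integrable setT (fun x => lne (modc (u x - a))%:E) /\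
  (\int[P]_x lne (modc (u x - a))%:E = 0)%E.
Proof.
move=> a1; pose r (n : nat) : R := 1 + n.+1%:R^-1.
have r1 n : 1 < r n by rewrite ltrDl invr_gt0.
have r2 n : r n <= 2 by rewrite lerD2l invf_le1// ler1n.
have ra n : modc ((r n)%:C * a) = r n.
  by rewrite modcM a1 mulr1 modcC ger0_norm// ltW// (lt_trans _ (r1 n)).
have dpos n x : 0 < modc (u x - (r n)%:C * a).
  rewrite modc_gt0 subr_eq0; apply/eqP => E.
  by have := r1 n; rewrite -[X in _ < X](ra n) -E u1 ltxx.
have d3 n x : modc (u x - (r n)%:C * a) <= 3.
  apply: le_trans (modcD _ _) _; rewrite modcN u1 ra; have := r2 n; lra.
pose G n x := (ln 3 - ln (modc (u x - (r n)%:C * a)))%:E.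
have mG n : measurable_fun setT (G n).
  apply/measurable_EFinP; apply: measurable_funB; first exact: measurable_cst.
  exact: measurable_ln_dist.
have G0 n x : setT x -> (0 <= G n x)%E.
  by move=> _; rewrite lee_fin subr_ge0 ler_ln ?posrE.
have ndG x : setT x -> {homo G^~ x : n m / (n <= m)%N >-> (n <= m)%E}.
  move=> _ n m nm; rewrite lee_fin lerD2l lerN2 ler_ln ?posrE//.
  apply: modc_dist_homo => //; first exact: ltW.
  by rewrite lerD2l lef_pV2 ?posrE ?ltr0n// ler_nat.
have IG n : (\int[P]_x G n x = (ln 3 - ln (r n))%:E)%E.
  have [I E] := @integral_lne_dist_neq1 ((r n)%:C * a) (ltac:(by rewrite ra gt_eqF)).
  rewrite [LHS](_ : _ = \int[P]_x ((ln 3)%:E - lne (modc (u x - (r n)%:C * a))%:E))%E.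
    rewrite integralB//; last first.
      apply: (@integrable_of_bound _ _ _ P (fun=> ln 3) `|ln 3|) => //; exact: measurable_cst.
    rewrite E integral_cst// [X in (_ * X - _)%E]probability_setT mule1.
    by rewrite ra max_r// ltW.
  by apply: eq_integral => x _; rewrite lne_EFin.
have limG x : G^~ x @ \oo --> ((ln 3)%:E - lne (modc (u x - a))%:E)%E.
  have [ua|ua] := eqVneq (u x) a.
    rewrite ua subrr modc0 le0_lneNy//=; apply/cvgeyPge => M.
    near=> n; rewrite lee_fin ua.
    rewrite -[X in modc (X - _)]mul1r -mulrBl modcM a1 mulr1.
    rewrite [X in modc X](_ : _ = (- n.+1%:R^-1 : R)%:C); last first.
      by rewrite rmorphD rmorph1 opprD addrA subrr add0r rmorphN.
    rewrite modcC normrN ger0_norm// lnV ?posrE// opprK.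
    rewrite -lerBlDl -[M - ln 3]expRK ler_ln ?posrE ?expR_gt0//.
    near: n; exists (Num.bound (expR (M - ln 3))) => // m /= hm.
    apply: le_trans (ltW (archi_boundP (expR_ge0 _))) _.
    by rewrite ler_nat (leq_trans hm).
  have p0 : 0 < modc (u x - a) by rewrite modc_gt0 subr_eq0.
  rewrite lne_EFin// -EFinB; apply: cvg_EFin; first exact: nearW.
  apply: cvgB; first exact: cvg_cst.
  apply: (@continuous_cvg _ _ _ _ _ _ (@ln R)); first exact: continuous_ln.
  apply: (@squeeze_cvgr _ _ _ _ (fun=> modc (u x - a)) (fun n => modc (u x - a) + n.+1%:R^-1)).
  - apply: nearW => n; apply/andP; split.
      have := @modc_dist_homo (u x) a 1 (r n) (u1 x) a1 (lexx _) (ltW (r1 n)).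
      by rewrite mul1r.
    rewrite [X in modc X <= _](_ : _ = (u x - a) + (- n.+1%:R^-1 : R)%:C * a); last first.
      by rewrite rmorphD rmorph1 rmorphN; ring.
    apply: le_trans (modcD _ _) _.
    by rewrite modcM a1 mulr1 modcC normrN ger0_norm.
  - exact: cvg_cst.
  - rewrite -[X in _ --> X]addr0; apply: cvgD; first exact: cvg_cst.
    exact: cvg_harmonic.
have mc := monotone_convergence P measurableT mG G0 ndG.
have I3 : (\int[P]_x ((ln 3)%:E - lne (modc (u x - a))%:E) = (ln 3)%:E)%E.
  rewrite [LHS](_ : _ = \int[P]_x (limn (G^~ x)))%E; last first.
    by apply: eq_integral => x _; apply/esym/cvg_lim => //; exact: limG.
  rewrite mc; apply/cvg_lim => //; rewrite [X in X @ _ --> _](_ : _ = fun n => (ln 3 - ln (r n))%:E); last first.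
    by apply/funext => n; exact: IG.
  apply: cvg_EFin; first exact: nearW.
  rewrite -[X in _ --> X]subr0; apply: cvgB; first exact: cvg_cst.
  rewrite -(@ln1 R); apply: (@continuous_cvg _ _ _ _ _ _ (@ln R)); first exact: continuous_ln.
  rewrite -[X in _ --> X]addr0; apply: cvgD; first exact: cvg_cst.
  exact: cvg_harmonic.
have ge3 x : (0 <= (ln 3)%:E - lne (modc (u x - a))%:E)%E.
  by apply: (cvge_to_ge (limG x)); apply: nearW => n; exact: G0.
have mL : measurable_fun setT (fun x => lne (modc (u x - a))%:E).
  apply: measurable_lne_EFin; apply: measurable_modc; apply: cmeasurableD => //.
  exact: cmeasurable_cst.
have i3 : P.-integrable setT (cst (ln 3)%:E).
  by apply: (@integrable_of_bound _ _ _ P (fun=> ln 3) `|ln 3|) => //; exact: measurable_cst.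
have I : P.-integrable setT (fun x => (ln 3)%:E - lne (modc (u x - a))%:E)%E.
  apply/integrableP; split; first exact: emeasurable_funB.
  by under eq_integral do rewrite gee0_abs//; rewrite I3 ltry.
have E x : (lne (modc (u x - a))%:E = (ln 3)%:E - ((ln 3)%:E - lne (modc (u x - a))%:E))%E.
  by case: (lne _) => [v| |]//=; rewrite -!EFinB; congr EFin; ring.
split; first by under eq_fun do rewrite E; exact: integrableB.
under eq_integral do rewrite E.
rewrite integralB// I3 integral_cst// [X in (_ * X - _)%E]probability_setT mule1.
by rewrite -EFinB subrr.
Unshelve. all: by end_near. Qed.

Lemma jensen_unit a : P.-integrable setT (fun x => lne (modc (u x - a))%:E) /\
  (\int[P]_x lne (modc (u x - a))%:E = (ln (Num.max 1 (modc a)))%:E)%E.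
Proof.
have [a1|] := eqVneq (modc a) 1; last exact: integral_lne_dist_neq1.
by rewrite a1 max_l// ln1; exact: integral_lne_dist_eq1.
Qed.

End jensen.

(** * Integrals over a uniform radial parameter as increments of a primitive *)

Section radial_integral.
Context {R : realType} {d : measure_display} {T : measurableType d}.
Variables (P : probability T R) (rho : T -> R).
Hypothesis mrho : measurable_fun setT rho.
Hypothesis rhoP : forall r, 0 <= r <= 1 -> P [set x | rho x < r] = r%:E.

Let shell (a b : R) : set T := rho @^-1` `[a, b[.

Let measurable_shell a b : measurable (shell a b).
Proof. by rewrite -[X in measurable X]setTI; apply: mrho. Qed.

Let shellP a b : 0 <= a -> a <= b -> b <= 1 -> P (shell a b) = (b - a)%:E.
Proof.
move=> a0 ab b1.
have mlt r : measurable [set x | rho x < r].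
  rewrite (_ : [set _ | _] = rho @^-1` `]-oo, r[); last first.
    by apply/seteqP; split => x /=; rewrite in_itv.
  by rewrite -[X in measurable X]setTI; apply: mrho.
have -> : shell a b = [set x | rho x < b] `\` [set x | rho x < a].
  apply/seteqP; split => x; rewrite /shell /= in_itv/=.
    by move=> /andP[ax xb]; split=> //; apply/negP; rewrite -leNgt.
  by move=> [xb /negP]; rewrite -leNgt xb => ->.
rewrite measureD//; last by apply: le_lt_trans (probability_le1 _ _) _; rewrite ?ltry.
rewrite setIidr; last by move=> x /= /lt_le_trans; apply.
rewrite EFinB -(rhoP (r := b)) ?b1 ?(le_trans a0)//.
by rewrite -(rhoP (r := a)) ?a0 ?(le_trans ab).
Qed.

Variables (h F : R -> R) (F0 : R).
Hypothesis mh : measurable_fun setT (h \o rho).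
Hypothesis h0 : forall x, 0 < x <= 1 -> 0 <= h x.
Hypothesis sandwich : forall x y, 0 < x -> x <= y -> y <= 1 ->
  (y - x) * h y <= F y - F x <= (y - x) * h x.

Let hmono x y : 0 < x -> x <= y -> y <= 1 -> h y <= h x.
Proof.
rewrite le_eqVlt => x0 /orP[/eqP->//|xy] y1.
have := sandwich x0 (ltW xy) y1 => /andP[h1 h2].
by have := le_trans h1 h2; rewrite ler_pM2l// subr_gt0.
Qed.

Let hE : measurable_fun setT (fun x => (h (rho x))%:E).
Proof. exact/measurable_EFinP. Qed.

Let shell_bounds a b : 0 < a -> a <= b -> b <= 1 ->
  (((b - a) * h b)%:E <= \int[P]_(x in shell a b) (h (rho x))%:E
     <= ((b - a) * h a)%:E)%E.
Proof.
move=> a0 ab b1; have sP := shellP (ltW a0) ab b1.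
have hb0 : 0 <= h b by rewrite h0// (lt_le_trans a0 ab).
have ha0 : 0 <= h a by rewrite h0// a0 (le_trans ab).
have hmem x : shell a b x -> h b <= h (rho x) <= h a.
  rewrite /shell/= in_itv/= => /andP[ax xb].
  have x0 := lt_le_trans a0 ax.
  by rewrite !hmono// ?ltW// (lt_le_trans xb).
apply/andP; split.
  rewrite mulrC EFinM -sP -integral_cst//; apply: ge0_le_integral => //.
  - exact: measurable_funTS hE.
  - by move=> x /hmem /andP[]; rewrite lee_fin.
rewrite mulrC EFinM -sP -integral_cst//; apply: ge0_le_integral => //.
- by move=> x /hmem /andP[h1 _]; rewrite lee_fin (le_trans hb0).
- exact: measurable_funTS hE.
- by move=> x /hmem /andP[_]; rewrite lee_fin.
Qed.

(** The integral over [[a, b[], as a function of [b], obeys the same sandwich as [F]. The increments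
    of the difference are therefore at most [(y - x) * (h x - h y)], and [eq_of_variation_bound]
    makes it constant. No derivative of [F] is taken. *)
Let integral_shell a : 0 < a -> a <= 1 ->
  (\int[P]_(x in shell a 1) (h (rho x))%:E = (F 1 - F a)%:E)%E.
Proof.
move=> a0 a1; pose Phi b := fine (\int[P]_(x in shell a b) (h (rho x))%:E)%E.
have fin x y : 0 < x -> x <= y -> y <= 1 ->
    (\int[P]_(x in shell x y) (h (rho x))%:E)%E \is a fin_num.
  move=> x0 xy y1; have /andP[l u] := shell_bounds x0 xy y1.
  by rewrite fin_real// (lt_le_trans _ l) ?ltNyr// (le_lt_trans u) ?ltry.
have PhiB x y : a <= x -> x <= y -> y <= 1 ->
    (y - x) * h y <= Phi y - Phi x <= (y - x) * h x.
  move=> ax xy y1; have x0 := lt_le_trans a0 ax.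
  have -> : Phi y - Phi x = fine (\int[P]_(z in shell x y) (h (rho z))%:E)%E.
    rewrite /Phi; have -> : shell a y = shell a x `|` shell x y.
      apply/seteqP; split => z; rewrite /shell/= !in_itv/=.
        by move=> /andP[az zy]; have [|] := ltP (rho z) x; [left; rewrite az|right].
      by move=> [/andP[-> zx]|/andP[xz ->]]; rewrite ?(lt_le_trans zx)// (le_trans ax).
    have dis : [disjoint shell a x & shell x y].
      rewrite disj_set2E; apply/eqP; rewrite -subset0 => z [].
      by rewrite /shell/= !in_itv/= => /andP[_ zx] /andP[]; rewrite leNgt zx.
    rewrite ge0_integral_setU//; last 2 first.
    - exact: measurable_funTS hE.
    - move=> z; rewrite /shell/= !in_itv/= lee_fin => -[/andP[az zx]|/andP[xz zy]]; apply: h0.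
        by rewrite (lt_le_trans a0 az) (le_trans (ltW zx) (le_trans xy y1)).
      by rewrite (lt_le_trans x0 xz) (le_trans (ltW zy) y1).
    rewrite fineD; first by rewrite addrC addKr.
      by apply: fin => //; exact: le_trans y1.
    exact: fin.
  have := shell_bounds x0 xy y1.
  by rewrite -{1 2}(fineK (fin _ _ x0 xy y1)) !lee_fin.
have := @eq_of_variation_bound R (fun x => F x - Phi x) (fun x => - h x) a 1 a1.
have Pa : Phi a = 0.
  rewrite /Phi (_ : shell a a = set0) ?integral_set0//.
  by apply/seteqP; split => // z; rewrite /shell/= in_itv/= => /andP[az]; rewrite ltNge az.
move=> E; have {}E : F a - Phi a = F 1 - Phi 1.
  apply: E => x y ax xy y1; have x0 := lt_le_trans a0 ax.
  have /andP[h1 h2] := PhiB _ _ ax xy y1; have /andP[h3 h4] := sandwich x0 xy y1.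
  by rewrite ler_norml; apply/andP; split; nra.
rewrite -(fineK (fin _ _ a0 a1 (lexx _))) -/(Phi 1); congr EFin.
by move: E; rewrite Pa; lra.
Qed.

(** [h] may be unbounded at 0, so the shells [1 / (n + 1) <= rho < 1] exhaust the domain, and [F0]
    stands for the limit of [F] at 0. *)
Lemma integral_of_sandwich : (F (n.+1%:R^-1) @[n --> \oo] --> F0) ->
  (\int[P]_(x in [set x | (0 < rho x < 1)%R]) (h (rho x))%:E = (F 1 - F0)%:E)%E.
Proof.
move=> FF0.
pose D (n : nat) := shell n.+1%:R^-1 1.
have U : \bigcup_n D n = [set x | 0 < rho x < 1].
  apply/seteqP; split => x /=.
    move=> [n _]; rewrite /D /shell/= in_itv/= => /andP[nx ->]; rewrite andbT.
    by apply: lt_le_trans nx; rewrite invr_gt0.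
  move=> /andP[x0 x1]; exists (Num.bound (rho x)^-1) => //.
  rewrite /D /shell/= in_itv/= x1 andbT invf_ple ?posrE//.
  apply: le_trans (ltW (archi_boundP _)) _; first by rewrite invr_ge0 ltW.
  by rewrite ler_nat.
have Dh n x : D n x -> (0 <= (h (rho x))%:E)%E.
  rewrite /D /shell/= in_itv/= => /andP[nx x1]; rewrite lee_fin h0// ltW// andbT.
  by apply: lt_le_trans nx; rewrite invr_gt0.
have := @ge0_nondecreasing_set_cvg_integral _ _ _ D (fun x => (h (rho x))%:E) P.
move=> /(_ _ _ _ Dh); rewrite U => C.
apply: (cvg_unique _ (C _ _ _)) => //.
- move=> n m nm; apply/subsetPset => x; rewrite /D /shell/= !in_itv/= => /andP[nx ->].
  by rewrite andbT (le_trans _ nx)// lef_pV2 ?posrE// ler_nat.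
- by move=> n; exact: measurable_shell.
- by move=> n; exact: measurable_funTS hE.
- rewrite /= [X in X @ _ --> _](_ : _ = fun n => (F 1 - F n.+1%:R^-1)%:E); last first.
    by apply/funext => n; rewrite integral_shell ?invr_gt0// invf_le1 ?ler1n.
  apply: cvg_EFin; first exact: nearW.
  by apply: cvgB => //; exact: cvg_cst.
Qed.

End radial_integral.

(** * Potentials of linear images of a disk *)

Section joukowsky.
Context {R : realType}.
Implicit Types (x z : R[i]).

Lemma Re_sqrtc_ge0 z : 0 <= complex.Re (sqrtc z).
Proof. by case: z => a b /=; rewrite sqrtr_ge0. Qed.

(** The imaginary part of the principal root has the sign of the imaginary part of its argument.
    This is applied to [x - 2] and [x + 2]. *)
Lemma Im_sqrtc_sign z w : complex.Im z = complex.Im w ->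
  0 <= complex.Im (sqrtc z) * complex.Im (sqrtc w).
Proof.
case: z w => [a b] [a' b'] /= <-.
by rewrite mulrACA -expr2; apply: mulr_ge0; rewrite ?sqr_ge0// mulr_ge0 ?sqrtr_ge0.
Qed.

(** Inverse of the Joukowsky map: the root [u] of [u + 1 / u = x] with modulus at least 1. Its
    inverse is the Cauchy transform of the standard semicircle law. *)
Definition jouk x : R[i] := (x + sqrt_z2m4 x) / 2%:R.

Lemma sqr_sqrt_z2m4 x : sqrt_z2m4 x ^+ 2 = x ^+ 2 - 4%:R.
Proof. by rewrite /sqrt_z2m4 exprMn !sqr_sqrtc; ring. Qed.

Lemma joukV x : jouk x * ((x - sqrt_z2m4 x) / 2%:R) = 1.
Proof.
have := sqr_sqrt_z2m4 x; rewrite /jouk; set s := sqrt_z2m4 x => E.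
rewrite (_ : _ * _ = (x ^+ 2 - s ^+ 2) / 4%:R); last by field.
by rewrite E; field.
Qed.

Lemma jouk_neq0 x : jouk x != 0.
Proof. by apply/eqP => j0; have := joukV x; rewrite j0 mul0r => /eqP; rewrite eq_sym oner_eq0. Qed.

Lemma joukVE x : (jouk x)^-1 = (x - sqrt_z2m4 x) / 2%:R.
Proof. by apply: (mulfI (jouk_neq0 x)); rewrite joukV mulfV ?jouk_neq0. Qed.

Lemma joukDV x : jouk x + (jouk x)^-1 = x.
Proof. by rewrite joukVE /jouk; field. Qed.

(** With [p] and [q] the principal roots of [x - 2] and [x + 2], the map and its inverse are
    [((p + q) / 2) ^ 2] and [((p - q) / 2) ^ 2]. As vectors [p] and [q] have a nonnegative scalar
    product, so the first has the larger modulus; the product of the two moduli is 1. *)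
Lemma modc_jouk_ge1 x : 1 <= modc (jouk x).
Proof.
have h : modc ((jouk x)^-1) <= modc (jouk x).
  rewrite joukVE /jouk /sqrt_z2m4; set p := sqrtc _; set q := sqrtc _.
  have xpq : x = (p ^+ 2 + q ^+ 2) / 2%:R by rewrite !sqr_sqrtc; field.
  have p1 : 0 <= complex.Re p := Re_sqrtc_ge0 _.
  have q1 : 0 <= complex.Re q := Re_sqrtc_ge0 _.
  have pq2 : 0 <= complex.Im p * complex.Im q.
    by apply: Im_sqrtc_sign; rewrite ImD ImD ImN Im_nat oppr0.
  rewrite (_ : (x - _) / _ = ((p - q) / 2%:R) ^+ 2); last by rewrite xpq; field.
  rewrite (_ : (x + _) / _ = ((p + q) / 2%:R) ^+ 2); last by rewrite xpq; field.
  rewrite !modcX !modcM ler_pXn2r ?nnegrE ?mulr_ge0 ?modc_ge0//.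
  apply: ler_wpM2r; first exact: modc_ge0.
  rewrite -(ler_pXn2r (n := 2)) ?nnegrE ?modc_ge0// !sqr_modc !raddfB !raddfD/=.
  have := mulr_ge0 p1 q1; nra.
have e1 : modc (jouk x) * modc (jouk x)^-1 = 1 by rewrite -modcM mulfV ?jouk_neq0// modc1.
rewrite leNgt; apply/negP => j1; have := modc_ge0 (jouk x)^-1; nra.
Qed.

Lemma modc_joukV_le1 x : modc (jouk x)^-1 <= 1.
Proof. by rewrite modcV invf_le1 ?modc_jouk_ge1// modc_gt0 jouk_neq0. Qed.

Lemma Psi_jouk x : Psi x = 2^-1 * complex.Re ((jouk x) ^- 2) + ln (modc (jouk x)).
Proof.
rewrite /Psi -/(jouk x).
have -> : x ^+ 2 - x * sqrt_z2m4 x = 2%:R + 2%:R * (jouk x) ^- 2.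
  have := sqr_sqrt_z2m4 x; rewrite -exprVn joukVE; set s := sqrt_z2m4 x => E.
  transitivity (2%:R * ((x ^+ 2 - s ^+ 2) / 4%:R) + 2%:R * ((x - s) / 2%:R) ^+ 2); first by field.
  by rewrite E; field.
rewrite ReD ReM Re_nat Im_nat; lra.
Qed.

End joukowsky.

(** * The semicircle potential as an infimum of functions affine in the variance *)

Section semicircle_potential.
Context {R : realType}.
Implicit Types (x z : R[i]) (al be l m : R).

(** This inequality and the next one express that [envelope] is minimal at [l] for a point on the
    real axis and for one on the imaginary axis. Equality holds at [l = m]; the hyperbolic bounds on
    [ln] settle the two sides. *)
Lemma ln_ratio_ge_tanh l m : 0 < l <= 1 -> 0 < m <= 1 ->
  (l - m) * (1 + l) / (l * (1 + m)) <= ln (l / m).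
Proof.
move=> /andP[l0 l1] /andP[m0 m1].
have lm0 : 0 < l / m by rewrite divr_gt0.
have [ml|lm] := leP m l.
  have r1 : 1 <= l / m by rewrite ler_pdivlMr// mul1r.
  apply: le_trans (ln_ge_tanh r1).
  rewrite (_ : 2 * (l / m - 1) / (l / m + 1) = 2 * (l - m) / (l + m)); last first.
    by field; rewrite !gt_eqF// addr_gt0.
  rewrite ler_pdivrMr ?mulr_gt0 ?addr_gt0// mulrAC ler_pdivlMr ?addr_gt0//.
  have : 0 <= l - m by lra. move: (l - m) => d d0.
  have -> : 2 * d * (l * (1 + m)) = d * (2 * l * (1 + m)) by ring.
  rewrite -(mulrA d); apply: ler_wpM2l => //; nra.
have r1 : 1 <= m / l by rewrite ler_pdivlMr// mul1r ltW.
have := ln_le_sinh r1; rewrite -[l / m]invf_div lnV ?posrE ?divr_gt0// => h.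
rewrite lerNr; apply: le_trans h _.
rewrite invf_div (_ : (m / l - l / m) / 2 = (m - l) * (m + l) / (2 * l * m)); last first.
  by field; rewrite !gt_eqF.
rewrite -!mulNr opprB ler_pdivrMr ?mulr_gt0// mulrAC ler_pdivlMr ?mulr_gt0 ?addr_gt0//.
have : 0 <= m - l by lra. move: (m - l) => d d0.
rewrite -!mulrA; apply: ler_wpM2l => //.
have -> : (1 + l) * (2 * (l * m)) = l * (2 * m * (1 + l)) by ring.
rewrite mulrCA; apply: ler_wpM2l; nra.
Qed.

Lemma ln_ratio_ge_coth l m : 0 < l <= 1 -> 0 < m < 1 ->
  (l - m) * (1 - l) / (l * (1 - m)) <= ln (l / m).
Proof.
move=> /andP[l0 l1] /andP[m0 m1].
have lm0 : 0 < l / m by rewrite divr_gt0.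
apply: le_trans (ln_geBV lm0).
rewrite invf_div (_ : 1 - m / l = (l - m) / l); last by field; rewrite gt_eqF.
have m10 : 0 < 1 - m by lra.
rewrite ler_pdivrMr ?mulr_gt0// (_ : _ / l * _ = (l - m) * (1 - m)); last first.
  by field; rewrite gt_eqF.
rewrite -subr_ge0 (_ : _ - _ = (l - m) ^+ 2) ?sqr_ge0//; ring.
Qed.

(** For [0 < m < 1] this is, up to normalization, the potential of the uniform
measure on the ellipse with half axes [1 + m] and [1 - m]; the potential of the
semicircle law is its infimum over [m]. *)
Definition envelope (a1 a2 al m : R) : R :=
  - (al / 2 * ln m) - al / 2 + (a1 * (m / (1 + m)) + a2 * (m / (1 - m))) / 2.

(** The difference of the two sides is [al / 2] times the average, with weights [w1] and [w2], of
    the gaps in the two preceding inequalities. *)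
Lemma envelope_min al l m w1 w2 (a1 a2 : R) :
  0 < l <= 1 -> 0 < m <= 1 -> 0 <= w1 -> 0 <= w2 -> w1 + w2 = 1 -> 0 < al ->
  a1 = al * w1 * ((1 + l) ^+ 2 / l) -> a2 = al * w2 * ((1 - l) ^+ 2 / l) ->
  (m = 1 -> a2 = 0) ->
  envelope a1 a2 al l <= envelope a1 a2 al m.
Proof.
move=> lP mP w10 w20 w12 al0 E1 E2 m1a2.
have [l0 l1] := andP lP; have [m0 m1] := andP mP.
have T1 := ln_ratio_ge_tanh lP mP.
rewrite /envelope -subr_ge0.
have lnE : ln (l / m) = ln l - ln m by rewrite ln_div.
have D1 : a1 * (m / (1 + m)) - a1 * (l / (1 + l)) =
    - (al * w1) * ((l - m) * (1 + l) / (l * (1 + m))).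
  by rewrite E1; field; rewrite !gt_eqF ?addr_gt0.
(* At [m = 1] the quotient [m / (1 - m)] is 0 by convention instead of infinite, which is harmless
   only if [a2 = 0]; the value [l = 1] is special for the same reason. *)
have D2 : - (al * w2) * ln (l / m) <= a2 * (m / (1 - m)) - a2 * (l / (1 - l)).
  have [me|mn] := eqVneq m 1.
    rewrite (m1a2 me) !mul0r subr0 me divr1.
    move: E2; rewrite (m1a2 me) => /esym/eqP; rewrite !mulf_eq0 invr_eq0 (gt_eqF al0) (gt_eqF l0)/= !orbF.
    case/orP => [/eqP->|]; first by rewrite mulr0 oppr0 mul0r.
    by rewrite orbb subr_eq0 => /eqP <-; rewrite ln1 mulr0.
  have mlt : 0 < m < 1 by rewrite m0 lt_neqAle mn m1.
  have T2 := ln_ratio_ge_coth lP mlt.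
  have [le|ln] := eqVneq l 1.
    have a20 : a2 = 0 by rewrite E2 le subrr expr0n/= mul0r mulr0.
    have T3 : 0 <= ln (l / m) by move: T2; rewrite le subrr mulr0 mul0r.
    by rewrite a20 !mul0r subr0 mulNr oppr_le0 mulr_ge0// mulr_ge0// ltW.
  have -> : a2 * (m / (1 - m)) - a2 * (l / (1 - l)) =
     - (al * w2) * ((l - m) * (1 - l) / (l * (1 - m))).
    rewrite E2; field; rewrite !gt_eqF// subr_gt0 ?(andP mlt).2//.
    by rewrite lt_neqAle ln l1.
  by rewrite !mulNr lerN2 ler_wpM2l// mulr_ge0// ltW.
have D3 : - (al * w1) * ln (l / m) <= - (al * w1) * ((l - m) * (1 + l) / (l * (1 + m))).
  by rewrite !mulNr lerN2 ler_wpM2l// mulr_ge0// ltW.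
move: D2 D3; rewrite -D1 lnE.
have -> : w1 = 1 - w2 by lra.
nra.
Qed.

Variable x0 : R[i].

Definition jmod al : R := modc (jouk (x0 / (Num.sqrt al)%:C)).

(** Up to the summand [al * ln al / 2], this is [al] times the potential at [x0] of the semicircle
    law of variance [al]. *)
Definition scpot al : R := al * Psi (x0 / (Num.sqrt al)%:C).

Lemma jmod_ge1 al : 1 <= jmod al.
Proof. exact: modc_jouk_ge1. Qed.

Let a1 := complex.Re x0 ^+ 2.
Let a2 := complex.Im x0 ^+ 2.

(** Elliptic coordinates. With [u] the Joukowsky root and [l = |u| ^ -2], the point [u + 1 / u] has
    the coordinates [(1 + l) * Re u] and [(1 - l) * Im u]; the weights are the squared cosine and
    sine of the argument of [u]. *)
Lemma jouk_coordinates al : 0 < al -> exists w1 w2 : R,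
  [/\ 0 <= w1, 0 <= w2, w1 + w2 = 1,
      a1 = al * w1 * ((1 + jmod al ^- 2) ^+ 2 / jmod al ^- 2) &
      a2 = al * w2 * ((1 - jmod al ^- 2) ^+ 2 / jmod al ^- 2) /\
      complex.Re ((jouk (x0 / (Num.sqrt al)%:C)) ^- 2) = (w1 - w2) * jmod al ^- 2].
Proof.
move=> al0; have sa0 : 0 < Num.sqrt al by rewrite sqrtr_gt0.
have p1 := jmod_ge1 al; have p0 : 0 < jmod al by apply: lt_le_trans p1.
set x := x0 / _; set u := jouk x.
have x0E : x0 = (Num.sqrt al)%:C * (u + u^-1).
  rewrite joukDV /x mulrCA divff ?mulr1// (inj_eq (@complexI _) _ 0).
  by rewrite gt_eqF.
have pE : jmod al = modc u by [].
have nE : jmod al ^+ 2 = complex.Re u ^+ 2 + complex.Im u ^+ 2 by rewrite pE sqr_modc.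
have uV : u^-1 = (complex.Re u / jmod al ^+ 2) +i* (- complex.Im u / jmod al ^+ 2).
  rewrite nE; case: (u) => c e /=; congr (_ +i* _); rewrite mulNr//.
exists (complex.Re u ^+ 2 / jmod al ^+ 2), (complex.Im u ^+ 2 / jmod al ^+ 2).
have n0 : jmod al ^+ 2 != 0 by rewrite expf_neq0// gt_eqF.
have sal : Num.sqrt al ^+ 2 = al by rewrite sqr_sqrtr// ltW.
have d0 : 0 <= (jmod al ^+ 2)^-1 by rewrite invr_ge0 sqr_ge0.
split.
- by rewrite mulr_ge0 ?sqr_ge0.
- by rewrite mulr_ge0 ?sqr_ge0.
- by rewrite -mulrDl -nE divff.
- rewrite /a1 {1}x0E uV ReM ReD /=; rewrite mul0r subr0 exprMn sal; field.
  by rewrite gt_eqF.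
- split.
    rewrite /a2 {1}x0E uV ImM ImD /=; rewrite mul0r addr0 exprMn sal; field.
    by rewrite gt_eqF.
  rewrite -exprVn uV expr2 ReM /=; field.
  by rewrite gt_eqF.
Qed.

Let lP al : 0 < jmod al ^- 2 <= 1.
Proof.
have p1 := jmod_ge1 al; have p0 : 0 < jmod al by apply: lt_le_trans p1.
by rewrite invr_gt0 exprn_gt0//= invf_le1 ?exprn_gt0// exprn_ege1.
Qed.

Lemma scpot_envelope al : 0 < al -> scpot al = envelope a1 a2 al (jmod al ^- 2).
Proof.
move=> al0; have [w1 [w2 [w10 w20 w12 E1 [E2 ER]]]] := jouk_coordinates al0.
rewrite /scpot Psi_jouk ER -/(jmod al) /envelope.
have p1 := jmod_ge1 al; have p0 : 0 < jmod al by apply: lt_le_trans p1.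
rewrite lnV ?posrE ?exprn_gt0// lnXn//.
set l := jmod al ^- 2; have [l0 l1] := andP (lP al).
rewrite -/l in l0 l1 E1 E2.
have -> : a1 * (l / (1 + l)) = al * w1 * (1 + l).
  by rewrite E1; field; rewrite !gt_eqF// addr_gt0.
have -> : a2 * (l / (1 - l)) = al * w2 * (1 - l).
  have [->|ln] := eqVneq l 1; first by rewrite subrr invr0 !mulr0.
  by rewrite E2; field; rewrite !gt_eqF// subr_gt0 lt_neqAle ln.
have -> : w2 = 1 - w1 by lra.
by rewrite -mulr_natl; field.
Qed.

Lemma scpot_le_envelope al m : 0 < al -> 0 < m <= 1 -> (m = 1 -> a2 = 0) ->
  scpot al <= envelope a1 a2 al m.
Proof.
move=> al0 mP m1; have [w1 [w2 [w10 w20 w12 E1 [E2 _]]]] := jouk_coordinates al0.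
by rewrite scpot_envelope//; apply: (envelope_min (w1 := w1) (w2 := w2)).
Qed.

(** For fixed [m] the envelope is affine in [al] and lies above [scpot]. The choice
    [m = jmod al ^- 2] touches at [al], and its slope [- ln m / 2 - 1 / 2] is
    [ln (jmod al) - 1 / 2]. *)
Lemma scpot_supergradient al be : 0 < al -> 0 < be ->
  scpot be <= scpot al + (be - al) * (ln (jmod al) - 2^-1).
Proof.
move=> al0 be0; apply: le_trans (scpot_le_envelope be0 (lP al) _) _.
  have [w1 [w2 [_ _ _ _ [-> _]]]] := jouk_coordinates al0.
  by move=> ->; rewrite subrr expr0n/= mul0r mulr0.
rewrite scpot_envelope// /envelope.
have p1 := jmod_ge1 al; have p0 : 0 < jmod al by apply: lt_le_trans p1.
rewrite lnV ?posrE ?exprn_gt0// lnXn//; set q := (a1 * _ + _).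
by rewrite le_eqVlt; apply/orP; left; apply/eqP; rewrite -mulr_natl; field.
Qed.

Lemma Re_jouk_bound al : `|complex.Re ((jouk (x0 / (Num.sqrt al)%:C)) ^- 2)| <= 1.
Proof.
set v := _ ^- 2.
have v1 : modc v <= 1.
  by rewrite /v -exprVn modcX exprn_ile1 ?modc_ge0// modc_joukV_le1.
rewrite -(expr_le1 (n := 2))// real_normK ?num_real//.
apply: le_trans (_ : modc v ^+ 2 <= 1); first by rewrite sqr_modc lerDl sqr_ge0.
by rewrite exprn_ile1 ?modc_ge0.
Qed.

(** The supergradient inequality at the endpoint 0, where the potential is given the value 0. *)
Lemma scpot_ge al : 0 < al -> al * (ln (jmod al) - 2^-1) <= scpot al.
Proof.
move=> al0; rewrite /scpot Psi_jouk -/(jmod al) ler_pM2l//.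
have := Re_jouk_bound al; rewrite ler_norml => /andP[h _]; lra.
Qed.

End semicircle_potential.

Section entropy.
Context {R : realType}.

Lemma xlnx_bound (x : R) : 0 < x -> - (x * ln x) <= 2 * Num.sqrt x.
Proof.
move=> x0; have s0 : 0 < Num.sqrt x by rewrite sqrtr_gt0.
have xE : x = Num.sqrt x ^+ 2 by rewrite sqr_sqrtr// ltW.
rewrite {1 2}xE lnXn// -[ln _ *+ 2]mulr_natl.
have := ln_geBV s0; set r := Num.sqrt x in s0 *.
rewrite -subr_ge0 => h; rewrite -subr_ge0.
have -> : 2 * r - - (r ^+ 2 * (2 * ln r)) = 2 * r ^+ 2 * (ln r - (1 - r^-1)) + 2 * r ^+ 2.
  by field; rewrite gt_eqF.
have r2 : 0 <= 2 * r ^+ 2 by rewrite mulr_ge0// sqr_ge0.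
by rewrite addr_ge0// mulr_ge0.
Qed.

Lemma cvg_sqrt_harmonic : Num.sqrt (n.+1%:R^-1 : R) @[n --> \oo] --> (0 : R).
Proof.
rewrite -(@sqrtr0 R); apply: (@continuous_cvg _ _ _ _ _ _ (@Num.sqrt R)).
  exact: sqrt_continuous.
exact: cvg_harmonic.
Qed.

(** A primitive of [- ln / 2]; it is the nonlinear part of the profile [g] that belongs to a
    disk. *)
Definition halfent (al : R) : R := (al - al * ln al) / 2.

Lemma halfent_sandwich (x y : R) : 0 < x -> x <= y ->
  (y - x) * (- (ln y / 2)) <= halfent y - halfent x <= (y - x) * (- (ln x / 2)).
Proof.
move=> x0 xy; have y0 := lt_le_trans x0 xy.
have l1 := ln_leB1 (divr_gt0 y0 x0); have l2 := ln_leB1 (divr_gt0 x0 y0).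
move: l1 l2; rewrite !ln_div ?posrE// => l1 l2.
have {}l1 : x * (ln y - ln x) <= y - x.
  apply: le_trans (ler_wpM2l (ltW x0) l1) _.
  by rewrite mulrBr mulr1 mulrCA divff ?mulr1// gt_eqF.
have {}l2 : y * (ln x - ln y) <= x - y.
  apply: le_trans (ler_wpM2l (ltW y0) l2) _.
  by rewrite mulrBr mulr1 mulrCA divff ?mulr1// gt_eqF.
by rewrite /halfent; apply/andP; split; lra.
Qed.

Lemma le_sqrt (x : R) : 0 < x -> x <= 1 -> x <= Num.sqrt x.
Proof.
move=> x0 x1; rewrite -{1}(sqr_sqrtr (ltW x0)) expr2 -[leRHS]mulr1.
by rewrite ler_pM2l ?sqrtr_gt0// -[leRHS]sqrtr1 ler_wsqrtr.
Qed.

Lemma halfent_bound (x : R) : 0 < x -> x <= 1 -> 0 <= halfent x <= 2 * Num.sqrt x.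
Proof.
move=> x0 x1; have xl := xlnx_bound x0; have xs := le_sqrt x0 x1.
have xl0 : x * ln x <= 0 by rewrite pmulr_rle0// ln_le0.
by rewrite /halfent; apply/andP; split; lra.
Qed.

Lemma halfent_cvg0 : halfent n.+1%:R^-1 @[n --> \oo] --> (0 : R).
Proof.
apply: (@squeeze_cvgr _ _ _ _ (fun=> 0) (fun n => 2 * Num.sqrt n.+1%:R^-1)).
- by apply: nearW => n; rewrite halfent_bound// ?invr_gt0// invf_le1 ?ler1n.
- exact: cvg_cst.
- rewrite -[X in _ --> X](mulr0 2); apply: cvgM; first exact: cvg_cst.
  exact: cvg_sqrt_harmonic.
Qed.

End entropy.

Section potential_sup.
Context {R : realType}.
Variables (x0 : R[i]) (kappa : R).
Hypotheses (k0 : 0 < kappa) (k1 : kappa <= 1).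

(** This is [ft g t _ z - g 0] for the profile of the disk of radius [b], with [x0 = z / sqrtc t]
    and [kappa = sqrt |t| / b]: the entropy term of [g] cancels the logarithm of [sqrt al] in
    [ft]. *)
Definition ellpot (al : R) : R :=
  if al == 0 then 0 else al / 2 + al * ln kappa + scpot x0 al.

(** On one hand the slope of the concave [ellpot], on the other the logarithm of the modulus of the
    larger zero in Jensen's formula on the circle of parameter [al]. This coincidence links the
    supremum to the potential. *)
Definition ellslope (al : R) : R := ln (kappa * jmod x0 al).

Let slopeE al : ellslope al = ln kappa + ln (jmod x0 al).
Proof. by rewrite /ellslope lnM ?posrE// (lt_le_trans _ (jmod_ge1 _ _)). Qed.

Lemma ellpot_supergradient al be : 0 < al -> 0 <= be ->
  ellpot be <= ellpot al + (be - al) * ellslope al.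
Proof.
move=> al0; rewrite le_eqVlt slopeE /ellpot (gt_eqF al0) => /orP[/eqP<-|be0].
  rewrite eqxx; have := scpot_ge x0 al0; lra.
rewrite (gt_eqF be0); have := scpot_supergradient x0 al0 be0; lra.
Qed.

Let C := 1 + (complex.Re x0 ^+ 2 + 2 * complex.Im x0 ^+ 2).

Lemma ellpot_small al : 0 <= al -> al <= 2^-1 -> ellpot al <= C * Num.sqrt al.
Proof.
rewrite le_eqVlt => /orP[/eqP<-|al0] al1; first by rewrite /ellpot eqxx sqrtr0 mulr0.
rewrite /ellpot (gt_eqF al0).
have s0 : 0 < Num.sqrt al by rewrite sqrtr_gt0.
have als : al <= Num.sqrt al.
  rewrite -{1}(sqr_sqrtr (ltW al0)) expr2 -[leRHS]mulr1 ler_pM2l//.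
  by rewrite -sqrtr1 ler_wsqrtr//; lra.
have m1 : 0 < al <= 1 by rewrite al0/=; lra.
(* The parameter [m = al], though not the optimal one, makes every term of the envelope of order at
   most [sqrt al]; [al <= 1 / 2] keeps [1 - al] away from 0. *)
have := @scpot_le_envelope _ x0 al al al0 m1 (ltac:(lra)); rewrite /envelope.
have lk : al * ln kappa <= 0 by rewrite pmulr_rle0// ln_le0.
have xl := xlnx_bound al0.
have A1 : complex.Re x0 ^+ 2 * (al / (1 + al)) <= complex.Re x0 ^+ 2 * Num.sqrt al.
  rewrite ler_wpM2l ?sqr_ge0//; apply: le_trans als.
  by rewrite ler_pdivrMr ?addr_gt0// ler_peMr ?ltW//; lra.
have A2 : complex.Im x0 ^+ 2 * (al / (1 - al)) <= complex.Im x0 ^+ 2 * (2 * Num.sqrt al).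
  rewrite ler_wpM2l ?sqr_ge0//; apply: le_trans (_ : 2 * al <= _); last by lra.
  by rewrite ler_pdivrMr; [nra|lra].
have := sqr_ge0 (complex.Re x0); have := sqr_ge0 (complex.Im x0).
rewrite /C; move: A1 A2; set p := complex.Re x0 ^+ 2; set q := complex.Im x0 ^+ 2.
move=> A1 A2 q0 p0.
have := mulr_ge0 p0 (ltW s0); have := mulr_ge0 q0 (ltW s0); lra.
Qed.

(** The supremum up to [al] instead of up to 1 serves as a primitive of the positive part of
    [ellslope], as the radial integration requires. *)
Definition ellsup (al : R) : R := sup [set ellpot be | be in `[0, al]].

Let ubA al : 0 <= al -> al <= 1 -> has_sup [set ellpot be | be in `[0, al]].
Proof.
move=> al0 al1; split; first by exists (ellpot 0); exists 0 => //=; rewrite in_itv/= lexx.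
exists (ellpot 1 + `|ellslope 1|) => _ [be + <-]; rewrite /= in_itv/= => /andP[b0 b1].
apply: le_trans (ellpot_supergradient ltr01 b0) _; rewrite lerD2l.
have b2 : be <= 1 by exact: le_trans al1.
apply: le_trans (ler_norm _) _; rewrite normrM; rewrite -[leRHS]mul1r ler_wpM2r//.
by rewrite ler_norml; lra.
Qed.

Lemma ellpot_le_sup al be : al <= 1 -> 0 <= be -> be <= al -> ellpot be <= ellsup al.
Proof.
move=> al1 b0 ba; apply: ub_le_sup; last by exists be => //=; rewrite in_itv/= b0.
by have [] := ubA (le_trans b0 ba) al1.
Qed.

Lemma ellsup_le al M : 0 <= al ->
  (forall be, 0 <= be -> be <= al -> ellpot be <= M) -> ellsup al <= M.
Proof.
move=> al0 H; apply: ge_sup; first by exists (ellpot 0); exists 0 => //=; rewrite in_itv/= lexx.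
by move=> _ [be + <-]; rewrite /= in_itv/= => /andP[b0 b1]; exact: H.
Qed.

(** A running supremum grows only while the slope is positive. By concavity the growth between [x]
    and [y] lies between the positive parts of the slopes at [y] and at [x], times the length. *)
Lemma ellsup_sandwich x y : 0 < x -> x <= y -> y <= 1 ->
  (y - x) * Num.max 0 (ellslope y) <= ellsup y - ellsup x
    <= (y - x) * Num.max 0 (ellslope x).
Proof.
move=> xp xy y1; have yp := lt_le_trans xp xy; have x1 := le_trans xy y1.
have yx0 : 0 <= y - x by rewrite subr_ge0.
have sx0 : 0 <= ellsup y - ellsup x.
  rewrite subr_ge0; apply: ellsup_le => [|be b0 bx]; first exact: ltW.
  by apply: ellpot_le_sup => //; exact: le_trans xy.
apply/andP; split.
  have [h|h] := leP (ellslope y) 0; first by rewrite mulr0.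
  rewrite lerBrDl -lerBrDr.
  apply: ellsup_le => [|be b0 bx]; first exact: ltW.
  rewrite lerBrDr; apply: le_trans (ellpot_le_sup y1 (ltW yp) (lexx _)).
  have := ellpot_supergradient yp b0.
  have : (x - be) * ellslope y >= 0 by rewrite mulr_ge0 ?subr_ge0// ltW.
  lra.
rewrite lerBlDl; apply: ellsup_le => [|be b0 byy]; first exact: ltW.
have m0 : 0 <= Num.max 0 (ellslope x) by rewrite le_max lexx.
have [bx|xb] := leP be x.
  by apply: le_trans (ellpot_le_sup x1 b0 bx) _; rewrite lerDl mulr_ge0.
apply: le_trans (ellpot_supergradient xp b0) _.
apply: lerD; first by apply: ellpot_le_sup => //; exact: ltW.
apply: le_trans (_ : (be - x) * Num.max 0 (ellslope x) <= _).
  by apply: ler_wpM2l; [rewrite subr_ge0 ltW|rewrite le_max lexx orbT].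
by rewrite ler_wpM2r// lerD2r.
Qed.

Lemma ellsup_cvg0 : ellsup n.+1%:R^-1 @[n --> \oo] --> (0 : R).
Proof.
apply: (@squeeze_cvgr _ _ _ _ (fun=> 0) (fun n => C * Num.sqrt n.+1%:R^-1)).
- exists 1%N => // n /= n1.
  have np : 0 < n.+1%:R^-1 :> R by rewrite invr_gt0.
  have n2 : n.+1%:R^-1 <= 2^-1 :> R by rewrite lef_pV2 ?posrE// ler_nat.
  apply/andP; split.
    rewrite -[0](_ : ellpot 0 = 0); last by rewrite /ellpot eqxx.
    apply: (ellpot_le_sup _ (lexx 0) (ltW np)); apply: le_trans n2 _; lra.
  apply: ellsup_le => [|be b0 bn]; first exact: ltW.
  apply: le_trans (ellpot_small b0 (le_trans bn n2)) _.
  rewrite ler_wpM2l// ?ler_wsqrtr// /C.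
  by have := sqr_ge0 (complex.Re x0); have := sqr_ge0 (complex.Im x0); lra.
- exact: cvg_cst.
- rewrite -[X in _ --> X](mulr0 C); apply: cvgM; first exact: cvg_cst.
  exact: cvg_sqrt_harmonic.
Qed.

End potential_sup.

Section more_measurability.
Context {R : realType} {d : measure_display} {T : measurableType d}.

(** [f * expR (- ln (f ^ 2))] is [f / f ^ 2], and it is 0 at the zeros of [f], in accordance with
    the convention for the inverse. *)
Lemma measurable_funV (f : T -> R) : measurable_fun setT f ->
  measurable_fun setT (fun x => (f x)^-1).
Proof.
move=> mf; rewrite (_ : (fun x => _) = fun x => f x * expR (- ln (f x ^+ 2))).
  apply: measurable_funM => //; apply: measurableT_comp; first exact: measurable_expR.
  apply: measurableT_comp => //; apply: measurableT_comp; first exact: measurable_ln.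
  exact: measurable_funX.
apply/funext => x; have [->|fx] := eqVneq (f x) 0; first by rewrite invr0 mul0r.
rewrite expRN lnK ?posrE ?exprn_even_gt0//.
by field.
Qed.

Lemma cmeasurableV (f : T -> R[i]) : cmeasurable f ->
  cmeasurable (fun x => (f x)^-1).
Proof.
move=> mf; under [X in cmeasurable X]eq_fun do rewrite invcJ.
apply: cmeasurableM; first exact: cmeasurable_conjc.
apply: cmeasurableC; apply: measurable_funV; apply: measurable_funX.
exact: measurable_modc.
Qed.

Lemma measurable_sqrt (f : T -> R) : measurable_fun setT f ->
  measurable_fun setT (fun x => Num.sqrt (f x)).
Proof.
move=> mf; apply: measurableT_comp => //.
by apply: continuous_measurable_fun; exact: sqrt_continuous.
Qed.

Lemma cmeasurable_sqrtc (f : T -> R[i]) : cmeasurable f ->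
  cmeasurable (fun x => sqrtc (f x)).
Proof.
move=> mf; have mm := measurable_modc mf.
have /cmeasurableP[f1 f2] := mf; apply/cmeasurableP; split.
  rewrite (_ : (fun x => _) = fun x =>
      Num.sqrt ((modc (f x) + complex.Re (f x)) / 2)); last first.
    by apply/funext => x; rewrite /modc; case: (f x).
  apply: measurable_sqrt; apply: measurable_funM; last exact: measurable_cst.
  exact: measurable_funD.
rewrite (_ : (fun x => _) = fun x => (if complex.Im (f x) < 0 then -1 else 1) *
    Num.sqrt ((modc (f x) - complex.Re (f x)) / 2)); last first.
  apply/funext => x; rewrite /modc; case: (f x) => p q /=; congr (_ * _).
  by case: (ltgtP q 0) => // h; rewrite ?(ltr0_sg h) ?(gtr0_sg h).
apply: measurable_funM.
  by apply: measurable_fun_ifT => //; apply: measurable_fun_ltr.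
apply: measurable_sqrt; apply: measurable_funM; last exact: measurable_cst.
exact: measurable_funB.
Qed.

Lemma measurable_jmod (x0 : R[i]) (f : T -> R) : measurable_fun setT f ->
  measurable_fun setT (fun x => jmod x0 (f x)).
Proof.
move=> mf; apply: measurable_modc; rewrite /jouk /sqrt_z2m4.
have mx : cmeasurable (fun x => x0 / (Num.sqrt (f x))%:C).
  apply: (@cmeasurableM _ _ _ (fun=> x0)); first exact: cmeasurable_cst.
  by apply: cmeasurableV; apply: cmeasurableC; exact: measurable_sqrt.
apply: (@cmeasurableM _ _ _ _ (fun=> 2%:R^-1)); last exact: cmeasurable_cst.
apply: cmeasurableD => //; apply: cmeasurableM; apply: cmeasurable_sqrtc;
  by apply: (@cmeasurableD _ _ _ _ (fun=> _)) => //; exact: cmeasurable_cst.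
Qed.

End more_measurability.

Lemma integral_law_signed {R : realType} {d d'} {T : measurableType d}
    {T' : measurableType d'} (P : probability T R) (f : T -> T')
    (mf : measurable_fun setT f) (F : T' -> \bar R) :
  measurable_fun [set: T'] F -> (\int[law P mf]_y F y = \int[P]_x F (f x))%E.
Proof.
move=> mF; rewrite -[fun x => F (f x)]/(F \o f) integralE [RHS]integralE.
have -> : (F \o f)^\+%E = F^\+%E \o f by rewrite -funepos_comp.
have -> : (F \o f)^\-%E = F^\-%E \o f by rewrite -funeneg_comp.
by rewrite !integral_law//; [exact: measurable_funeneg|exact: measurable_funepos].
Qed.

Section disk_law.
Context {R : realType}.
Variables (mu : probability (R * R)%type R) (b : R).
Hypotheses (mur : rotation_invariant mu) (b0 : 0 < b).
Hypothesis radial : forall r, 0 <= r <= b ->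
  mu [set x | modc (toC x) < r] = (r ^+ 2 / b ^+ 2)%:E.

(** By [radial] it is uniformly distributed on [0, 1] under [mu]; it plays the role of the parameter
    [al] of [ft]. *)
Definition sqradius (x : R * R) : R := modc (toC x) ^+ 2 / b ^+ 2.

Lemma measurable_sqradius : measurable_fun setT sqradius.
Proof.
apply: measurable_funM; last exact: measurable_cst.
by apply: measurable_funX; exact: measurable_modc_toC.
Qed.

Lemma sqradius_ge0 x : 0 <= sqradius x.
Proof. by rewrite mulr_ge0 ?invr_ge0 ?sqr_ge0. Qed.

Lemma sqradiusP r : 0 <= r <= 1 -> mu [set x | sqradius x < r] = r%:E.
Proof.
move=> /andP[r0 r1]; have b20 : 0 < b ^+ 2 by rewrite exprn_gt0.
rewrite (_ : [set _ | _] = [set x | modc (toC x) < b * Num.sqrt r]); last first.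
  apply/funext => x /=; apply/propext; rewrite /sqradius ltr_pdivrMr//.
  have br : 0 <= b * Num.sqrt r by rewrite mulr_ge0 ?sqrtr_ge0 ?ltW.
  have -> : r * b ^+ 2 = (b * Num.sqrt r) ^+ 2 by rewrite exprMn sqr_sqrtr// mulrC.
  by rewrite ltr_pXn2r ?nnegrE ?modc_ge0.
rewrite radial.
  by rewrite exprMn sqr_sqrtr// mulrAC divff ?mul1r// gt_eqF.
apply/andP; split; first by rewrite mulr_ge0 ?sqrtr_ge0 ?ltW.
rewrite -[leRHS]mulr1; apply: ler_wpM2l; first exact: ltW.
by rewrite -[leRHS]sqrtr1 ler_wsqrtr.
Qed.

Let D := [set x | (0 < sqradius x < 1)%R].

Lemma disk_origin : mu [set 0] = 0%E.
Proof.
apply/eqP; rewrite eq_le measure_ge0 andbT; apply/lee_addgt0Pr => e e0; rewrite add0e.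
have [e1|e1] := leP e 1; last first.
  by apply: le_trans (probability_le1 _ measurable_origin) _; rewrite lee_fin ltW.
rewrite -(@sqradiusP e) ?(ltW e0)//; apply: le_measure; rewrite ?inE.
- exact: measurable_origin.
- rewrite (_ : [set _ | _] = sqradius @^-1` `]-oo, e[); last first.
    by apply/seteqP; split => x /=; rewrite in_itv.
  by rewrite -[X in measurable X]setTI; exact: measurable_sqradius.
- by move=> x -> /=; rewrite /sqradius -[X in toC X]/(ofC 0) ofCK modc0 expr0n/= mul0r.
Qed.

Lemma measurable_open_disk : measurable D.
Proof.
rewrite (_ : D = sqradius @^-1` `]0, 1[); last first.
  by apply/seteqP; split => x; rewrite /D/= in_itv.
by rewrite -[X in measurable X]setTI; exact: measurable_sqradius.
Qed.

Lemma disk_full : mu D = 1%E.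
Proof.
rewrite -(@sqradiusP 1) ?ler01 ?lexx//.
apply: (measure_eq_mod_null measurable_open_disk _ measurable_origin disk_origin).
  rewrite (_ : [set _ | _] = sqradius @^-1` `]-oo, 1[); last first.
    by apply/seteqP; split => x /=; rewrite in_itv.
  by rewrite -[X in measurable X]setTI; exact: measurable_sqradius.
move=> x x0; rewrite /D/=; split=> [/andP[_ ->]//|->]; rewrite andbT.
rewrite lt_def sqradius_ge0 andbT mulf_eq0 invr_eq0 !expf_eq0/= (gt_eqF b0) orbF modc_eq0.
by apply: contra_notN x0 => /eqP x0; rewrite -[x]toCK x0.
Qed.

Lemma integral_disk (F : R * R -> \bar R) : measurable_fun setT F ->
  (\int[mu]_x F x = \int[mu]_(x in D) F x)%E.
Proof.
move=> mF.
rewrite [RHS]integral_mkcond; apply: ae_eq_integral => //.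
  by apply/(measurable_restrictT _ measurable_open_disk); exact: measurable_funTS.
have nD : mu (~` D) = 0%E.
  by rewrite probability_setC ?disk_full ?subee//; exact: measurable_open_disk.
apply: (negligible_ae_eq (measurableC measurable_open_disk) nD) => x /contrapT Dx.
by rewrite /patch mem_set.
Qed.

Lemma sgnc_rotation s (F : R * R -> \bar R) : modc s = 1 ->
  measurable_fun setT F -> (forall y, (0 <= F y)%E) ->
  (\int[mu]_x F (rot s (ofC (sgnc (toC x)))) = \int[mu]_x F (ofC (sgnc (toC x))))%E.
Proof.
move=> s1 mF F0.
rewrite -(integral_law mu (@cmeasurable_sgnc R) mF F0).
rewrite -(integral_law mu (@cmeasurable_sgnc R) (F := fun y => F (rot s y)))//; last first.
  by apply: measurableT_comp => //; exact: measurable_rot.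
apply: integral_rot => //; exact: circle_law_rotation_invariant disk_origin.
Qed.

Lemma jensen_sgnc a :
  mu.-integrable setT (fun x => lne (modc (sgnc (toC x) - a))%:E) /\
  (\int[mu]_x lne (modc (sgnc (toC x) - a))%:E = (ln (Num.max 1 (modc a)))%:E)%E.
Proof.
apply: (@jensen_unit _ _ _ mu (fun x => sgnc (toC x))).
- exact: cmeasurable_sgnc.
- by move=> x; exact: modc_sgnc.
- by move=> s s1 F mF F0; exact: sgnc_rotation.
Qed.

End disk_law.

(** * Jensen's formula for the linear image of a disk *)

Section linear_image_potential.
Context {R : realType}.
Variables (mu : probability (R * R)%type R) (b : R).
Hypotheses (mur : rotation_invariant mu) (b0 : 0 < b).
Hypothesis radial : forall r, 0 <= r <= b ->
  mu [set x | modc (toC x) < r] = (r ^+ 2 / b ^+ 2)%:E.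
Variable t : R[i].
Hypotheses (t0 : 0 < modc t) (tb : modc t <= b ^+ 2).
Variable z : R[i].

Definition ellmap (tau w : R[i]) : R[i] := w + tau * conjc w.

Let tau : R[i] := t / (b ^+ 2)%:C.
Let kappa : R := Num.sqrt (modc t) / b.
Let x0 : R[i] := z / sqrtc t.

Let kappa0 : 0 < kappa. Proof. by rewrite divr_gt0 ?sqrtr_gt0. Qed.

Let kappa1 : kappa <= 1.
Proof.
rewrite ler_pdivrMr// mul1r -(ler_pXn2r (n := 2)) ?nnegrE ?sqrtr_ge0 ?(ltW b0)//.
by rewrite sqr_sqrtr// modc_ge0.
Qed.

Lemma modc_sqrtc (v : R[i]) : modc (sqrtc v) = Num.sqrt (modc v).
Proof.
by rewrite -{2}(sqr_sqrtc v) modcX sqrtr_sqr ger0_norm// modc_ge0.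
Qed.

Lemma cmeasurable_ellmap d (T : measurableType d) (c : R[i]) (f : T -> R[i]) :
  cmeasurable f -> cmeasurable (fun x => ellmap c (f x)).
Proof.
move=> mf; apply: cmeasurableD => //; apply: cmeasurableM; first exact: cmeasurable_cst.
exact: cmeasurable_conjc.
Qed.

(** For unimodular [s] the conjugate of [s] is [1 / s], so [s * (z - ellmap tau (s * w))] is a
    quadratic polynomial in [s] with leading coefficient [- w]. The sum of its zeros is [z / w] and
    their product [tau * conjc w / w] is the square of [c], which has modulus [kappa]. Dividing by
    [c] turns the equation into that of Joukowsky, and the zeros are [c * u] and [c / u]. *)
Lemma ellmap_circle_factor (w : R[i]) : w != 0 -> exists a1 a2 : R[i],
  [/\ forall s, modc s = 1 -> modc (z - ellmap tau (s * w)) = modc w * (modc (s - a1) * modc (s - a2)),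
      modc a1 = kappa * jmod x0 (modc w ^+ 2 / b ^+ 2) &
      modc a2 = kappa / jmod x0 (modc w ^+ 2 / b ^+ 2)].
Proof.
move=> w0; set al := _ / _.
have w0' : 0 < modc w by rewrite modc_gt0.
have al0 : 0 < al by rewrite divr_gt0// exprn_gt0.
have sal : Num.sqrt al = modc w / b.
  by rewrite /al -expr_div_n sqrtr_sqr ger0_norm// divr_ge0 ?modc_ge0// ltW.
have sal0 : (Num.sqrt al)%:C != 0 :> R[i].
  by rewrite (inj_eq (@complexI _) _ 0) gt_eqF// sqrtr_gt0.
have st0 : sqrtc t != 0 by rewrite -modc_eq0 modc_sqrtc gt_eqF// sqrtr_gt0.
set u := jouk (x0 / (Num.sqrt al)%:C).
pose c := sqrtc t * (Num.sqrt al)%:C / w.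
have mc : modc c = kappa.
  rewrite !modcM modcV modc_sqrtc modcC sal ger0_norm ?divr_ge0 ?ltW//.
  by rewrite /kappa; field; rewrite !gt_eqF.
have csum : c * u + c / u = z / w.
  rewrite -mulrDr joukDV /c /x0; field.
  by rewrite w0 sal0 st0.
have cprod : (c * u) * (c / u) = tau * conjc w / w.
  rewrite mulrACA mulfV ?jouk_neq0// mulr1 /c /tau.
  transitivity (t * ((Num.sqrt al) ^+ 2)%:C / w ^+ 2).
    by rewrite rmorphXn/= -[in RHS](sqr_sqrtc t); field.
  rewrite sqr_sqrtr ?ltW// /al rmorphM/= rmorphXn/= -[in LHS]rmorphXn/= -mulcJ.
  rewrite fmorphV/=; field; rewrite w0/=.
  by rewrite (inj_eq (@complexI _) _ 0) gt_eqF// exprn_gt0.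
exists (c * u), (c / u); split.
- move=> s s1; have ss : conjc s * s = 1 by rewrite mulrC mulcJ s1 expr1n.
  rewrite -modcM -[LHS]mul1r -{1}s1 -modcM -modcM -modcN; congr modc.
  transitivity (w * (s ^+ 2 - z / w * s + tau * conjc w / w)).
    rewrite /ellmap; have -> : conjc (s * w) = conjc s * conjc w by rewrite rmorphM.
    have -> : tau * conjc w / w = tau * (conjc s * s) * conjc w / w by rewrite ss mulr1.
    by field.
  by rewrite -csum -cprod; ring.
- by rewrite modcM mc.
- by rewrite modcM modcV mc.
Qed.

Lemma lne_EFinM (c p q : R) : 0 < c -> 0 <= p -> 0 <= q ->
  (lne (c * (p * q))%:E = (ln c)%:E + (lne p%:E + lne q%:E))%E.
Proof.
move=> c0; rewrite le_eqVlt => /orP[/eqP<-|p0] q0.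
  rewrite mul0r mulr0 le0_lneNy//= le0_lneNy//.
move: q0; rewrite le_eqVlt => /orP[/eqP<-|q0].
  by rewrite !mulr0 le0_lneNy// lne_EFin.
by rewrite !lne_EFin ?mulr_gt0// -!EFinD !lnM ?posrE ?mulr_gt0.
Qed.

(** The zero of modulus [kappa / jmod] contributes nothing because [kappa <= 1 <= jmod]; the other
    one contributes the positive part of the logarithm of its modulus. *)
Lemma circle_mean (w : R[i]) : w != 0 ->
  (mu.-integrable setT (fun v => lne (modc (z - ellmap tau (sgnc (toC v) * w)))%:E)) /\
  (\int[mu]_v lne (modc (z - ellmap tau (sgnc (toC v) * w)))%:E =
  (ln (modc w) + Num.max 0 (ellslope x0 kappa (modc w ^+ 2 / b ^+ 2)))%:E)%E.
Proof.
move=> w0; have [a1 [a2 [E m1 m2]]] := ellmap_circle_factor w0.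
have w0' : 0 < modc w by rewrite modc_gt0.
have [i1 e1] := jensen_sgnc mur b0 radial a1.
have [i2 e2] := jensen_sgnc mur b0 radial a2.
set p := jmod x0 _ in m1 m2 *.
have p1 : 1 <= p := jmod_ge1 _ _.
have kp : 0 < kappa * p by rewrite mulr_gt0// (lt_le_trans ltr01).
have {}e1 : (\int[mu]_x lne (modc (sgnc (toC x) - a1))%:E =
    (Num.max 0 (ln (kappa * p)))%:E)%E.
  rewrite e1 m1; congr EFin; have [h|h] := leP 1 (kappa * p).
    by rewrite max_r// ln_ge0.
  by rewrite ln1 max_l// ln_le0// ltW.
have {}e2 : (\int[mu]_x lne (modc (sgnc (toC x) - a2))%:E = 0)%E.
  rewrite e2 m2 max_l ?ln1// ler_pdivrMr ?(lt_le_trans ltr01)// mul1r.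
  exact: le_trans kappa1 p1.
have F v : (lne (modc (z - ellmap tau (sgnc (toC v) * w)))%:E =
  (ln (modc w))%:E + (lne (modc (sgnc (toC v) - a1))%:E + lne (modc (sgnc (toC v) - a2))%:E))%E.
  by rewrite E ?modc_sgnc// lne_EFinM ?modc_ge0.
have ic : mu.-integrable setT (cst (ln (modc w))%:E).
  by apply: (@integrable_of_bound _ _ _ mu (fun=> _) `|ln (modc w)|) => //; exact: measurable_cst.
have i12 := integrableD measurableT i1 i2.
split.
  by under [X in _.-integrable _ X]eq_fun do rewrite F; exact: integrableD.
under eq_integral do rewrite F.
rewrite integralD// integralD// e1 e2 adde0 integral_cst//.
by rewrite [X in (_ * X + _)%E]probability_setT mule1.
Qed.

Let D := [set x | (0 < sqradius b x < 1)%R].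

Let mD : measurable D. Proof. exact: measurable_open_disk. Qed.

Let DP x : D x -> toC x != 0 /\ modc (toC x) < b.
Proof.
rewrite /D/= /sqradius => /andP[h1 h2]; split.
  by apply: contraTneq h1 => ->; rewrite modc0 expr0n/= mul0r ltxx.
rewrite ltr_pdivrMr ?exprn_gt0// mul1r in h2.
by rewrite -(ltr_pXn2r (n := 2)) ?nnegrE ?modc_ge0// ltW.
Qed.

Let slope_disk : (\int[mu]_(x in D) (Num.max 0 (ellslope x0 kappa (sqradius b x)))%:E =
  (ellsup x0 kappa 1)%:E)%E.
Proof.
rewrite -[ellsup _ _ 1]subr0.
apply: (@integral_of_sandwich _ _ _ mu (sqradius b) _ _
  (fun r => Num.max 0 (ellslope x0 kappa r)) (ellsup x0 kappa) 0).
- exact: measurable_sqradius.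
- exact: sqradiusP.
- apply: measurable_maxr; first exact: measurable_cst.
  apply: (@measurableT_comp _ _ _ _ _ _ (@ln R)); first exact: measurable_ln.
  apply: measurable_funM; first exact: measurable_cst.
  by apply: measurable_jmod; exact: measurable_sqradius.
- by move=> x _; rewrite le_max lexx.
- by move=> x y xp xy y1; exact: ellsup_sandwich.
- exact: ellsup_cvg0.
Qed.

Let mentropy : measurable_fun setT (fun x => - (ln (sqradius b x) / 2)).
Proof.
rewrite (_ : (fun x => _) = fun x => ln (sqradius b x) * (- 2^-1)); last first.
  by apply/funext => x; rewrite mulrN.
apply: measurable_funM; last exact: measurable_cst.
apply: (@measurableT_comp _ _ _ _ _ _ (@ln R)); first exact: measurable_ln.
exact: measurable_sqradius.
Qed.

(** Equivalently, the mean of [ln |w|] over the disk is [ln b - 1 / 2]. *)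
Let entropy_disk : (\int[mu]_(x in D) (- (ln (sqradius b x) / 2))%:E = (2^-1)%:E)%E.
Proof.
rewrite (_ : (2^-1)%:E = (halfent (1 : R) - 0)%:E); last first.
  by rewrite /halfent ln1 mulr0 !subr0 mul1r.
apply: (@integral_of_sandwich _ _ _ mu (sqradius b) _ _
  (fun r => - (ln r / 2)) halfent 0).
- exact: measurable_sqradius.
- exact: sqradiusP.
- exact: mentropy.
- move=> x /andP[xp x1]; rewrite oppr_ge0 pmulr_lle0// ln_le0//.
- by move=> x y xp xy _; exact: halfent_sandwich.
- exact: halfent_cvg0.
Qed.

Lemma ellmap_bound w : modc w < b -> modc (z - ellmap tau w) <= modc z + 2 * b.
Proof.
move=> wb; have tau1 : modc tau <= 1.
  rewrite modcM modcV modcC ger0_norm ?sqr_ge0// ler_pdivrMr ?exprn_gt0//.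
  by rewrite mul1r.
apply: le_trans (modcD _ _) _; rewrite lerD2l modcN.
apply: le_trans (modcD _ _) _; rewrite modcM modcJ.
have := modc_ge0 w; nra.
Qed.

Let M := modc z + 2 * b.

(** Polar integration is available for nonnegative integrands. On the disk [M] bounds the distance,
    so the maximum with 0 is active only on a null set. *)
Let G (w : R[i]) : \bar R :=
  maxe 0%E ((ln M)%:E - lne (modc (z - ellmap tau w))%:E)%E.

Let M0 : 0 < M.
Proof. by rewrite ltr_wpDl ?modc_ge0// mulr_gt0. Qed.

Let GE w : modc w < b -> G w = ((ln M)%:E - lne (modc (z - ellmap tau w))%:E)%E.
Proof.
move=> wb; rewrite /G max_r//.
have := ellmap_bound wb; rewrite -/M.
move=> hM; have [->|d0] := eqVneq (modc (z - ellmap tau w)) 0.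
  by rewrite le0_lneNy//= leey.
have p0 : 0 < modc (z - ellmap tau w) by rewrite lt_def d0 modc_ge0.
by rewrite lne_EFin// -EFinB lee_fin subr_ge0 ler_ln ?posrE.
Qed.

Let mL d (T : measurableType d) (f : T -> R[i]) : cmeasurable f ->
  measurable_fun setT (fun x => lne (modc (z - ellmap tau (f x)))%:E).
Proof.
move=> mf; apply: measurable_lne_EFin; apply: measurable_modc.
apply: (@cmeasurableD _ _ _ (fun=> z)); first exact: cmeasurable_cst.
by apply: cmeasurableN; exact: cmeasurable_ellmap.
Qed.

Let mG d (T : measurableType d) (f : T -> R[i]) : cmeasurable f ->
  measurable_fun setT (fun x => G (f x)).
Proof.
move=> mf; apply: measurable_maxe; first exact: measurable_cst.
by apply: emeasurable_funB; [exact: measurable_cst|exact: mL].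
Qed.

Let circle_G x : D x ->
  (\int[circle_law mu]_y G (toC (rot (toC y) x)) =
   (ln M - ln (modc (toC x)) - Num.max 0 (ellslope x0 kappa (sqradius b x)))%:E)%E.
Proof.
move=> /DP[w0 wb]; rewrite integral_law//; last 2 first.
- by apply: mG; apply: cmeasurableM; [exact: cmeasurable_toC|exact: cmeasurable_cst].
- by move=> y; rewrite /G le_max lexx.
have [i e] := circle_mean w0.
under eq_integral.
  move=> y _; rewrite /rot !ofCK GE; last by rewrite modcM modc_sgnc mul1r.
  over.
rewrite integralB//; last first.
  by apply: (@integrable_of_bound _ _ _ mu (fun=> ln M) `|ln M|) => //; exact: measurable_cst.
rewrite e integral_cst// [X in (_ * X - _)%E]probability_setT mule1.
by rewrite -EFinB /sqradius; congr EFin; ring.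
Qed.

Lemma integral_G : (\int[mu]_x G (toC x) =
  (ln M - (ln b - 2^-1 + ellsup x0 kappa 1))%:E)%E.
Proof.
have mGt : measurable_fun setT (fun x : R * R => G (toC x)).
  by apply: mG; exact: cmeasurable_toC.
have G0 w : (0 <= G w)%E by rewrite /G le_max lexx.
rewrite (integral_polar mur mGt)//.
pose k x := (\int[circle_law mu]_y G (toC (rot (toC y) x)))%E.
have mk : measurable_fun setT k.
  have mGr : measurable_fun setT (fun p : (R * R) * (R * R) => G (toC (rot (toC p.2) p.1))).
    apply: mG; apply: cmeasurableM; exact: measurableT_comp (@cmeasurable_toC R) _.
  exact: (@measurable_fun_fubini_tonelli_F _ _ _ _ _ (circle_law mu) _ mGr (fun p => G0 _)).
rewrite -[LHS]/(\int[mu]_x k x)%E (integral_disk b0 radial mk).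
have k0 x : (0 <= k x)%E by apply: integral_ge0.
(* The circle means are a difference of terms; moving the slope to the left makes all integrands
   nonnegative, and the integrals add without integrability conditions. *)
have sumE : (\int[mu]_(x in D) (k x + (Num.max 0 (ellslope x0 kappa (sqradius b x)))%:E) =
    \int[mu]_(x in D) ((ln M - ln b)%:E + (- (ln (sqradius b x) / 2))%:E))%E.
  apply: eq_integral => x; rewrite inE => Dx; rewrite /k circle_G// -!EFinD; congr EFin.
  have [w0 wb] := DP Dx; have w0' : 0 < modc (toC x) by rewrite modc_gt0.
  have -> : ln (sqradius b x) = 2 * ln (modc (toC x)) - 2 * ln b.
    by rewrite /sqradius ln_div ?posrE ?exprn_gt0// !lnXn// !mulr2n; ring.
  rewrite subrK; lra.
have mslope : measurable_fun D (fun x => (Num.max 0 (ellslope x0 kappa (sqradius b x)))%:E).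
  apply: measurable_funTS; apply/measurable_EFinP; apply: measurable_maxr; first exact: measurable_cst.
  apply: (@measurableT_comp _ _ _ _ _ _ (@ln R)); first exact: measurable_ln.
  apply: measurable_funM; first exact: measurable_cst.
  by apply: measurable_jmod; exact: measurable_sqradius.
have ment : measurable_fun D (fun x => (- (ln (sqradius b x) / 2))%:E).
  by apply: measurable_funTS; apply/measurable_EFinP; exact: mentropy.
have bM : 0 <= ln M - ln b.
  rewrite subr_ge0 ler_ln ?posrE//; apply: ler_wpDl; first exact: modc_ge0.
  by apply: ler_peMl; [exact: ltW|rewrite ler1n].
move: sumE; rewrite ge0_integralD; [|exact: mD|by move=> x _; exact: k0
  |exact: measurable_funTS mk|by move=> x _; rewrite lee_fin le_max lexx|exact: mslope].
rewrite slope_disk [X in _ = X -> _]ge0_integralD; [|exact: mD|by move=> x _; rewrite lee_fin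
  |exact: measurable_cst| |exact: ment]; last first.
  by move=> x /andP[x1 x2]; rewrite lee_fin oppr_ge0 pmulr_lle0// ln_le0// ltW.
rewrite entropy_disk integral_cst//.
rewrite [X in (_ + _ = _ * X + _)%E](_ : _ = 1%E) ?mule1; last exact: disk_full.
case: (\int[mu]_(x in D) k x)%E => [v| |]//=.
by rewrite -!EFinD => -[] h; congr EFin; lra.
Qed.

Lemma potential_ellmap : (\int[mu]_x lne (modc (z - ellmap tau (toC x)))%:E =
  (ln b - 2^-1 + ellsup x0 kappa 1)%:E)%E.
Proof.
have mGt : measurable_fun setT (fun x : R * R => G (toC x)).
  by apply: mG; exact: cmeasurable_toC.
have mLt := mL (@cmeasurable_toC R).
have iG : mu.-integrable setT (fun x => G (toC x)).
  apply/integrableP; split => //; under eq_integral.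
    move=> x _; rewrite gee0_abs; last by rewrite /G le_max lexx.
    over.
  by rewrite integral_G ltry.
have iM : mu.-integrable setT (cst (ln M)%:E).
  by apply: (@integrable_of_bound _ _ _ mu (fun=> ln M) `|ln M|) => //; exact: measurable_cst.
transitivity (\int[mu]_x ((ln M)%:E - G (toC x)))%E.
  rewrite (integral_disk b0 radial mLt) [RHS](integral_disk b0 radial); last first.
    by apply: emeasurable_funB => //; exact: measurable_cst.
  apply: eq_integral => x; rewrite inE => /DP[_ xb]; rewrite GE//.
  by case: (lne _) => [v| |]//=; rewrite -!EFinB; congr EFin; ring.
rewrite integralB// integral_G integral_cst// [X in (_ * X - _)%E]probability_setT mule1.
by rewrite -EFinB; congr EFin; ring.
Qed.

End linear_image_potential.

Section heat_potential.
Context {R : realType}.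

Lemma sqrtc_scale (t : R[i]) (al : R) : 0 < al ->
  sqrtc (t * al%:C) = sqrtc t * (Num.sqrt al)%:C.
Proof.
move=> al0; have a0 := ltW al0; case: t => p q /=.
rewrite !mulr0 subr0 add0r.
have -> : Num.sqrt ((p * al) ^+ 2 + (q * al) ^+ 2) = Num.sqrt (p ^+ 2 + q ^+ 2) * al.
  by rewrite !exprMn -mulrDl sqrtrM ?addr_ge0 ?sqr_ge0// sqrtr_sqr ger0_norm.
set N := Num.sqrt (p ^+ 2 + q ^+ 2).
have pN : `|p| <= N by rewrite -sqrtr_sqr ler_wsqrtr// lerDl sqr_ge0.
have E v : 0 <= v -> Num.sqrt (v * al / 2) = Num.sqrt (v / 2) * Num.sqrt al.
  by move=> v0; rewrite mulrAC sqrtrM// divr_ge0.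
move: pN; rewrite ler_norml => /andP[h1 h2].
rewrite -mulrDl -mulrBl !E ?subr_ge0// -?lerBlDr ?sub0r//.
rewrite mulf_eq0 (gt_eqF al0) orbF sgrM (gtr0_sg al0) mulr1 mulrA.
  by apply/eqP; rewrite eq_complex/= !mulr0 subr0 add0r !eqxx.
by rewrite lerNl.
Qed.

Variables (mu : probability (R * R)%type R) (b : R).
Hypotheses (mur : rotation_invariant mu) (b0 : 0 < b).
Hypothesis radial : forall r, 0 <= r <= b ->
  mu [set x | modc (toC x) < r] = (r ^+ 2 / b ^+ 2)%:E.

Definition ellipse_law (tau : R[i]) : probability (R * R)%type R :=
  law mu (cmeasurable_ellmap tau (@cmeasurable_toC R)).

Lemma ae_disk (B : set (R * R)) : measurable B ->
  (forall x, modc (toC x) < b -> ~ B x) -> mu B = 0%E.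
Proof.
move=> mB H; have mD := measurable_open_disk b.
have D0 : mu (~` [set x | (0 < sqradius b x < 1)%R]) = 0%E.
  by rewrite probability_setC// disk_full// subee.
apply: subset_measure0 D0 => //; first exact: measurableC.
move=> x Bx /= /andP[_]; rewrite /sqradius ltr_pdivrMr ?exprn_gt0// mul1r.
by rewrite ltr_pXn2r ?nnegrE ?modc_ge0 ?(ltW b0)// => /H.
Qed.

Lemma modc_ellmap_le (tau w : R[i]) : modc tau <= 1 ->
  modc (ellmap tau w) <= 2 * modc w.
Proof.
move=> t1; apply: le_trans (modcD _ _) _; rewrite modcM modcJ.
by rewrite mulr_natl mulr2n lerD2l ler_piMl// modc_ge0.
Qed.

Lemma Re_le_modc (w : R[i]) : `|complex.Re w| <= modc w.
Proof.
rewrite -(ler_pXn2r (n := 2)) ?nnegrE ?modc_ge0// sqr_modc real_normK ?num_real//.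
by rewrite lerDl sqr_ge0.
Qed.

Lemma Im_le_modc (w : R[i]) : `|complex.Im w| <= modc w.
Proof.
rewrite -(ler_pXn2r (n := 2)) ?nnegrE ?modc_ge0// sqr_modc real_normK ?num_real//.
by rewrite lerDr sqr_ge0.
Qed.

Lemma ellipse_law_compact (tau : R[i]) : modc tau <= 1 ->
  compactly_supported (ellipse_law tau).
Proof.
move=> t1; pose I := [set` `[(- (2 * b)), 2 * b]].
exists (I `*` I); first by apply: compact_setX; exact: segment_compact.
have mI : measurable (I `*` I) by apply: measurableX; exact: measurable_itv.
rewrite lawE; apply: ae_disk.
  rewrite -[X in measurable X]setTI.
  by apply: (cmeasurable_ellmap tau (@cmeasurable_toC R)) => //; exact: measurableC.
move=> x xb /=; apply.
have h : modc (ellmap tau (toC x)) <= 2 * b.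
  by apply: le_trans (modc_ellmap_le _ t1) _; rewrite ler_pM2l// ltW.
split; rewrite /I/= in_itv/= -ler_norml; apply: le_trans h.
  exact: Re_le_modc.
exact: Im_le_modc.
Qed.

Variable g : R -> R.
Hypothesis gE : forall al, 0 <= al <= 1 -> g al = g 0 + halfent al - al * ln b.

Lemma ft_ellpot (t z : R[i]) (al : R) : 0 < modc t -> 0 <= al <= 1 ->
  ft g t al z = g 0 + ellpot (z / sqrtc t) (Num.sqrt (modc t) / b) al.
Proof.
move=> t0 al01; rewrite /ft /ellpot; case: eqVneq => [_|aln]; first by rewrite addr0.
have al0 : 0 < al by rewrite lt_def aln (andP al01).1.
rewrite gE// sqrtc_scale// /scpot -mulrA -invfM ln_div ?posrE ?sqrtr_gt0//.
have lnsq (x : R) : 0 < x -> ln (Num.sqrt x) = ln x / 2.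
  move=> xp; rewrite -{2}(sqr_sqrtr (ltW xp)) lnXn ?sqrtr_gt0// mulr2n; lra.
rewrite !lnsq ?mulr_gt0// lnM ?posrE// /halfent; lra.
Qed.

Lemma ellipse_law_heat_potential (t : R[i]) : 0 < modc t -> modc t <= b ^+ 2 ->
  has_heat_potential g t (ellipse_law (t / (b ^+ 2)%:C)).
Proof.
move=> t0 tb; have b2 : 0 < b ^+ 2 by rewrite exprn_gt0.
split.
  apply: ellipse_law_compact.
  by rewrite modcM modcV modcC ger0_norm ?sqr_ge0// ler_pdivrMr ?mul1r.
move=> z; rewrite /log_potential integral_law_signed; last first.
  apply: measurable_lne_EFin; apply: measurable_modc.
  apply: (@cmeasurableD _ _ _ (fun=> z)); first exact: cmeasurable_cst.
  by apply: cmeasurableN; exact: cmeasurable_toC.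
under eq_integral do rewrite ofCK.
rewrite (potential_ellmap mur b0 radial t0 tb).
set x0 := z / sqrtc t; set kappa := Num.sqrt (modc t) / b.
have k0 : 0 < kappa by rewrite divr_gt0 ?sqrtr_gt0.
have E : [set (ft g t al z)%:E | al in `[0%R, 1%R]] =
    EFin @` [set g 0 + ellpot x0 kappa al | al in `[0, 1]].
  rewrite image_comp; apply: eq_imagel => al /=; rewrite in_itv/= => al01.
  by rewrite ft_ellpot.
have le1 al : 0 <= al <= 1 -> ellpot x0 kappa al <= ellsup x0 kappa 1.
  by move=> /andP[? ?]; exact: ellpot_le_sup.
have ub : has_ubound [set g 0 + ellpot x0 kappa al | al in `[0, 1]].
  exists (g 0 + ellsup x0 kappa 1) => _ [al + <-]; rewrite /= in_itv/= => al01.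
  by rewrite lerD2l le1.
have ne : [set g 0 + ellpot x0 kappa al | al in `[0, 1]] !=set0.
  by exists (g 0 + ellpot x0 kappa 0); exists 0 => //=; rewrite in_itv/= lexx ler01.
rewrite E ereal_sup_EFin// -EFinB; congr EFin.
have -> : sup [set g 0 + ellpot x0 kappa al | al in `[0, 1]] = g 0 + ellsup x0 kappa 1.
  apply/eqP; rewrite eq_le; apply/andP; split.
    apply: ge_sup => // _ [al + <-]; rewrite /= in_itv/= => al01.
    by rewrite lerD2l le1.
  rewrite -lerBrDl; apply: ellsup_le => // al h0 h1; rewrite lerBrDl.
  by apply: ub_le_sup => //; exists al => //=; rewrite in_itv/= h0.
(* [g 1 = g 0 + 1 / 2 - ln b], so subtracting [g 1] leaves exactly the constant [ln b - 1 / 2] of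
   the potential. *)
by rewrite (gE (al := 1)) ?ler01 ?lexx// /halfent ln1; lra.
Qed.

End heat_potential.

(** * Maximizers *)

Section maximizer.
Context {R : realType}.
Variable g : R -> R.

Definition is_maximizer (r al : R) : Prop := 0 <= al <= 1 /\
  forall be, 0 <= be <= 1 -> g be + be * ln r <= g al + al * ln r.

Lemma derive_quotient (al e : R) : derivable g al 1 -> 0 < e ->
  exists2 d, 0 < d & forall h, h != 0 -> `|h| < d ->
    `|(g (al + h) - g al) / h - derive1 g al| < e.
Proof.
move=> dg e0; have := dg; rewrite /derivable => /cvg_ex[l hl].
have E : derive1 g al = l by rewrite derive1E /derive; exact: cvg_lim hl.
move/cvgrPdist_lt: (hl) => /(_ _ e0); rewrite near_withinE => -[d /= d0 H].
exists d => // h h0 hd; have := H h.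
rewrite /ball/= sub0r normrN => /(_ hd h0).
by rewrite distrC E /GRing.scale/= mulr1 [h + al]addrC mulrC.
Qed.

Lemma maximizer_derive (r al : R) : 0 < al < 1 -> derivable g al 1 ->
  is_maximizer r al -> derive1 g al = - ln r.
Proof.
move=> /andP[a0 a1] dg [_ H].
apply/eqP; rewrite -subr_eq0 opprK; apply/negPn/negP => n0.
have e0 : 0 < `|derive1 g al + ln r| by rewrite normr_gt0.
have [d d0 Hd] := derive_quotient dg e0.
pose h : R := Num.min (d / 2) (Num.min (al / 2) ((1 - al) / 2)).
have h0 : 0 < h by rewrite !lt_min !divr_gt0//= subr_gt0.
have hd : h < d.
  by apply: le_lt_trans (_ : d / 2 < d); [rewrite ge_min lexx|lra].
have ha : h <= al / 2 by rewrite !ge_min lexx orbT.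
have ha1 : h <= (1 - al) / 2 by rewrite !ge_min lexx !orbT.
have hn : h != 0 by rewrite gt_eqF.
have P1 := H (al + h) (ltac:(apply/andP; split; lra)).
have P2 := H (al - h) (ltac:(apply/andP; split; lra)).
have Q1 : (g (al + h) - g al) / h <= - ln r by rewrite ler_pdivrMr//; lra.
have Q2 : - ln r <= (g (al - h) - g al) / (- h).
  by rewrite invrN mulrN -mulNr ler_pdivlMr//; lra.
have := Hd h hn; rewrite ger0_norm ?ltW// => /(_ hd).
have := Hd (- h); rewrite oppr_eq0 normrN => /(_ hn); rewrite (ger0_norm (ltW h0)) => /(_ hd).
move: Q1 Q2 n0; set u := (_ / h); set v := (_ / - h); set D := derive1 g al.
move=> Q1 Q2 n0; have [s|s] := ltP 0 (D + ln r).
  rewrite (gtr0_norm s) => _; rewrite ltr_norml => /andP[k _]; lra.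
rewrite (ler0_norm s) => + _; rewrite ltr_norml => /andP[_ k]; lra.
Qed.

Hypothesis gcont : {within `[0, 1], continuous g}.

Lemma maximizer_exists r : exists al, is_maximizer r al.
Proof.
have [|al al01 H] := @EVT_max R (fun al => g al + al * ln r) 0 1 ler01.
  move=> x; apply: cvgD; first exact: gcont.
  have H : {within `[0, 1], continuous (fun al : R => al * ln r)}.
    apply: continuous_subspaceT => y.
    by apply: cvgM; [exact: cvg_id|exact: cvg_cst].
  exact: H.
by exists al; split; [rewrite in_itv/= in al01|move=> be b01; apply: H; rewrite in_itv].
Qed.

Lemma alpha0P r : 0 < r -> is_maximizer r (alpha0 g r).
Proof.
move=> r0; rewrite /alpha0; case: xgetP => [a _ [a01 H]|H].
  by split => // be /H; rewrite lne_EFin// -!EFinM -!EFinD lee_fin.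
have [al [al01 mal]] := maximizer_exists r; exfalso; apply: (H al); split => // be /mal.
by rewrite lne_EFin// -!EFinM -!EFinD lee_fin.
Qed.

Lemma maximizer_mono r s al be : 0 < r -> r < s -> is_maximizer r al ->
  is_maximizer s be -> al <= be.
Proof.
move=> r0 rs [a01 Ha] [b01 Hb]; have h1 := Ha _ b01; have h2 := Hb _ a01.
have h3 : (be - al) * (ln s - ln r) >= 0 by lra.
have h4 : ln r < ln s by rewrite ltr_ln ?posrE// (lt_trans r0).
by rewrite leNgt; apply/negP => ba; nra.
Qed.

Lemma alpha0_mono r s : 0 < r -> r <= s -> alpha0 g r <= alpha0 g s.
Proof.
move=> r0; rewrite le_eqVlt => /orP[/eqP->//|rs].
by apply: (maximizer_mono r0 rs); apply: alpha0P => //; exact: lt_trans rs.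
Qed.

Hypothesis gd1 : forall x, 0 < x < 1 -> derivable g x 1.

(** A common interior maximizer [al] for two radii would give [- ln r] and [- ln s] as the value of
    the derivative of [g] at [al]. *)
Lemma alpha0_strict r s : 0 < r -> r < s -> 0 < alpha0 g s -> alpha0 g r < 1 ->
  alpha0 g r < alpha0 g s.
Proof.
move=> r0 rs s1 r1; have s0 := lt_trans r0 rs.
rewrite lt_neqAle (alpha0_mono r0 (ltW rs)) andbT; apply/eqP => E.
have a01 : 0 < alpha0 g r < 1 by rewrite r1 E s1.
have := maximizer_derive a01 (gd1 a01) (alpha0P r0).
rewrite {1}E (maximizer_derive _ _ (alpha0P s0)) -?E//; last exact: gd1.
move=> /oppr_inj /ln_inj; rewrite !posrE => /(_ s0 r0) sr.
by move: rs; rewrite sr ltxx.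
Qed.

Hypothesis gconc : concave_on01 g.
Hypothesis gd2 : forall x, 0 < x < 1 -> derive1n 2 g x < 0.

(** Between two maximizers concavity makes [g] affine, so its second derivative vanishes at the
    midpoint. *)
Lemma maximizer_unique r al be : is_maximizer r al -> is_maximizer r be -> al = be.
Proof.
wlog ab : al be / al <= be.
  by move=> W Ha Hb; have [/W->//|/ltW/W->//] := leP al be.
move=> [a01 Ha] [b01 Hb]; apply/eqP; rewrite eq_le ab/= leNgt; apply/negP => {}ab.
have /andP[a0 a1] := a01; have /andP[b0 b1] := b01.
have ba : 0 < be - al by rewrite subr_gt0.
have E : g al + al * ln r = g be + be * ln r.
  by apply/eqP; rewrite eq_le Ha ?Hb.
have aff z : al <= z <= be -> g z = g al + (al - z) * ln r.
  move=> /andP[az zb].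
  have z01 : 0 <= z <= 1 by rewrite (le_trans a0)// (le_trans zb).
  have h1 := Ha _ z01.
  pose l := (be - z) / (be - al).
  have l01 : 0 <= l <= 1.
    by rewrite /l divr_ge0 ?subr_ge0//= ?ler_pdivrMr ?mul1r ?lerB// ltW.
  have lz : l * al + (1 - l) * be = z by rewrite /l; field; rewrite gt_eqF.
  have h2 := gconc a01 b01 l01; rewrite lz in h2.
  apply/eqP; rewrite eq_le; apply/andP; split; first by lra.
  apply: le_trans h2; rewrite (_ : g be = g al + (al - be) * ln r); last by lra.
  rewrite -{1}lz le_eqVlt; apply/orP; left; apply/eqP; ring.
pose m := (al + be) / 2.
have am : al < m by rewrite /m; lra.
have mb : m < be by rewrite /m; lra.
have m01 : 0 < m < 1 by rewrite (le_lt_trans a0)// (lt_le_trans mb).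
have dz z : al < z < be -> derive1 g z = - ln r.
  move=> /andP[az zb]; rewrite derive1E.
  rewrite (@near_eq_derive _ _ _ g (fun z => (g al + al * ln r) - z * ln r)).
    rewrite (_ : (fun z => _) = cst (g al + al * ln r) - (fun z : R => z * ln r)); last by [].
    rewrite deriveB// derive_cst sub0r.
    rewrite (_ : (fun z : R => z * ln r) = (fun z : R => (ln r) *: z)); last first.
      by apply/funext => y; rewrite mulrC.
    by rewrite deriveZ// derive_id /GRing.scale/= mulr1.
  near=> y; rewrite aff; first by ring.
  by apply/andP; split; apply: ltW; near: y; [exact: lt_nbhsr|exact: lt_nbhsl].
have := gd2 m01; rewrite /derive1n/= derive1E.
rewrite (@near_eq_derive _ _ _ (derive1 g) (cst (- ln r))).
  by rewrite derive_cst ltxx.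
near=> y; apply: dz.
by apply/andP; split; near: y; [exact: lt_nbhsr|exact: lt_nbhsl].
Unshelve. all: by end_near. Qed.

Lemma alpha0E r al : 0 < r -> is_maximizer r al -> alpha0 g r = al.
Proof. by move=> r0; apply: maximizer_unique; exact: alpha0P. Qed.

Lemma concave_tangent al x : 0 < al < 1 -> 0 <= x <= 1 ->
  g x <= g al + derive1 g al * (x - al).
Proof.
move=> al01 x01; have [->|xa] := eqVneq x al; first by rewrite subrr mulr0 addr0.
apply/ler_addgt0Pr => e e0.
have xan : x - al != 0 by rewrite subr_eq0.
have n0 : 0 < `|x - al| by rewrite normr_gt0.
have [d d0 Hd] := derive_quotient (gd1 al01) (divr_gt0 e0 n0).
pose l := Num.min 1 (d / 2 / `|x - al|).
have l0 : 0 < l by rewrite lt_min ltr01 !divr_gt0.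
have l1 : l <= 1 by rewrite ge_min lexx.
have hd : `|l * (x - al)| < d.
  rewrite normrM gtr0_norm//; apply: le_lt_trans (_ : d / 2 < d); last by lra.
  by rewrite -ler_pdivlMr// ge_min lexx orbT.
have hn : l * (x - al) != 0 by rewrite mulf_neq0// gt_eqF.
have := Hd _ hn hd.
have C : l * g x + (1 - l) * g al <= g (al + l * (x - al)).
  have -> : al + l * (x - al) = l * x + (1 - l) * al by ring.
  by apply: gconc => //; [rewrite (ltW (andP al01).1) (ltW (andP al01).2)|rewrite ltW].
set u := g (al + _) in C *.
have -> : (u - g al) / (l * (x - al)) = (u - g al) / l / (x - al).
  by rewrite invfM mulrA.
have Cu : g x - g al <= (u - g al) / l by rewrite ler_pdivlMr//; lra.
move=> Q; have : `|(u - g al) / l - derive1 g al * (x - al)| < e.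
  rewrite -(ltr_pM2r n0) -?normrM in Q; last first.
  move: Q; rewrite divfK ?gt_eqF// mulrBl divfK//.
rewrite ltr_norml => /andP[_ k]; lra.
Qed.

(** The radius is read off from the critical point equation [g' al = - ln r]; the tangent inequality
    shows that [al] is a global maximizer for it. *)
Lemma alpha0_surj al : 0 < al < 1 -> exists2 r, 0 < r & alpha0 g r = al.
Proof.
move=> al01; exists (expR (- derive1 g al)); first exact: expR_gt0.
apply: alpha0E; first exact: expR_gt0.
split; first by case/andP: al01 => /ltW-> /ltW.
move=> be b01; rewrite expRK; have := concave_tangent al01 b01; lra.
Qed.

End maximizer.

(** * The profile and the singular time of a disk *)

Section quadratic_maximizer.
Context {R : realType}.
Variables (g : R -> R) (b : R).
Hypotheses (b0 : 0 < b) (gcont : {within `[0, 1], continuous g}).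
Hypothesis a0E : forall r, 0 < r <= b -> alpha0 g r = r ^+ 2 / b ^+ 2.

Let maxE al : 0 < al <= 1 -> is_maximizer g (b * Num.sqrt al) al.
Proof.
move=> /andP[a0 a1]; have s0 : 0 < Num.sqrt al by rewrite sqrtr_gt0.
have sb : b * Num.sqrt al <= b.
  by rewrite -[leRHS]mulr1 ler_pM2l// -[leRHS]sqrtr1 ler_wsqrtr.
have br : 0 < b * Num.sqrt al by rewrite mulr_gt0.
have := alpha0P gcont br; rewrite a0E ?br// exprMn sqr_sqrtr ?(ltW a0)//.
by rewrite mulrAC divff ?mul1r// gt_eqF// exprn_gt0.
Qed.

Let ln_radius al : 0 < al -> ln (b * Num.sqrt al) = ln b + ln al / 2.
Proof.
move=> a0; have s0 : 0 < Num.sqrt al by rewrite sqrtr_gt0.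
rewrite lnM ?posrE// -[in RHS](sqr_sqrtr (ltW a0)) lnXn//.
by rewrite mulr2n; field.
Qed.

Let phi al := g al - halfent al + al * ln b.

(** Maximality of [u] at radius [b * sqrt u], tested against [v], and conversely, encloses the
    increment of [g] in the same way as [halfent_sandwich] encloses that of [halfent]. The
    difference has increments at most [(v - u) * (ln v - ln u) / 2] and is constant. *)
Let phi1 x : 0 < x <= 1 -> phi x = phi 1.
Proof.
move=> /andP[x0 x1]; apply: (@eq_of_variation_bound _ phi (fun y => ln y / 2) _ _ x1).
move=> u v xu uv v1; have u0 := lt_le_trans x0 xu; have v0 := lt_le_trans u0 uv.
have u1 := le_trans uv v1.
have [_ /(_ v (ltac:(by rewrite v1 ltW)))] := maxE (al := u) (ltac:(by rewrite u0)).
have [_ /(_ u (ltac:(by rewrite u1 ltW)))] := maxE (al := v) (ltac:(by rewrite v0)).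
rewrite !ln_radius// => h1 h2; have /andP[h3 h4] := halfent_sandwich u0 uv.
by rewrite ler_norml /phi; apply/andP; split; lra.
Qed.

Lemma profile_of_quadratic_maximizer al : 0 <= al <= 1 ->
  g al = g 0 + halfent al - al * ln b.
Proof.
move=> /andP[+ a1]; rewrite le_eqVlt => /orP[/eqP<-|a0].
  by rewrite /halfent; ring.
suff : phi al = g 0 by rewrite /phi; lra.
rewrite phi1 ?a0//; pose u (n : nat) : R := n.+1%:R^-1.
have u0 n : 0 < u n by rewrite invr_gt0.
have u1 n : u n <= 1 by rewrite invf_le1// ler1n.
have cu : u @ \oo --> (0 : R) by exact: cvg_harmonic.
have cg : g (u n) @[n --> \oo] --> g 0.
  have [_ h _] := (continuous_within_itvP (g : R -> R^o) ltr01).1 gcont.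
  by move/cvg_at_rightP : h; apply.
have cphi : phi (u n) @[n --> \oo] --> g 0.
  rewrite -[X in _ --> X](_ : g 0 - 0 + 0 * ln b = _); last by ring.
  apply: cvgD; first by apply: cvgB => //; exact: halfent_cvg0.
  by apply: cvgM => //; exact: cvg_cst.
rewrite -(cvg_lim _ cphi)//; apply/esym; apply: lim_near_cst => //.
by apply: nearW => n; rewrite phi1// u0 u1.
Qed.

Hypothesis gd1 : forall x, 0 < x < 1 -> derivable g x 1.

Let dgE x : 0 < x < 1 -> derive1 g x = - (ln b + ln x / 2).
Proof.
move=> x01; have /andP[x0 x1] := x01.
rewrite (maximizer_derive x01 (gd1 x01) (maxE (al := x) _)) ?ln_radius//.
by rewrite x0 ltW.
Qed.

Lemma quadratic_maximizer_dg0 : dg0 g = +oo%E.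
Proof.
apply: cvg_lim; first exact: ereal_hausdorff.
apply/cvgeryP; apply: (cvg_trans (G := (fun x => - (ln b + ln x / 2)) @ 0^'+)).
  apply: near_eq_cvg; near=> x; rewrite dgE//; apply/andP; split; near: x.
    exact: nbhs_right_gt.
  exact: nbhs_right_lt.
apply/cvgryPge => A; near=> x.
suff : ln x <= - 2 * (A + ln b) by lra.
by near: x; move/cvgrNyPle : (@lnNy R); apply.
Unshelve. all: by end_near. Qed.

Lemma quadratic_maximizer_dg1 : dg1 g = (- ln b)%:E.
Proof.
apply: cvg_lim; first exact: ereal_hausdorff.
apply: cvg_EFin; first by apply: nearW.
have E : (fun x => - (ln b + ln x / 2)) @ 1^'- --> - ln b.
  rewrite -[X in _ --> X](_ : - (ln b + ln 1 / 2) = _); last by rewrite ln1; ring.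
  apply: cvgN; apply: cvgD; first exact: cvg_cst.
  apply: cvgM; last exact: cvg_cst.
  by apply: cvg_at_left_filter; exact: continuous_ln.
apply: cvg_trans E.
apply: near_eq_cvg; near=> x; rewrite /= dgE//; apply/andP; split; near: x.
  exact: nbhs_left_gt.
exact: nbhs_left_lt.
Unshelve. all: by end_near. Qed.

(** The supremum runs over []0, b[], where [alpha0 s / s = s / b ^ 2] has slope [1 / b ^ 2]. The
    single point [b / 2] suffices for this inequality, which turns [modc t < t_sing g] into
    [modc t < b ^ 2]. *)
Lemma quadratic_maximizer_tsing : (t_sing g <= (b ^+ 2)%:E)%E.
Proof.
rewrite /t_sing; set S := ereal_sup _.
have hS : ((b ^+ 2)^-1%:E <= S)%E.
  apply: ereal_sup_ubound; exists (b / 2).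
    rewrite /= quadratic_maximizer_dg0 quadratic_maximizer_dg1/= !lte_fin opprK lnK ?posrE//.
    by apply/andP; split; have := b0; lra.
  congr (_%:E); rewrite derive1E.
  rewrite (@near_eq_derive _ _ _ _ (fun u => (b ^+ 2)^-1 *: u)).
    by rewrite deriveZ// derive_id /GRing.scale/= mulr1 ger0_norm// invr_ge0 sqr_ge0.
  near=> u.
  have u0 : 0 < u by near: u; apply: lt_nbhsr; rewrite divr_gt0.
  have ub : u < b by near: u; apply: lt_nbhsl; have := b0; lra.
  rewrite a0E ?u0 ?(ltW ub)// /GRing.scale/=; field.
  by rewrite !gt_eqF.
have b2 : 0 < b ^+ 2 by rewrite exprn_gt0.
move: S hS => [s| |].
- rewrite lee_fin => hs; have s0 : 0 < s by rewrite (lt_le_trans _ hs)// invr_gt0.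
  by rewrite inver gt_eqF// lee_fin invf_ple ?posrE.
- by move=> _; rewrite invey lee_fin ltW.
- by move=> _; rewrite inveNy leNye.
Unshelve. all: by end_near. Qed.

End quadratic_maximizer.

(** * Uniform measures on disks *)

Section plane_lebesgue.
Context {R : realType}.

(** Uniqueness of Lebesgue measure: the rescaled image measure has the right value on half-open
    intervals. *)
Lemma lebesgue_affine (a c : R) (A : set R) : a != 0 -> measurable A ->
  (lebesgue_measure ((fun x : R => (a * x + c)%R) @^-1` A) =
   `|a|^-1%:E * lebesgue_measure A)%E.
Proof.
move=> a0 mA; have na : 0 < `|a| by rewrite normr_gt0.
pose f (x : measurableTypeR R) : measurableTypeR R := a * x + c.
have mf : measurable_fun setT f.
  by apply: measurable_funD => //; apply: measurable_funM.
pose m := mscale (NngNum (ltW na)) (pushforward lebesgue_measure f).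
have E : lebesgue_measure A = m mf A.
  apply: lebesgue_measure_unique => // _ [[u v] _ <-].
  rewrite /m/= /mscale/= /pushforward/=.
  have [p|n|/esym z] := ltgtP 0 a; last by rewrite z eqxx in a0.
    rewrite (_ : f @^-1` _ = `](u - c) / a, (v - c) / a]%classic).
      rewrite !lebesgue_measure_itv/= !lte_fin ltr_pM2r ?invr_gt0// ltrD2r.
      case: ifP => _; last by rewrite mule0.
      by rewrite gtr0_norm// -EFinD -EFinM; congr (_%:E); field.
    apply/seteqP; split => x; rewrite /= !in_itv/= /f ltr_pdivrMr// ler_pdivlMr//;
      rewrite ltrBlDr lerBrDr [x * a]mulrC//.
  (* A negative factor reverses the interval, so that its closed end is now on the left. *)
  rewrite (_ : f @^-1` _ = `[(v - c) / a, (u - c) / a[%classic).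
    rewrite !lebesgue_measure_itv/= !lte_fin ltr_nM2r ?invr_lt0// ltrD2r.
    case: ifP => _; last by rewrite mule0.
    by rewrite ltr0_norm// -EFinD -EFinM; congr (_%:E); field; rewrite lt_eqF.
  apply/seteqP; split => x; rewrite /= !in_itv/= /f ltr_ndivlMr// ler_ndivrMr//;
    by rewrite ltrBlDr lerBrDr [x * a]mulrC andbC.
rewrite E /m /mscale/= muleA -EFinM mulVf ?gt_eqF// mul1e /pushforward; reflexivity.
Qed.

Local Notation leb := (@lebesgue_measure R).
Local Notation leb2 := (leb \x leb)%E.

Lemma leb2_swap (A : set (R * R)) : measurable A ->
  (leb2 A = \int[leb]_y leb (ysection A y))%E.
Proof.
move=> mA; rewrite -[RHS]/((leb \x^ leb)%E A).
by apply: product_measure_unique => // B C mB mC /=; rewrite product_measure2E.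
Qed.

Definition shear_fst (a k : R) (p : R * R) : R * R := (a * p.1 + k * p.2, p.2).
Definition shear_snd (k a : R) (p : R * R) : R * R := (p.1, k * p.1 + a * p.2).

Lemma measurable_shear_fst a k A : measurable A -> measurable (shear_fst a k @^-1` A).
Proof.
move=> mA; rewrite -[X in measurable X]setTI.
suff : measurable_fun setT (shear_fst a k) by apply.
apply/measurable_fun_pair; last exact: measurable_snd.
by apply: measurable_funD; apply: measurable_funM.
Qed.

Lemma measurable_shear_snd k a A : measurable A -> measurable (shear_snd k a @^-1` A).
Proof.
move=> mA; rewrite -[X in measurable X]setTI.
suff : measurable_fun setT (shear_snd k a) by apply.
apply/measurable_fun_pair; first exact: measurable_fst.
by apply: measurable_funD; apply: measurable_funM.
Qed.

Lemma leb2_shear_snd (k a : R) (A : set (R * R)) : a != 0 -> measurable A ->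
  (leb2 (shear_snd k a @^-1` A) = `|a|^-1%:E * leb2 A)%E.
Proof.
move=> a0 mA; rewrite /product_measure1 -ge0_integralZl//=; last exact: measurable_fun_xsection.
apply: eq_integral => x _; rewrite -(lebesgue_affine (k * x) a0); last exact: measurable_xsection.
congr (leb _); apply/seteqP; split => y; rewrite /= /xsection/= !inE/= addrC//.
Qed.

Lemma leb2_shear_fst (k a : R) (A : set (R * R)) : a != 0 -> measurable A ->
  (leb2 (shear_fst a k @^-1` A) = `|a|^-1%:E * leb2 A)%E.
Proof.
move=> a0 mA; rewrite !leb2_swap//; last exact: measurable_shear_fst.
rewrite -ge0_integralZl//=; last exact: measurable_fun_ysection.
apply: eq_integral => y _; rewrite -(lebesgue_affine (k * y) a0); last exact: measurable_ysection.
congr (leb _); apply/seteqP; split => x; rewrite /= /ysection/= !inE//=.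
Qed.

Let measurable_preimage_rot (s : R[i]) (A : set (R * R)) :
  measurable A -> measurable (rot s @^-1` A).
Proof. by move=> mA; rewrite -[X in measurable X]setTI; exact: measurable_rot. Qed.

(** A rotation with nonzero cosine is the product of two shears with inverse
scalings; a rotation by a right angle is the square of such a rotation. *)
Lemma leb2_rot (s : R[i]) (A : set (R * R)) : modc s = 1 -> measurable A ->
  leb2 (rot s @^-1` A) = leb2 A.
Proof.
have key u B : modc u = 1 -> complex.Re u != 0 -> measurable B ->
    leb2 (rot u @^-1` B) = leb2 B.
  case: u => c t; rewrite /modc/=; move=> u1 c0 mB.
  have ct : c ^+ 2 + t ^+ 2 = 1.
    by rewrite -[LHS]sqr_sqrtr ?u1 ?expr1n// addr_ge0// sqr_ge0.
  pose C := shear_snd (t / c) c^-1 @^-1` B.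
  have mC : measurable C by exact: measurable_shear_snd.
  transitivity (leb2 (shear_fst c (- t) @^-1` C)).
    congr (leb2 _); apply/funext => -[x y]; rewrite /C/= /rot/=; congr (B (_, _)).
      by rewrite /toC/=; ring.
    rewrite /toC/= (_ : _ + c^-1 * y = t * x + (1 - t ^+ 2) / c * y); last by field.
    rewrite (_ : 1 - t ^+ 2 = c ^+ 2); last by lra.
    by field.
  rewrite leb2_shear_fst// leb2_shear_snd ?invr_eq0//.
  by rewrite muleA -EFinM normfV invrK mulVf ?mul1e ?normr_eq0.
move=> s1 mA; have [s0|s0] := eqVneq (complex.Re s) 0; last exact: key.
have [th _ sE] := unit_expi s1.
have hE : s = expi (th / 2) * expi (th / 2).
  by rewrite -expiD sE; congr expi; field.
have h1 : complex.Re (expi (th / 2)) != 0.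
  apply/eqP => h0; have := s0; rewrite hE ReM.
  have := cos2Dsin2 (th / 2); move: h0; rewrite /expi /=; nra.
etransitivity; last exact: (key _ _ (modc_expi _) h1 mA).
etransitivity; last exact: (key _ _ (modc_expi _) h1 (measurable_preimage_rot _ mA)).
congr (leb2 _); apply/funext => x /=.
by rewrite /rot !ofCK mulrA -hE.
Qed.

Lemma leb2_scale (r : R) (A : set (R * R)) : 0 < r -> measurable A ->
  (leb2 (rot r%:C @^-1` A) = (r ^- 2)%:E * leb2 A)%E.
Proof.
move=> r0 mA; have rn : r != 0 by rewrite gt_eqF.
pose C := shear_snd 0 r @^-1` A.
have mC : measurable C by exact: measurable_shear_snd.
transitivity (leb2 (shear_fst r 0 @^-1` C)).
  congr (leb2 _); apply/funext => -[x y]; rewrite /C/= /rot/=; by congr (A (_, _)); rewrite /toC/=; ring.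
rewrite leb2_shear_fst// leb2_shear_snd//.
by rewrite muleA -EFinM gtr0_norm// -invfM -expr2.
Qed.

Definition disk (r : R) : set (R * R) := [set x | modc (toC x) < r].

Lemma measurable_disk r : measurable (disk r).
Proof.
rewrite /disk (_ : [set _ | _] = (fun x => modc (toC x)) @^-1` `]-oo, r[); last first.
  by apply/seteqP; split => x /=; rewrite in_itv.
by rewrite -[X in measurable X]setTI; exact: measurable_modc_toC.
Qed.

Lemma leb2_disk_gt0 r : 0 < r -> (0 < leb2 (disk r))%E.
Proof.
move=> r0; have r2 : 0 < r / 2 by rewrite divr_gt0.
apply: (@lt_le_trans _ _ (leb2 (`]0, r / 2[ `*` `]0, r / 2[))).
  rewrite product_measure1E//= !lebesgue_measure_itv/= lte_fin r2 sube0 -EFinM lte_fin.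
  by rewrite mulr_gt0.
apply: le_measure; rewrite ?inE//; [exact: measurableX|exact: measurable_disk|].
move=> [x y] [/=]; rewrite !in_itv/= => /andP[x0 xr] /andP[y0 yr].
rewrite /disk/= -(ltr_pXn2r (n := 2)) ?nnegrE ?modc_ge0 ?(ltW r0)// sqr_modc/=.
nra.
Qed.

Lemma leb2_disk_lty r : (leb2 (disk r) < +oo)%E.
Proof.
apply: (@le_lt_trans _ _ (leb2 (`]-r, r[ `*` `]-r, r[))).
  apply: le_measure; rewrite ?inE//; [exact: measurable_disk|exact: measurableX|].
  move=> x /= xr; rewrite !in_itv/= -!ltr_norml.
  by split; [apply: le_lt_trans (Re_le_modc (toC x)) xr|apply: le_lt_trans (Im_le_modc (toC x)) xr].
rewrite product_measure1E//= !lebesgue_measure_itv/=; case: ifP => _; last by rewrite mul0e ltry.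
by rewrite -EFinD -EFinM ltry.
Qed.

Lemma leb2_disk_scale r b : 0 < r -> 0 < b ->
  (leb2 (disk r) = (r ^+ 2 / b ^+ 2)%:E * leb2 (disk b))%E.
Proof.
move=> r0 b0; have br0 : 0 < b / r by rewrite divr_gt0.
transitivity (leb2 (rot (b / r)%:C @^-1` disk b)).
  congr (leb2 _); apply/funext => x; rewrite /disk/= /rot ofCK modcM modcC gtr0_norm//.
  by apply/propext; rewrite mulrAC ltr_pdivrMr// ltr_pM2l.
rewrite leb2_scale//; last exact: measurable_disk.
by congr (_%:E * _)%E; rewrite expr_div_n invf_div.
Qed.

End plane_lebesgue.

Section uniform_disk.
Context {R : realType}.
Implicit Types mu : probability (R * R)%type R.

Lemma eq_probability_rays (P Q : probability R R) :
  (forall r, P `]-oo, r[%classic = Q `]-oo, r[%classic) ->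
  forall A, measurable A -> P A = Q A.
Proof.
move=> PQ A mA; pose G : set (set R) := @RGenInftyO.G R.
have HE : [set X | G X /\ X `<=` setT] = G by apply/seteqP; split => // X [].
apply: (g_sigma_algebra_measure_unique_trace G setT) => //; rewrite ?HE.
- by move=> _ [r ->]; exact: measurable_itv.
- by move=> _ _ [x ->] [y ->]; exists (Num.min x y); apply/seteqP; split => z;
    rewrite /= !in_itv/= lt_min => /andP.
- by transitivity (1%E : \bar R); [exact: probability_setT|exact/esym/probability_setT].
- by move=> _ [r ->]; exact: PQ.
- by apply: le_lt_trans (probability_le1 _ _) _; rewrite ?ltry.
- suff : G.-sigma.-measurable A by [].
  by rewrite -RGenInftyO.measurableE.
Qed.

(** Uniqueness of Haar measure on the circle: the double integral of [F (y * x)] is constant in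
    either variable once the other is integrated out, and Tonelli equates the two results. *)
Lemma circle_law_unique mu1 mu2 : rotation_invariant mu1 -> rotation_invariant mu2 ->
  mu1 [set 0] = 0%E -> mu2 [set 0] = 0%E ->
  forall F : R * R -> \bar R, measurable_fun setT F -> (forall y, 0 <= F y)%E ->
  (\int[circle_law mu1]_y F y = \int[circle_law mu2]_y F y)%E.
Proof.
move=> r1 r2 o1 o2 F mF F0.
have c1 := circle_law_rotation_invariant r1 o1.
have c2 := circle_law_rotation_invariant r2 o2.
have unit mu (f : R * R -> \bar R) (c : \bar R) : measurable_fun setT f ->
    (forall x, modc (toC x) = 1 -> f x = c) ->
    (\int[circle_law mu]_x f x = c)%E.
  move=> mf fc; transitivity (\int[circle_law mu]_x cst c x)%E; last first.
    by rewrite integral_cst// [X in (_ * X)%E]probability_setT mule1.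
  apply: ae_eq_integral => //.
  apply: (negligible_ae_eq _ (circle_law_unit mu)).
    rewrite (_ : [set _ | _] = [set x | (~` [set 1]) (modc (toC x))]).
      apply: measurable_modc_set; first exact: cmeasurable_toC.
      exact: measurableC.
    by apply/seteqP; split => x /= /eqP.
  by move=> x /= /negP; rewrite negbK => /eqP /fc.
have mG : measurable_fun setT (fun p : (R * R) * (R * R) => F (rot (toC p.1) p.2)).
  exact: measurableT_comp measurable_mulplane.
transitivity (\int[circle_law mu2]_y \int[circle_law mu1]_x F (rot (toC y) x))%E.
  apply/esym; apply: unit.
    apply: (@measurable_fun_fubini_tonelli_F _ _ _ _ _ (circle_law mu1)
      (fun p => F (rot (toC p.1) p.2))) => //.
  by move=> y y1; rewrite integral_rot.
rewrite (fubini_tonelli (m1 := circle_law mu2) (m2 := circle_law mu1)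
  (fun p => F (rot (toC p.1) p.2)))//=.
apply: unit.
  apply: (@measurable_fun_fubini_tonelli_G _ _ _ _ _ (circle_law mu2)
      (fun p => F (rot (toC p.1) p.2))) => //.
move=> x x1; rewrite -[RHS](integral_rot c2 x1)//.
by apply: eq_integral => y _; rewrite /rot mulrC.
Qed.

(** The measures of disks determine the law of the modulus. The measure of [A] is the integral,
    against this law, of the proportion [H r] of the circle of radius [r] that lies in [A], and [H]
    is the same for both measures. *)
Lemma rotation_invariant_unique mu1 mu2 : rotation_invariant mu1 -> rotation_invariant mu2 ->
  mu1 [set 0] = 0%E -> mu2 [set 0] = 0%E ->
  (forall r, mu1 (disk r) = mu2 (disk r)) ->
  forall A, measurable A -> mu1 A = mu2 A.
Proof.
move=> r1 r2 o1 o2 D A mA.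
have mlaw A' : measurable A' ->
    law mu1 (@measurable_modc_toC R) A' = law mu2 (@measurable_modc_toC R) A'.
  apply: eq_probability_rays => r; rewrite !lawE.
  have -> : (fun x : R * R => modc (toC x)) @^-1` `]-oo, r[ = disk r.
    by apply/seteqP; split => x /=; rewrite in_itv.
  exact: D.
pose F (x : R * R) : \bar R := (\1_A x)%:E.
have mF : measurable_fun setT F by exact/measurable_EFinP.
have F0 x : (0 <= F x)%E by rewrite lee_fin.
have IE mu : (\int[mu]_x F x = mu A)%E by rewrite integral_indic// setIT.
pose G (p : R * (R * R)) : \bar R := F (rot (toC p.2) (ofC p.1%:C)).
have mG : measurable_fun setT G.
  apply: measurableT_comp => //; apply: cmeasurableM.
    exact: measurableT_comp (@cmeasurable_toC R) _.
  by under eq_fun do rewrite ofCK; apply: cmeasurableC.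
pose H (r : R) : \bar R := (\int[circle_law mu1]_y G (r, y))%E.
have mH : measurable_fun setT H.
  by apply: (@measurable_fun_fubini_tonelli_F _ _ _ _ _ (circle_law mu1) G) => // p; exact: F0.
have H0 r : (0 <= H r)%E by apply: integral_ge0 => y _; exact: F0.
have LE mu : rotation_invariant mu -> mu [set 0] = 0%E ->
    mu A = (\int[law mu (@measurable_modc_toC R)]_r H r)%E.
  move=> mur o; transitivity (\int[mu]_x H (modc (toC x)))%E; last by rewrite integral_law.
  rewrite -(IE mu) (integral_polar_modc mur o mF F0); apply: eq_integral => x _.
  rewrite (circle_law_unique mur r1 o o1 (F := fun y => F (rot (toC y) (modp x))))//.
  apply: measurableT_comp => //; apply: cmeasurableM; first exact: cmeasurable_toC.
  exact: cmeasurable_cst.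
by rewrite !LE//; apply: eq_probability_integral.
Qed.

Variables (mu : probability (R * R)%type R) (b : R).
Hypotheses (mur : rotation_invariant mu) (b0 : 0 < b).
Local Notation leb2 := (@lebesgue_measure R \x @lebesgue_measure R)%E.

(** [leb2] lives on the product of two copies of [measurableTypeR R], which carries
another display than [R * R]; the identity transfers it. *)
Let uniform_subproof : {Q : probability (R * R)%type R |
  forall A, measurable A -> Q A = (leb2 (A `&` disk b) / leb2 (disk b))%E}.
Proof.
pose T : measurableType _ := (measurableTypeR R * measurableTypeR R)%type.
have mf : measurable_fun setT (fun x : T => (x : R * R)).
  by move=> _ B mB; rewrite setTI; exact: mB.
pose Q := mnormalize (mrestr leb2 (measurable_disk b)) (@dirac _ T point R).
exists (law Q mf) => A mA; rewrite lawE.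
have p := leb2_disk_gt0 b0; have q := leb2_disk_lty b.
rewrite /Q/= /mnormalize/= /mrestr setTI gt_eqF// lt_eqF//=.
move: p q; case: (leb2 (disk b)) => [l| |]//=; rewrite lte_fin => l0 _.
by rewrite inver gt_eqF.
Qed.

Let uniform := sval uniform_subproof.

Let uniformE A : measurable A -> uniform A = (leb2 (A `&` disk b) / leb2 (disk b))%E.
Proof. exact: (svalP uniform_subproof). Qed.

Let uniform_disk_le r : 0 <= r <= b -> uniform (disk r) = (r ^+ 2 / b ^+ 2)%:E.
Proof.
move=> /andP[+ rb]; have p := leb2_disk_gt0 b0; have q := leb2_disk_lty b.
rewrite uniformE; last exact: measurable_disk.
rewrite le_eqVlt => /orP[/eqP<-|r0].
  rewrite (_ : disk 0 = set0) ?set0I ?measure0 ?mul0e ?expr0n ?mul0r//.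
  by apply/seteqP; split => // x; rewrite /disk/= ltNge modc_ge0.
rewrite setIidl; last by move=> x /= /lt_le_trans; apply.
rewrite (leb2_disk_scale r0 b0) -muleA.
move: p q; case: (leb2 (disk b)) => [l| |]//; rewrite lte_fin => l0 _.
by rewrite inver gt_eqF// -!EFinM divff ?mulr1// gt_eqF.
Qed.

Lemma uniform_radial : (forall A, measurable A -> mu A = (leb2 (A `&` disk b) / leb2 (disk b))%E) ->
  forall r, 0 <= r <= b -> mu (disk r) = (r ^+ 2 / b ^+ 2)%:E.
Proof.
move=> mE r rb; have mD := measurable_disk r.
by rewrite mE// -uniformE// uniform_disk_le.
Qed.

Lemma radial_uniform : (forall r, 0 <= r <= b -> mu (disk r) = (r ^+ 2 / b ^+ 2)%:E) ->
  uniform_on_centered_disk mu.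
Proof.
move=> rad; exists b => //= A mA; rewrite -[RHS]uniformE//.
have uE r : 0 <= r <= b -> mu (disk r) = uniform (disk r).
  by move=> rb; rewrite rad// uniform_disk_le.
have full (nu : probability (R * R)%type R) r : nu (disk b) = 1%E -> b <= r -> nu (disk r) = 1%E.
  move=> h br; apply/eqP; rewrite eq_le; apply/andP; split.
    by apply: probability_le1; exact: measurable_disk.
  apply: (@le_trans _ _ (nu (disk b))); first by rewrite h.
  apply: le_measure; rewrite ?inE.
  - exact: measurable_disk.
  - exact: measurable_disk.
  - by move=> x /lt_le_trans; apply.
have b1 : b ^+ 2 / b ^+ 2 = 1 by rewrite divff// expf_eq0/= gt_eqF.
have u0 : uniform [set 0] = 0%E.
  by apply: (disk_origin b0) => r rb; exact: uniform_disk_le.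
apply: (rotation_invariant_unique mur _ _ u0).
- move=> th B mB; rewrite [RHS]uniformE// uniformE; last first.
    by rewrite -[X in measurable X]setTI; exact: measurable_rot.
  congr (_ / _)%E.
  rewrite -[RHS](leb2_rot (modc_expi th)); last first.
    by apply: measurableI => //; exact: measurable_disk.
  congr (leb2 _); apply/seteqP; split => x; rewrite /disk/= /rot ofCK modcM modc_expi mul1r//.
- exact: (disk_origin b0 rad).
- move=> r; have [r0|r0] := ltP r 0.
    rewrite (_ : disk r = set0) ?measure0//.
    by apply/seteqP; split => // x; rewrite /disk/= ltNge (le_trans (ltW r0)) ?modc_ge0.
  have [rb|br] := leP r b; first by rewrite uE// r0.
  have bb : 0 <= b <= b by rewrite lexx ltW.
  transitivity (1%E : \bar R); [|apply/esym]; apply: full (ltW br).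
    by rewrite rad// b1.
  by rewrite uniform_disk_le// b1.
- exact: mA.
Qed.

End uniform_disk.

(** * Quadratic transport cost *)

Section quadratic_cost.
Context {R : realType}.
Local Open Scope ereal_scope.
Implicit Types mu nu : probability (R * R)%type R.

Definition qcost (x y : R * R) : R := (modc (toC x - toC y) ^+ 2)%R.

Lemma qcost_ge0 x y : (0 <= qcost x y)%R. Proof. exact: sqr_ge0. Qed.

Lemma measurable_qcost d (T : measurableType d) (f h : T -> R * R) :
  measurable_fun setT f -> measurable_fun setT h ->
  measurable_fun setT (fun x => qcost (f x) (h x)).
Proof.
move=> mf mh; apply: measurable_funX; apply: measurable_modc; apply: cmeasurableD.
  exact: measurableT_comp (@cmeasurable_toC R) _.
by apply: cmeasurableN; exact: measurableT_comp (@cmeasurable_toC R) _.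
Qed.

Lemma finite_integral_ae_bounded mu (f : R * R -> R) (M : R) (N : set (R * R)) :
  measurable_fun setT f -> (forall x, 0 <= f x)%R -> measurable N -> mu N = 0 ->
  (forall x, ~ N x -> f x <= M)%R -> exists C : R, \int[mu]_x (f x)%:E = C%:E.
Proof.
move=> mf f0 mN N0 fM.
have mm : measurable_fun setT (fun x => (Num.min (f x) `|M|)%:E).
  by apply/measurable_EFinP; exact: measurable_minr.
have -> : \int[mu]_x (f x)%:E = \int[mu]_x (Num.min (f x) `|M|)%:E.
  apply: ae_eq_integral => //; first exact/measurable_EFinP.
  apply: (negligible_ae_eq mN N0) => x /fM xM.
  by congr EFin; apply/esym/min_idPl; exact: le_trans (ler_norm _).
set I := \int[mu]_x _.
have I0 : 0 <= I by apply: integral_ge0 => x _; rewrite lee_fin le_min f0 normr_ge0.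
have IM : I <= `|M|%:E.
  apply: (@le_trans _ _ (\int[mu]_x (cst `|M|%:E x))).
    apply: ge0_le_integral => //.
    - by move=> x _; rewrite lee_fin le_min f0 normr_ge0.
    - by move=> x _; rewrite lee_fin ge_min lexx orbT.
  by rewrite integral_cst// [X in _ * X]probability_setT mule1.
by exists (fine I); rewrite fineK// ge0_fin_numE// (le_lt_trans IM)// ltry.
Qed.

Lemma coupling_integral_fst mu nu q (F : R * R -> \bar R) : coupling mu nu q ->
  measurable_fun setT F -> (forall x, 0 <= F x) ->
  \int[q]_x F x.1 = \int[mu]_x F x.
Proof.
move=> [qm _] mF F0; rewrite -(integral_law q measurable_fst)//.
apply: eq_probability_integral => A mA; rewrite lawE -qm//.
by congr (q _); apply/seteqP; split => x //= [].
Qed.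

Lemma coupling_integral_snd mu nu q (F : R * R -> \bar R) : coupling mu nu q ->
  measurable_fun setT F -> (forall x, 0 <= F x) ->
  \int[q]_x F x.2 = \int[nu]_x F x.
Proof.
move=> [_ qn] mF F0; rewrite -(integral_law q measurable_snd)//.
apply: eq_probability_integral => A mA; rewrite lawE -qn//.
by congr (q _); apply/seteqP; split => x //= [].
Qed.

Lemma W2sq_ext mu1 mu2 nu1 nu2 :
  (forall A, measurable A -> mu1 A = mu2 A) ->
  (forall A, measurable A -> nu1 A = nu2 A) -> W2sq mu1 nu1 = W2sq mu2 nu2.
Proof.
move=> m n; rewrite /W2sq; congr (ereal_inf (_ @` _)); apply/funext => q.
by apply/propext; split => -[h1 h2]; split => A mA; rewrite ?h1 ?h2 ?m ?n.
Qed.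

Lemma coupling_law (mu : probability (R * R)%type R) (F1 F2 : R * R -> R * R)
    (m1 : measurable_fun setT F1) (m2 : measurable_fun setT F2)
    (m12 : measurable_fun setT (fun x => (F1 x, F2 x))) :
  coupling (law mu m1) (law mu m2) (law mu m12).
Proof.
by split => A mA; rewrite !lawE; congr (mu _); apply/seteqP; split => x //= [].
Qed.

(** For positive [al] and [be] the choice [m = be / al] makes the two correction terms equal, with
    sum [2 * al * be * E]. If one factor is 0, a large or a small [m] gives the bound up to [e]. *)
Lemma lower_bound_of_scaled (c E al be : R) : (0 <= c)%R -> (0 <= E)%R ->
  (0 <= al)%R -> (0 <= be)%R ->
  (forall m, (0 < m)%R -> ((al ^+ 2 + be ^+ 2) * E <= c + m * (al ^+ 2 * E) + m^-1 * (be ^+ 2 * E))%R) ->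
  ((al - be) ^+ 2 * E <= c)%R.
Proof.
move=> c0 E0 a0 b0 H.
have [ap|] := ltP 0%R al; last first.
  move=> a0'; have ea : al = 0%R by apply/eqP; rewrite eq_le a0' a0.
  rewrite ea in H *.
  rewrite sub0r sqrrN; apply/ler_addgt0Pr => e e0.
  pose B := (be ^+ 2 * E)%R; have B0 : (0 <= B)%R by rewrite mulr_ge0// sqr_ge0.
  (* With this [m] the remaining term is [B * e / (B + 1)], hence at most [e], also if [B = 0]. *)
  have := H ((B + 1) / e)%R (ltac:(by rewrite divr_gt0// ltr_wpDl)).
  rewrite (expr2 0%R) !mul0r add0r mulr0 addr0 invf_div -/B => h.
  apply: le_trans h _; rewrite lerD2l mulrAC ler_pdivrMr ?ltr_wpDl// ler_pM2l//.
  by rewrite lerDl.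
have [bp|] := ltP 0%R be; last first.
  move=> b0'; have eb : be = 0%R by apply/eqP; rewrite eq_le b0' b0.
  rewrite eb in H *.
  rewrite subr0; apply/ler_addgt0Pr => e e0.
  pose B := (al ^+ 2 * E)%R; have B0 : (0 <= B)%R by rewrite mulr_ge0// sqr_ge0.
  have := H (e / (B + 1))%R (ltac:(by rewrite divr_gt0// ltr_wpDl)).
  rewrite (expr2 0%R) !mul0r addr0 mulr0 addr0 -/B => h.
  apply: le_trans h _; rewrite lerD2l mulrAC ler_pdivrMr ?ltr_wpDl// ler_pM2l//.
  by rewrite lerDl.
have := H (be / al)%R (divr_gt0 bp ap).
have -> : (be / al * (al ^+ 2 * E) = al * be * E)%R by field; rewrite gt_eqF.
have -> : ((be / al)^-1 * (be ^+ 2 * E) = al * be * E)%R by field; rewrite !gt_eqF.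
by move=> h; rewrite sqrrB mulr2n; lra.
Qed.

Section scaled_coordinate.
Variables (mu : probability (R * R)%type R) (F1 F2 : R * R -> R * R).
Hypotheses (m1 : measurable_fun setT F1) (m2 : measurable_fun setT F2).
Variables (h c : R * R -> R) (al be E : R).
Hypotheses (mh : measurable_fun setT h) (mc : measurable_fun setT c).
Hypotheses (hE : \int[mu]_x (h x ^+ 2)%:E = E%:E) (al0 : (0 <= al)%R) (be0 : (0 <= be)%R).
Hypotheses (c1 : forall x, c (F1 x) = (al * h x)%R) (c2 : forall x, c (F2 x) = (be * h x)%R).

(** Integrating [x ^ 2 + y ^ 2 <= (x - y) ^ 2 + m * x ^ 2 + y ^ 2 / m] over the
coupling for every [m > 0]; the best [m] is [be / al], a limit if one of them is 0. *)
Lemma coupling_scaled_coordinate q : coupling (law mu m1) (law mu m2) q ->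
  ((al - be) ^+ 2 * E)%:E <= \int[q]_x ((c x.1 - c x.2) ^+ 2)%:E.
Proof.
move=> qc.
have sq d (T : measurableType d) (f : T -> R) : measurable_fun setT f ->
    measurable_fun setT (fun x => (f x ^+ 2)%:E).
  by move=> mf; apply/measurable_EFinP; exact: measurable_funX.
have sq0 (x : R) : 0 <= (x ^+ 2)%:E by rewrite lee_fin sqr_ge0.
have E0 : (0 <= E)%R by rewrite -lee_fin -hE integral_ge0.
have mc1 : measurable_fun setT (fun x : (R * R) * (R * R) => c x.1).
  exact: measurableT_comp.
have mc2 : measurable_fun setT (fun x : (R * R) * (R * R) => c x.2).
  exact: measurableT_comp.
have I1 : \int[q]_x (c x.1 ^+ 2)%:E = (al ^+ 2 * E)%:E.
  rewrite (coupling_integral_fst (F := fun y => (c y ^+ 2)%:E) qc)//; last exact: sq.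
  rewrite integral_law//; last exact: sq.
  under eq_integral do rewrite c1 exprMn EFinM.
  by rewrite ge0_integralZl//= ?hE ?lee_fin ?sqr_ge0//; exact: sq.
have I2 : \int[q]_x (c x.2 ^+ 2)%:E = (be ^+ 2 * E)%:E.
  rewrite (coupling_integral_snd (F := fun y => (c y ^+ 2)%:E) qc)//; last exact: sq.
  rewrite integral_law//; last exact: sq.
  under eq_integral do rewrite c2 exprMn EFinM.
  by rewrite ge0_integralZl//= ?hE ?lee_fin ?sqr_ge0//; exact: sq.
have md : measurable_fun setT (fun x : (R * R) * (R * R) => ((c x.1 - c x.2) ^+ 2)%:E).
  by apply: sq; exact: measurable_funB.
set J := \int[q]_x _; have J0 : 0 <= J by apply: integral_ge0 => x _; exact: sq0.
have key m : (0 < m)%R -> ((al ^+ 2 + be ^+ 2) * E)%:E <=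
    J + m%:E * (al ^+ 2 * E)%:E + m^-1%:E * (be ^+ 2 * E)%:E.
  move=> mp; have mV : (0 <= m^-1)%R by rewrite invr_ge0 ltW.
  have scale (k : R) (f : (R * R) * (R * R) -> R) (I : R) : (0 <= k)%R ->
      measurable_fun setT f -> \int[q]_x (f x ^+ 2)%:E = I%:E ->
      \int[q]_x (k * f x ^+ 2)%:E = k%:E * I%:E.
    move=> k0 mf <-; under eq_integral do rewrite EFinM.
    by rewrite ge0_integralZl//; exact: sq.
  have mk (k : R) (f : (R * R) * (R * R) -> R) : measurable_fun setT f ->
      measurable_fun setT (fun x => (k * f x ^+ 2)%:E).
    move=> mf; apply/measurable_EFinP; apply: measurable_funM => //.
    exact: measurable_funX.
  rewrite mulrDl EFinD -I1 -I2 -(ge0_integralD q)//; [|exact: sq|exact: sq].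
  rewrite I1 I2 -(scale _ _ _ (ltW mp) mc1 I1) -(scale _ _ _ mV mc2 I2) /J.
  have k0 (k x : R) : (0 <= k)%R -> 0 <= (k * x ^+ 2)%:E.
    by move=> kp; rewrite lee_fin mulr_ge0// sqr_ge0.
  rewrite -ge0_integralD//; [|by move=> x _; apply: k0; exact: ltW|exact: mk].
  rewrite -ge0_integralD//; last 3 first.
  - by apply: emeasurable_funD => //; exact: mk.
  - by move=> x _; exact: k0.
  - exact: mk.
  apply: ge0_le_integral => //.
  - by move=> x _; rewrite adde_ge0.
  - by apply: emeasurable_funD; exact: sq.
  - by apply: emeasurable_funD; [apply: emeasurable_funD => //|]; exact: mk.
    move=> x _; rewrite -!EFinD lee_fin.
    set X := c x.1; set Y := c x.2.
    have : (0 <= (m * X - Y) ^+ 2 / m)%R by rewrite divr_ge0 ?sqr_ge0// ltW.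
    rewrite (_ : _ / m = m * X ^+ 2 + m^-1 * Y ^+ 2 - 2 * (X * Y))%R; last first.
      by field; rewrite gt_eqF.
    rewrite sqrrB mulr2n; lra.
  by move=> x _; rewrite adde_ge0// k0// ltW.
move: J J0 key => [j| |] J0 key //; last by rewrite leey.
rewrite lee_fin in J0 *; exact: lower_bound_of_scaled.
Qed.

End scaled_coordinate.

End quadratic_cost.

Section ellipses.
Context {R : realType}.
Variables (mu : probability (R * R)%type R) (tau : R[i]) (M : R).
Hypotheses (tau1 : (modc tau <= 1)).
Hypothesis second_moment : (\int[mu]_x (modc (toC x) ^+ 2)%:E = M%:E)%E.

(** In coordinates rotated by half the argument of [tau] the map
[ellmap (s%:C * tau)] is diagonal with entries [1 + s * modc tau] and
[1 - s * modc tau]. *)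
Let e : R[i] := expi (argc tau / 2).
Let u (x : R * R) : R := complex.Re (conjc e * toC x).
Let v (x : R * R) : R := complex.Im (conjc e * toC x).

Let ee : (conjc e * e = 1).
Proof. by rewrite mulrC mulcJ modc_expi expr1n. Qed.

Let tauE : (conjc e * tau = (modc tau)%:C * e).
Proof.
rewrite {1}[tau]argcP (_ : expi (argc tau) = e * e); last first.
  by rewrite -expiD; congr expi; field.
by rewrite mulrCA [(conjc e * _)]mulrA ee mul1r.
Qed.

Let cell (s : R) x : (conjc e * ellmap (s%:C * tau) (toC x) =
  conjc e * toC x + (s * modc tau)%:C * conjc (conjc e * toC x)).
Proof.
rewrite /ellmap mulrDr; congr (_ + _).
have -> : conjc (conjc e * toC x) = e * conjc (toC x).
  by case: e => p q; case: (toC x) => p' q'; apply/eqP; rewrite eq_complex/=;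
    apply/andP; split; apply/eqP; ring.
by rewrite -(mulrA s%:C) (mulrCA (conjc e)) (mulrA (conjc e) tau) tauE rmorphM/=; ring.
Qed.

Let uell (s : R) x : u (ofC (ellmap (s%:C * tau) (toC x))) = ((1 + s * modc tau) * u x).
Proof.
rewrite /u ofCK cell ReD; case: (conjc e * toC x) => p q /=; ring.
Qed.

Let vell (s : R) x : v (ofC (ellmap (s%:C * tau) (toC x))) = ((1 - s * modc tau) * v x).
Proof.
rewrite /v ofCK cell ImD; case: (conjc e * toC x) => p q /=; ring.
Qed.

Let mu_ : measurable_fun setT u.
Proof.
have /cmeasurableP[] // : cmeasurable (fun x : R * R => conjc e * toC x).
by apply: (@cmeasurableM _ _ _ (fun=> conjc e)); [exact: cmeasurable_cst|exact: cmeasurable_toC].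
Qed.

Let mv_ : measurable_fun setT v.
Proof.
have /cmeasurableP[] // : cmeasurable (fun x : R * R => conjc e * toC x).
by apply: (@cmeasurableM _ _ _ (fun=> conjc e)); [exact: cmeasurable_cst|exact: cmeasurable_toC].
Qed.

Let sqr_uv (x y : R * R) :
  (modc (toC x - toC y) ^+ 2 = (u x - u y) ^+ 2 + (v x - v y) ^+ 2).
Proof.
have -> : (modc (toC x - toC y) = modc (conjc e * (toC x - toC y))).
  by rewrite modcM modcJ modc_expi mul1r.
by rewrite sqr_modc mulrBr ReD ReN ImD ImN.
Qed.

Let sqr_uv0 (x : R * R) : (modc (toC x) ^+ 2 = u x ^+ 2 + v x ^+ 2).
Proof.
have -> : (modc (toC x) = modc (conjc e * toC x)).
  by rewrite modcM modcJ modc_expi mul1r.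
by rewrite sqr_modc.
Qed.

Let sq d (T : measurableType d) (f : T -> R) : measurable_fun setT f ->
    measurable_fun setT (fun x => (f x ^+ 2)%:E).
Proof. by move=> mf; apply/measurable_EFinP; exact: measurable_funX. Qed.

Let sq0 (x : R) : (0 <= (x ^+ 2)%:E)%E. Proof. by rewrite lee_fin sqr_ge0. Qed.

(** The image of [mu] under the pair of maps gives the upper bound. For the lower bound the cost
    splits into the two rotated coordinates, whose scaling factors differ by [s1 - s2] times
    [modc tau] up to sign; the two second moments add up to [M]. Nonnegativity of [1 - s * modc tau]
    is where [tau1] is used. *)
Lemma W2sq_ellipse_law (s1 s2 : R) : (0 <= s1 <= 1) -> (0 <= s2 <= 1) ->
  W2sq (ellipse_law mu (s1%:C * tau)) (ellipse_law mu (s2%:C * tau)) =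
  ((s1 - s2) ^+ 2 * modc tau ^+ 2 * M)%:E.
Proof.
move=> /andP[s10 s11] /andP[s20 s21]; have k0 := modc_ge0 tau.
apply/eqP; rewrite eq_le; apply/andP; split.
  have m12 : measurable_fun setT (fun x : R * R =>
      (ofC (ellmap (s1%:C * tau) (toC x)), ofC (ellmap (s2%:C * tau) (toC x)))).
    by apply/measurable_fun_pair; apply: cmeasurable_ellmap; exact: cmeasurable_toC.
  apply: ereal_inf_lbound; exists (law mu m12); first exact: coupling_law.
  rewrite /transport_cost integral_law//; last first.
    by apply/measurable_EFinP; exact: measurable_qcost.
  rewrite EFinM -second_moment -ge0_integralZl//=; last 2 first.
  - by apply: sq; exact: measurable_modc_toC.
  - by rewrite lee_fin mulr_ge0// sqr_ge0.
  apply: eq_integral => x _; rewrite !ofCK -EFinM; congr EFin.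
  rewrite /ellmap -exprMn -exprMn.
  rewrite (_ : _ - _ = ((s1 - s2)%:C * tau * conjc (toC x))).
    by rewrite !modcM modcJ modcC !exprMn real_normK ?num_real.
  by rewrite rmorphB/=; ring.
apply: le_ereal_inf_tmp => _ [q qc <-]; rewrite /transport_cost.
under eq_integral do rewrite sqr_uv EFinD.
have mu1 : measurable_fun setT (fun x : (R * R) * (R * R) => (u x.1 - u x.2)).
  by apply: measurable_funB; apply: measurableT_comp.
have mv1 : measurable_fun setT (fun x : (R * R) * (R * R) => (v x.1 - v x.2)).
  by apply: measurable_funB; apply: measurableT_comp.
rewrite ge0_integralD//; [|exact: sq|exact: sq].
have : (\int[mu]_x (u x ^+ 2)%:E + \int[mu]_x (v x ^+ 2)%:E = M%:E)%E.
  rewrite -second_moment -ge0_integralD//; [|exact: sq|exact: sq].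
  by apply: eq_integral => x _; rewrite sqr_uv0 EFinD.
have U0 : (0 <= \int[mu]_x (u x ^+ 2)%:E)%E by apply: integral_ge0 => x _; exact: sq0.
have V0 : (0 <= \int[mu]_x (v x ^+ 2)%:E)%E by apply: integral_ge0 => x _; exact: sq0.
case EU: (\int[mu]_x (u x ^+ 2)%:E)%E U0 => [U| |] //; last first.
  by case: (\int[mu]_x (v x ^+ 2)%:E)%E V0.
case EV: (\int[mu]_x (v x ^+ 2)%:E)%E V0 => [V| |] // _ _ [] <-.
have p1 : (0 <= 1 + s1 * modc tau) by rewrite addr_ge0// mulr_ge0.
have p2 : (0 <= 1 + s2 * modc tau) by rewrite addr_ge0// mulr_ge0.
have p3 : (0 <= 1 - s1 * modc tau) by rewrite subr_ge0 mulr_ile1.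
have p4 : (0 <= 1 - s2 * modc tau) by rewrite subr_ge0 mulr_ile1.
have := coupling_scaled_coordinate mu_ mu_ EU p1 p2 (uell s1) (uell s2) qc.
have := coupling_scaled_coordinate mv_ mv_ EV p3 p4 (vell s1) (vell s2) qc.
move=> hv hu; apply: le_trans (leeD hu hv).
rewrite -EFinD lee_fin le_eqVlt; apply/orP; left; apply/eqP; ring.
Qed.

Lemma W2_ellipse_law (s1 s2 : R) : (0 <= s1 <= 1) -> (0 <= s2 <= 1) ->
  W2 (ellipse_law mu (s1%:C * tau)) (ellipse_law mu (s2%:C * tau)) =
  (`|s2 - s1| * (modc tau * Num.sqrt M))%:E.
Proof.
move=> h1 h2; rewrite /W2 W2sq_ellipse_law//=; congr EFin.
have M0 : (0 <= M) by rewrite -lee_fin -second_moment integral_ge0.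
rewrite -exprMn sqrtrM ?sqr_ge0// sqrtr_sqr normrM distrC.
by rewrite [X in (_ * X * _)]ger0_norm ?modc_ge0// mulrA.
Qed.

End ellipses.

(** * The transport map and the limit curve of a uniform disk *)

Section transport_map.
Context {R : realType}.

(** The rotation by half the argument of [t] occurs twice and recombines with [modc t] to [t]. At
    [w = 0] both sides vanish because the inverse of 0 is 0. *)
Lemma transport_mapE (g : R -> R) (t w : R[i]) :
  transport_map g t w = w + t * (alpha0 g (modc w))%:C / w.
Proof.
rewrite /transport_map /transport_real modcM modc_expi mul1r.
set e := expi (argc t / 2).
have ee : e * expi (- (argc t / 2)) = 1 by rewrite -expiD subrr expi0.
rewrite mulrDr mulrA ee mul1r; congr (_ + _).
have -> : (expi (- (argc t / 2)) * w)^-1 = e / w.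
  by rewrite invfM -[in RHS](mulr1 e) -(mulfV (x := expi (- (argc t / 2)))) ?mulrA ?ee ?mul1r// -modc_eq0 modc_expi oner_eq0.
rewrite {2}[t]argcP (_ : expi (argc t) = e * e); last first.
  by rewrite -expiD; congr expi; field.
by rewrite rmorphM/=; ring.
Qed.

Variables (g : R -> R) (nu : R[i] -> probability (R * R)%type R) (b : R).
Hypotheses (b0 : 0 < b) (mur : rotation_invariant (nu 0)).
Hypothesis radial : forall r, 0 <= r <= b -> nu 0 (disk r) = (r ^+ 2 / b ^+ 2)%:E.
Hypothesis a0E : forall r : R, 0 <= r -> nu 0 (disk r) = (alpha0 g r)%:E.
Hypothesis nuU : forall t, t != 0 -> forall mu : probability (R * R)%type R,
  has_heat_potential g t mu -> forall A, measurable A -> mu A = nu t A.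
Hypothesis gE : forall al, 0 <= al <= 1 -> g al = g 0 + halfent al - al * ln b.

Let b2 : 0 < b ^+ 2. Proof. by rewrite exprn_gt0. Qed.

Lemma uniform_alpha0 r : 0 <= r -> alpha0 g r = Num.min (r ^+ 2 / b ^+ 2) 1.
Proof.
move=> r0; apply: EFin_inj; rewrite -a0E//.
have [rb|br] := leP r b.
  rewrite radial ?r0//; congr EFin; apply/esym/min_idPl.
  by rewrite ler_pdivrMr// mul1r ler_pXn2r ?nnegrE// ltW.
have -> : Num.min (r ^+ 2 / b ^+ 2) 1 = 1.
  by apply/min_idPr; rewrite ler_pdivlMr// mul1r ler_pXn2r ?nnegrE// ltW.
apply/eqP; rewrite eq_le; apply/andP; split.
  by apply: probability_le1; exact: measurable_disk.
have <- : nu 0 (disk b) = 1%E by rewrite radial ?lexx ?ltW// divff// gt_eqF.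
apply: le_measure; rewrite ?inE; [exact: measurable_disk|exact: measurable_disk|].
by move=> x /= /lt_trans; apply.
Qed.

Lemma transport_map_disk t w : modc w < b -> transport_map g t w = ellmap (t / (b ^+ 2)%:C) w.
Proof.
move=> wb; rewrite transport_mapE /ellmap uniform_alpha0 ?modc_ge0//; congr (_ + _).
have -> : Num.min (modc w ^+ 2 / b ^+ 2) 1 = modc w ^+ 2 / b ^+ 2.
  by apply/min_idPl; rewrite ler_pdivrMr// mul1r ler_pXn2r ?nnegrE ?modc_ge0// ltW.
have [->|w0] := eqVneq w 0; first by rewrite invr0 rmorph0 !mulr0.
by rewrite rmorphM/= -mulcJ fmorphV; field; rewrite w0 (inj_eq (@complexI _) _ 0) gt_eqF.
Qed.

Lemma cmeasurable_transport_map t :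
  cmeasurable (fun x : R * R => transport_map g t (toC x)).
Proof.
under [X in cmeasurable X]eq_fun => x do rewrite transport_mapE uniform_alpha0 ?modc_ge0//.
apply: cmeasurableD; first exact: cmeasurable_toC.
apply: cmeasurableM; last by apply: cmeasurableV; exact: cmeasurable_toC.
apply: (@cmeasurableM _ _ _ (fun=> t)); first exact: cmeasurable_cst.
apply: cmeasurableC; apply: measurable_minr => //.
apply: measurable_funM => //; apply: measurable_funX; exact: measurable_modc_toC.
Qed.

Lemma ae_diskE (T : Type) (f h : R * R -> T) :
  (forall x, modc (toC x) < b -> f x = h x) -> ae_eq (nu 0) setT f h.
Proof.
move=> fh; apply: (@negligible_ae_eq _ (nu 0) (~` disk b)).
- by apply: measurableC; exact: measurable_disk.
- apply: (ae_disk b0 radial); first by apply: measurableC; exact: measurable_disk.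
  by move=> x xb; apply.
- by move=> x /contrapT; exact: fh.
Qed.

Lemma second_moment_finite : exists M : R,
  (\int[nu 0%R]_x (modc (toC x) ^+ 2)%:E = M%:E)%E.
Proof.
apply: (@finite_integral_ae_bounded _ _ (fun x => modc (toC x) ^+ 2) (b ^+ 2) (~` disk b)).
- by apply: measurable_funX; exact: measurable_modc_toC.
- by move=> x; exact: sqr_ge0.
- by apply: measurableC; exact: measurable_disk.
- apply: (ae_disk b0 radial); first by apply: measurableC; exact: measurable_disk.
  by move=> x xb; apply.
- by move=> x /contrapT xb; rewrite ler_pXn2r ?nnegrE ?modc_ge0 ?ltW.
Qed.

(** For [s > 0] the ellipse law has the characterizing potential, and uniqueness identifies it. No
    potential characterizes [nu 0]; at [s = 0] the linear map is the identity. *)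
Lemma nu_ellipse t s : 0 < modc t -> modc t <= b ^+ 2 -> 0 <= s <= 1 ->
  forall A, measurable A ->
    nu (s%:C * t) A = ellipse_law (nu 0) (s%:C * (t / (b ^+ 2)%:C)) A.
Proof.
move=> t0 tb /andP[s0 s1] A mA; have [->|sn] := eqVneq s 0.
  rewrite mul0r mul0r lawE; congr (nu 0 _); apply/seteqP; split => x /=;
    by rewrite /ellmap mul0r addr0 toCK.
have sp : 0 < s by rewrite lt_def sn.
apply/esym; rewrite mulrA; apply: nuU => //.
  by rewrite mulf_neq0// -modc_gt0// modcC normr_gt0.
apply: (ellipse_law_heat_potential mur b0 radial gE).
  by rewrite modcM modcC mulr_gt0 ?normr_gt0.
by rewrite modcM modcC ger0_norm// (le_trans _ tb)// ler_piMl// modc_ge0.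
Qed.

Lemma modc_scaled t : modc t <= b ^+ 2 -> modc (t / (b ^+ 2)%:C) <= 1.
Proof. by move=> tb; rewrite modcM modcV modcC (ger0_norm (ltW b2)) ler_pdivrMr ?mul1r. Qed.

Lemma uniform_geodesic t : 0 < modc t -> modc t <= b ^+ 2 ->
  wasserstein_geodesic (fun s : R => nu (s%:C * t)).
Proof.
move=> t0 tb; have [M hM] := second_moment_finite; have t1 := modc_scaled tb.
have W s1 s2 : 0 <= s1 <= 1 -> 0 <= s2 <= 1 -> W2 (nu (s1%:C * t)) (nu (s2%:C * t)) =
    (`|s2 - s1| * (modc (t / (b ^+ 2)%:C) * Num.sqrt M))%:E.
  move=> h1 h2; rewrite -(W2_ellipse_law t1 hM h1 h2).
  by congr sqrte; apply: W2sq_ext => A mA; rewrite nu_ellipse.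
move=> s1 s2 h1 h2; have z01 : 0 <= (0 : R) <= 1 by rewrite lexx ler01.
have o01 : 0 <= (1 : R) <= 1 by rewrite lexx ler01.
by rewrite !W// subr0 normr1 mul1r EFinM.
Qed.

(** [nu 0] and [nu t] are the ellipse laws at times 0 and 1, whose distance is known. The map agrees
    with the linear map on the disk only, so costs and marginals are compared up to a null set. *)
Lemma uniform_optimal t : 0 < modc t -> modc t <= b ^+ 2 ->
  optimal_transport_map (transport_map g t) (nu 0) (nu t).
Proof.
move=> t0 tb; have [M hM] := second_moment_finite; have t1 := modc_scaled tb.
set tau := t / _ in t1; have mT := cmeasurable_transport_map t.
rewrite /optimal_transport_map/=.
pose idT (x : R * R) := (x, ofC (transport_map g t (toC x))).
have midT : measurable_fun setT idT by apply/measurable_fun_pair.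
have z01 : 0 <= (0 : R) <= 1 by rewrite lexx ler01.
have o01 : 0 <= (1 : R) <= 1 by rewrite lexx ler01.
have nu1 A : measurable A -> nu t A = ellipse_law (nu 0) tau A.
  by move=> mA; have := nu_ellipse t0 tb o01 mA; rewrite !mul1r.
have nu0 A : measurable A -> nu 0 A = ellipse_law (nu 0) (0%:C * tau) A.
  by move=> mA; have := nu_ellipse t0 tb z01 mA; rewrite mul0r.
split=> //; exists (law (nu 0) midT); split.
- by move=> B mB; rewrite lawE.
- split=> A mA; rewrite lawE.
    by congr (nu 0 _); apply/seteqP; split => x //= [].
  rewrite nu1// lawE.
  have [N [mN N0 HN]] : ae_eq (nu 0) setT idT (fun x => (x, ofC (ellmap tau (toC x)))).
    by apply: ae_diskE => x xb; rewrite /idT transport_map_disk.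
  apply: (measure_eq_mod_null _ _ mN N0).
  - by rewrite -[X in measurable X]setTI; apply: midT => //; exact: measurableX.
  - rewrite -[X in measurable X]setTI; apply: cmeasurable_ellmap => //.
    exact: cmeasurable_toC.
  - move=> x xN; have E : idT x = (x, ofC (ellmap tau (toC x))).
      by apply: contrapT => h; apply: xN; apply: HN => /= /(_ Logic.I).
    suff : A (idT x).2 <-> A (ofC (ellmap tau (toC x))).
      by move=> -[h1 h2]; split; [case=> _ /h1|move=> /h2].
    by rewrite E.
- rewrite (W2sq_ext nu0 (nu2 := ellipse_law (nu 0) (1%:C * tau))); last first.
    by move=> A mA; rewrite mul1r nu1.
  rewrite (W2sq_ellipse_law t1 hM)// sub0r sqrrN expr1n mul1r EFinM -hM.
  have msq : measurable_fun setT (fun x : R * R => (modc (toC x) ^+ 2)%:E).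
    by apply/measurable_EFinP; apply: measurable_funX; exact: measurable_modc_toC.
  have mc : measurable_fun setT (fun x : (R * R) * (R * R) => (modc (toC x.1 - toC x.2) ^+ 2)%:E).
    by apply/measurable_EFinP; exact: measurable_qcost.
  rewrite -ge0_integralZl//=; [|by move=> x _; rewrite lee_fin sqr_ge0|by rewrite lee_fin sqr_ge0].
  rewrite /transport_cost integral_law//; last by move=> y; rewrite lee_fin sqr_ge0.
  apply: ae_eq_integral => //.
  - exact: (measurableT_comp mc midT).
  - exact: measurable_funeM.
  apply: ae_diskE => x xb; rewrite /idT/= ofCK transport_map_disk// -/tau -EFinM -exprMn.
  by rewrite /ellmap opprD addrA subrr sub0r modcN modcM modcJ.
Qed.

End transport_map.

(** * Cyclical monotonicity *)

Section cyclic_monotonicity.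
Context {R : realType}.
Local Open Scope ereal_scope.

(** The law of a pair whose index in the cycle is drawn uniformly, formed as an average of laws
    without enlarging the probability space. *)
Lemma mean_probability d (T : measurableType d) (Q : nat -> probability T R) (K : nat) :
  {Q' : probability T R |
    (forall A, measurable A -> Q' A = K.+1%:R^-1%:E * \sum_(j < K.+1) Q j A) /\
    forall F : T -> \bar R, measurable_fun [set: T] F -> (forall y, 0 <= F y) ->
      \int[Q']_y F y = K.+1%:R^-1%:E * \sum_(j < K.+1) \int[Q j]_y F y}.
Proof.
pose k : {nonneg R} := NngNum (ltac:(by rewrite invr_ge0 ler0n) : (0 <= (K.+1%:R : R)^-1)%R).
have tot : msum Q K.+1 setT = K.+1%:R%:E.
  rewrite /msum (eq_bigr (fun=> 1%E)) ?sumEFin ?big_const_ord ?iter_addr_0//.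
  by move=> i _; exact: probability_setT.
pose Q' : probability T R := mnormalize (msum Q K.+1) (Q 0%N).
have E A : Q' A = K.+1%:R^-1%:E * \sum_(j < K.+1) Q j A.
  rewrite /Q'/= /mnormalize/= tot eqe pnatr_eq0/= muleC //.
exists Q'; split => // F mF F0.
have -> : \int[Q']_y F y = \int[mscale k (msum Q K.+1)]_y F y.
  by apply: eq_measure_integral => A mA _; exact: E.
by rewrite ge0_integral_mscale// ge0_integral_measure_sum.
Qed.

Variables (mu : probability (R * R)%type R) (T : R * R -> R * R).
Hypothesis mT : measurable_fun setT T.
Variable C : R.
Hypothesis costC : \int[mu]_x (qcost x (T x))%:E = C%:E.
Hypothesis optimal : forall q, coupling mu (law mu mT) q -> C%:E <= transport_cost q.

Variables (d : measure_display) (Om : measurableType d) (P : probability Om R).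
Variables (K : nat) (W : nat -> Om -> R * R).
Hypothesis mW : forall j, measurable_fun setT (W j).
Hypothesis lawW : forall j A, measurable A -> P (W j @^-1` A) = mu A.
Hypothesis WK : W K.+1 = W 0%N.

Let f j x : R := qcost (W j x) (T (W j x)).
Let h j x : R := qcost (W j.+1 x) (T (W j x)).
Let f_sum x : R := (\sum_(j < K.+1) f j x)%R.
Let h_sum x : R := (\sum_(j < K.+1) h j x)%R.
Let V : set Om := [set x | (h_sum x < f_sum x)%R].

Let mf j : measurable_fun setT (f j).
Proof. by apply: measurable_qcost => //; exact: measurableT_comp. Qed.

Let mh j : measurable_fun setT (h j).
Proof. by apply: measurable_qcost => //; exact: measurableT_comp. Qed.

Let mfs : measurable_fun setT f_sum. Proof. exact: measurable_sum. Qed.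
Let mhs : measurable_fun setT h_sum. Proof. exact: measurable_sum. Qed.

Let mV : measurable V.
Proof.
rewrite (_ : V = (fun x => (h_sum x < f_sum x)%R) @^-1` [set true]); last by apply/seteqP; split.
by rewrite -[X in measurable X]setTI; exact: (measurable_fun_ltr mhs mfs).
Qed.

Let next j x := if (h_sum x < f_sum x)%R then W j.+1 x else W j x.

Let mnext j : measurable_fun setT (next j).
Proof. by apply: measurable_fun_ifT => //; exact: measurable_fun_ltr. Qed.

Let mpair j : measurable_fun setT (fun x => (next j x, T (W j x))).
Proof. by apply/measurable_fun_pair => //; exact: measurableT_comp. Qed.

(** For [j] uniform in the cycle, send [W j.+1] instead of [W j] to [T (W j)] where
this makes the whole cycle cheaper.  As the event does not depend on [j], the
first marginal remains [mu]. *)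
Let swap := sval (mean_probability (fun j => law P (mpair j)) K).

Let measurable_pre j A : measurable A -> measurable (W j @^-1` A).
Proof. by move=> mA; rewrite -[X in measurable X]setTI; exact: mW. Qed.

Let nextP j A : measurable A ->
  P (next j @^-1` A) = P (V `&` W j.+1 @^-1` A) + P (W j @^-1` A `\` V).
Proof.
move=> mA; rewrite -measureU.
- congr (P _); apply/seteqP; split => x; rewrite /next /V /=; case: ifPn => h1.
  + by left.
  + by move=> Ax; right.
  + by case=> -[].
  + by case=> [[]|[]].
- by apply: measurableI => //; exact: measurable_pre.
- by apply: measurableD => //; exact: measurable_pre.
- by apply/seteqP; split => x // -[[Vx _] [_]].
Qed.

Let swap_coupling : coupling mu (law mu mT) swap.
Proof.
have [sE _] := svalP (mean_probability (fun j => law P (mpair j)) K).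
have const (a : \bar R) : a \is a fin_num -> K.+1%:R^-1%:E * \sum_(j < K.+1) a = a.
  move=> /fineK <-; rewrite sumEFin big_const_ord iter_addr_0 -EFinM -[X in (_ * X)%R]mulr_natl.
  by rewrite mulrA mulVf// mul1r.
split => A mA; (rewrite sE; last exact: measurableX).
- under eq_bigr => j _.
    rewrite lawE.
    rewrite (_ : _ @^-1` _ = next j @^-1` A); last by apply/seteqP; split => x //= [].
    rewrite nextP//.
    over.
  rewrite big_split/=.
  (* Passing from [j] to [j + 1] permutes the cycle: by [WK] the last summand on the left is the
     summand of index 0 on the right. *)
  have -> : \sum_(j < K.+1) P (V `&` W j.+1 @^-1` A) = \sum_(j < K.+1) P (V `&` W j @^-1` A).
    by rewrite big_ord_recr big_ord_recl/= WK addeC.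
  rewrite -big_split/= -[RHS]const ?fin_num_measure//; congr (_ * _); apply: eq_bigr => j _.
  by rewrite -(lawW j mA) [RHS](measureDI P (measurable_pre j mA) mV) addeC setIC.
- rewrite -[RHS]const ?fin_num_measure//; congr (_ * _); apply: eq_bigr => j _; rewrite !lawE.
  rewrite -(lawW j) ; last by rewrite -[X in measurable X]setTI; exact: mT.
  by congr (P _); apply/seteqP; split => x //= [].
Qed.

Let g x : R := if (h_sum x < f_sum x)%R then h_sum x else f_sum x.

Let mg : measurable_fun setT g.
Proof. by apply: measurable_fun_ifT => //; exact: measurable_fun_ltr. Qed.

Let fs_ge0 x : (0 <= f_sum x)%R. Proof. by apply: sumr_ge0 => j _; exact: qcost_ge0. Qed.
Let hs_ge0 x : (0 <= h_sum x)%R. Proof. by apply: sumr_ge0 => j _; exact: qcost_ge0. Qed.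
Let g_ge0 x : (0 <= g x)%R. Proof. by rewrite /g; case: ifP. Qed.

Let int_f : \int[P]_x (f_sum x)%:E = K.+1%:R%:E * C%:E.
Proof.
have E j : \int[P]_x (f j x)%:E = C%:E.
  rewrite -costC; have mF : measurable_fun setT (fun y => (qcost y (T y))%:E).
    by apply/measurable_EFinP; exact: measurable_qcost.
  have F0 y : 0 <= (qcost y (T y))%:E by rewrite lee_fin qcost_ge0.
  rewrite -(integral_law P (mW j) mF F0).
  by apply: eq_probability_integral => A mA; rewrite lawE lawW.
under eq_integral do rewrite /f_sum -sumEFin.
rewrite ge0_integral_sum//.
- rewrite (eq_bigr (fun=> C%:E)); last by move=> j _; exact: E.
  by rewrite sumEFin big_const_ord iter_addr_0 -EFinM mulr_natl.
- by move=> j; exact/measurable_EFinP.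
- by move=> j x _; rewrite lee_fin qcost_ge0.
Qed.

Let swap_cost : transport_cost swap = K.+1%:R^-1%:E * \int[P]_x (g x)%:E.
Proof.
have [_ sI] := svalP (mean_probability (fun j => law P (mpair j)) K).
have mc : measurable_fun setT (fun x : (R * R) * (R * R) => (qcost x.1 x.2)%:E).
  by apply/measurable_EFinP; apply: measurable_qcost.
have c0 (x : (R * R) * (R * R)) : 0 <= (qcost x.1 x.2)%:E by rewrite lee_fin qcost_ge0.
rewrite /transport_cost (sI _ mc c0); congr (_ * _).
pose G j x : R := if (h_sum x < f_sum x)%R then h j x else f j x.
have -> : \int[P]_x (g x)%:E = \int[P]_x (\sum_(j < K.+1) (G j x)%:E).
  apply: eq_integral => x _; rewrite sumEFin; congr EFin; rewrite /g /G.
  by case: ifP.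
rewrite ge0_integral_sum//.
- apply: eq_bigr => j _; rewrite integral_law//; apply: eq_integral => x _.
  by rewrite /G /next /=; case: ifP.
- move=> j; apply/measurable_EFinP; apply: measurable_fun_ifT => //.
  exact: measurable_fun_ltr.
- by move=> j x _; rewrite lee_fin /G; case: ifP => _; exact: qcost_ge0.
Qed.

(** The swapped coupling costs the mean of [g], the smaller of the two sums, divided by [K + 1]. By
    optimality the nonnegative function [f_sum - g] has integral 0; finiteness of [C] makes the
    subtraction legitimate. *)
Lemma cyclic_monotone : {ae P, forall x, (f_sum x <= h_sum x)%R}.
Proof.
have gf x : (g x <= f_sum x)%R by rewrite /g; case: ifP => // /ltW.
have d0 x : 0 <= (f_sum x - g x)%:E by rewrite lee_fin subr_ge0.
have md : measurable_fun setT (fun x => (f_sum x - g x)%:E).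
  by apply/measurable_EFinP; exact: measurable_funB.
have split : \int[P]_x (f_sum x)%:E = \int[P]_x (g x)%:E + \int[P]_x (f_sum x - g x)%:E.
  rewrite -ge0_integralD//; last 2 first.
  - by move=> x _; rewrite lee_fin.
  - exact/measurable_EFinP.
  by apply: eq_integral => x _; rewrite -EFinD subrKC.
have Kp : 0 < (K.+1%:R : R)%:E by rewrite lte_fin.
have le : \int[P]_x (f_sum x)%:E <= \int[P]_x (g x)%:E.
  have := optimal swap_coupling; rewrite swap_cost int_f => H.
  have Kv : 0 < (K.+1%:R : R)^-1%:E by rewrite lte_fin invr_gt0.
  by rewrite -(lee_pmul2l _ Kv)// -!EFinM mulrA mulVf// mul1r.
have I0 : \int[P]_x (f_sum x - g x)%:E = 0.
  have i0 : 0 <= \int[P]_x (f_sum x - g x)%:E by exact: integral_ge0.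
  have g0 : 0 <= \int[P]_x (g x)%:E by apply: integral_ge0 => x _; rewrite lee_fin.
  move: le split; rewrite int_f -EFinM.
  case: (\int[P]_x (g x)%:E) g0 => [r| |]//; case: (\int[P]_x _) i0 => [s| |]//.
  rewrite !lee_fin => s0 r0 h1 [] h2; congr EFin; lra.
have := (ae_eq_integral_abs P measurableT md).1.
under eq_integral do rewrite gee0_abs//.
move=> /(_ I0); apply: filterS => x /(_ Logic.I) /= [] E.
rewrite leNgt; apply/negP => hf; move: E; rewrite /g hf => E.
by move: hf; rewrite -subr_gt0 E ltxx.
Qed.

End cyclic_monotonicity.

(** * The cost of a cycle along a polar rectangle *)

Section polar_cycle.
Context {R : realType}.
Implicit Types (t s z w ze : R[i]).

Lemma sqr_modcB z w : modc (z - w) ^+ 2 - modc w ^+ 2 = modc z ^+ 2 - 2 * complex.Re (z * conjc w).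
Proof. by rewrite !sqr_modc; case: z w => a b [c e] /=; ring. Qed.

Lemma conjc_unit s : modc s = 1 -> conjc s = s^-1.
Proof.
move=> s1; have s0 : s != 0 by rewrite -modc_eq0 s1 oner_eq0.
by apply: (mulfI s0); rewrite mulcJ s1 expr1n mulfV.
Qed.

Lemma conjc_mul z w : conjc (z * w) = conjc z * conjc w.
Proof. exact: rmorphM. Qed.

Lemma conjc_inv z : conjc z^-1 = (conjc z)^-1.
Proof. exact: fmorphV. Qed.

Lemma conjc_re (x : R) : conjc x%:C = x%:C.
Proof. by apply/eqP; rewrite eq_complex/= oppr0 !eqxx. Qed.

(** The left side is the extra cost of assigning the image of [r v] to [w]. Since [v] is unimodular,
    the conjugate of [1 / v] is [v], and the displacement enters through a scalar product. *)
Lemma transport_step t v (r a : R) w : 0 < r -> modc v = 1 ->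
  modc (w - r%:C * v - t * a%:C / (r%:C * v)) ^+ 2 - modc (t * a%:C / (r%:C * v)) ^+ 2 =
  modc (w - r%:C * v) ^+ 2 - 2 * (a / r * complex.Re ((w - r%:C * v) * (conjc t * v))).
Proof.
move=> r0 v1; rewrite sqr_modcB; congr (_ - 2 * _).
have v0 : v != 0 by rewrite -modc_eq0 v1 oner_eq0.
have -> : conjc (t * a%:C / (r%:C * v)) = (a / r)%:C * (conjc t * v).
  rewrite invfM !conjc_mul !conjc_inv (conjc_unit v1) invrK !conjc_re.
  by rewrite rmorphM fmorphV/=; ring.
by rewrite mulrCA [_%:C * _]mulrC mulrC; case: (_ * (conjc t * v)) => p q /=; rewrite mul0r subr0.
Qed.

Section cycle.
Variables (t s ze : R[i]) (r1 r2 a1 a2 : R) (N : nat).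
Hypotheses (s1 : modc s = 1) (ze1 : modc ze = 1) (zeN : ze ^+ (2 * N) = -1).
Hypothesis zeRe : 0 <= complex.Re ze.
Hypotheses (r10 : 0 < r1) (r20 : 0 < r2) (a10 : 0 <= a1) (a20 : 0 <= a2).

Let de : R := modc (ze - 1).
Let E := conjc t * s ^+ 2.
(** A Riemann sum for the integral of [z dz] over the quarter circle from 1 to ['i], whose value is
    -1. *)
Let S1 := (ze - 1) * \sum_(j < N) ze ^+ (2 * j).

Let S1E : (1 + ze) * S1 = - 2%:R.
Proof.
rewrite /S1 mulrA (_ : (1 + ze) * (ze - 1) = ze ^+ 2 - 1); last by ring.
under eq_bigr do rewrite exprM.
by rewrite -subrX1 -exprM zeN; ring.
Qed.

Let S1_close : modc (S1 + 1) <= de.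
Proof.
have n1 : 1 <= modc (1 + ze).
  rewrite -(ler_pXn2r (n := 2)) ?nnegrE ?modc_ge0// expr1n sqr_modc ReD/=.
  have := sqr_ge0 (complex.Im (1 + ze)); have := zeRe; nra.
have E1 : (1 + ze) * (S1 + 1) = ze - 1 by rewrite mulrDr S1E; ring.
rewrite /de -E1 modcM; apply: ler_peMl => //; exact: modc_ge0.
Qed.

Let ReE_ge (x : R[i]) : - modc x <= complex.Re x.
Proof. by have := Re_le_modc x; rewrite ler_norml => /andP[]. Qed.

Let modE : modc E = modc t.
Proof. by rewrite modcM modcJ modcX s1 expr1n mulr1. Qed.

Let Re_S1 : - complex.Re E - modc t * de <= complex.Re (E * S1).
Proof.
have -> : E * S1 = E * (S1 + 1) - E by ring.
rewrite ReD ReN [leLHS]addrC lerD2r; apply: le_trans (ReE_ge _).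
by rewrite lerN2 modcM modE ler_wpM2l ?modc_ge0.
Qed.

Let Re_S2 : complex.Re E - modc t * (2 * de) <= complex.Re (E * (- ze * S1)).
Proof.
have -> : E * (- ze * S1) = - (E * (ze * (S1 + 1) + (1 - ze))) + E by ring.
rewrite ReD [leLHS]addrC lerD2r ReN lerN2; apply: le_trans (ler_norm _) _.
apply: le_trans (Re_le_modc _) _; rewrite modcM modE ler_wpM2l ?modc_ge0//.
apply: le_trans (modcD _ _) _; rewrite modcM ze1 mul1r -[1 - ze]opprB modcN -/de.
by have := S1_close; lra.
Qed.

(** A cycle along the boundary of a polar rectangle: [N] steps of angle [arg ze],
a quarter turn in total, on the circle of radius [r1], a radial step to radius
[r2], the same arc backwards, and a radial step to the start. *)
Variables (z : nat -> R[i]) (al : nat -> R).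
Hypothesis z1 : forall j, (j < N.+1)%N -> z j = r1%:C * (s * ze ^+ j).
Hypothesis z2 : forall j, (j < N.+1)%N -> z (N.+1 + j)%N = r2%:C * (s * ze ^+ (N - j)).
Hypothesis z3 : z (N.+1 + N.+1)%N = r1%:C * s.
Hypothesis al1 : forall j, (j < N.+1)%N -> al j = a1.
Hypothesis al2 : forall j, (j < N.+1)%N -> al (N.+1 + j)%N = a2.

Let D j : R := modc (z j.+1 - z j - t * (al j)%:C / z j) ^+ 2 - modc (t * (al j)%:C / z j) ^+ 2.

Let unit_pow k : modc (s * ze ^+ k) = 1.
Proof. by rewrite modcM modcX s1 ze1 expr1n mulr1. Qed.

Let D1 j : (j < N)%N -> D j = r1 ^+ 2 * de ^+ 2 - 2 * (a1 * complex.Re (E * ((ze - 1) * ze ^+ (2 * j)))).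
Proof.
move=> jN; have jN1 : (j < N.+1)%N := ltnW jN.
rewrite /D (z1 (j := j.+1))// (z1 jN1) al1//.
rewrite transport_step//.
have -> : r1%:C * (s * ze ^+ j.+1) - r1%:C * (s * ze ^+ j) = r1%:C * ((ze - 1) * (s * ze ^+ j)).
  by rewrite exprS; ring.
rewrite 2!modcM modcC unit_pow mulr1 exprMn real_normK ?num_real// -/de; congr (_ - 2 * _).
have -> : r1%:C * ((ze - 1) * (s * ze ^+ j)) * (conjc t * (s * ze ^+ j)) =
    r1%:C * (E * ((ze - 1) * ze ^+ (2 * j))).
  by rewrite /E mul2n -addnn exprD; ring.
case: (E * _) => p q /=; field; exact: lt0r_neq0.
Qed.

Let D2 : D N = (r2 - r1) ^+ 2 + 2 * ((r2 - r1) * (a1 / r1) * complex.Re E).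
Proof.
have := z2 (j := 0) isT; rewrite addn0 subn0 => zN.
rewrite /D zN z1// al1// transport_step//.
have -> : r2%:C * (s * ze ^+ N) - r1%:C * (s * ze ^+ N) = (r2 - r1)%:C * (s * ze ^+ N).
  by rewrite rmorphB/=; ring.
rewrite modcM modcC unit_pow mulr1 real_normK ?num_real//.
have -> : (r2 - r1)%:C * (s * ze ^+ N) * (conjc t * (s * ze ^+ N)) = (r2 - r1)%:C * (- E).
  rewrite (_ : - E = E * ze ^+ (2 * N)); last by rewrite zeN; ring.
  by rewrite /E mul2n -addnn exprD; ring.
case: E => p q /=; ring.
Qed.

Let D3 j : (j < N)%N -> D (N.+1 + j)%N =
  r2 ^+ 2 * de ^+ 2 - 2 * (a2 * complex.Re (E * ((1 - ze) * ze ^+ (2 * (N - j)).-1))).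
Proof.
move=> jN; have jN1 : (j < N.+1)%N := ltnW jN.
rewrite /D -addnS (z2 (j := j.+1))// (z2 jN1) al2//.
rewrite transport_step//.
have -> : (N - j = (N - j.+1).+1)%N by rewrite subnSK.
set k := (N - j.+1)%N.
have -> : r2%:C * (s * ze ^+ k) - r2%:C * (s * ze ^+ k.+1) = r2%:C * ((1 - ze) * (s * ze ^+ k)).
  by rewrite exprS; ring.
rewrite 2!modcM modcC unit_pow mulr1 exprMn real_normK ?num_real//.
rewrite -[1 - ze in LHS]opprB modcN -/de; congr (_ - 2 * _).
have -> : r2%:C * ((- (ze - 1)) * (s * ze ^+ k)) * (conjc t * (s * ze ^+ k.+1)) =
    r2%:C * (E * ((1 - ze) * ze ^+ (2 * k.+1).-1)).
  (* On the way back the displacement belongs to the vertex of exponent [k + 1] and the step leads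
     to exponent [k], whence the odd sum. *)
  rewrite (_ : (2 * k.+1).-1 = k + k.+1)%N; last by rewrite mul2n -addnn addSn.
  by rewrite /E !exprD; ring.
case: (E * _) => p q /=; field; exact: lt0r_neq0.
Qed.

Let D4 : D (N.+1 + N)%N = (r2 - r1) ^+ 2 + 2 * ((r2 - r1) * (a2 / r2) * complex.Re E).
Proof.
rewrite /D -addnS z3 (z2 (j := N))// al2// subnn expr0 mulr1 transport_step//.
rewrite -mulrBl -rmorphB/= modcM modcC s1 mulr1 real_normK ?num_real//.
have -> : (r1 - r2)%:C * s * (conjc t * s) = (r1 - r2)%:C * E by rewrite /E; ring.
case: E => p q /=; ring.
Qed.

(** The arcs contribute about [2 * (a1 - a2) * Re E], the radial steps the terms with [a1 / r1] and
    [a2 / r2]; together they form the left side. Of the quadratic costs only those of the two radial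
    steps survive refinement, since [N * de ^ 2] and [de] tend to 0. *)
Lemma polar_cycle_bound :
  \sum_(j < N.+1 + N.+1) modc (t * (al j)%:C / z j) ^+ 2 <=
  \sum_(j < N.+1 + N.+1) modc (z j.+1 - z j - t * (al j)%:C / z j) ^+ 2 ->
  complex.Re (conjc t * s ^+ 2) * (r1 * a2 / r2 - r2 * a1 / r1) <=
  (r2 - r1) ^+ 2 + N%:R * de ^+ 2 * (r1 ^+ 2 + r2 ^+ 2) + modc t * de * (a1 + 2 * a2).
Proof.
rewrite -subr_ge0 -sumrB (eq_bigr (fun j : 'I_(N.+1 + N.+1) => D j))//.
rewrite big_split_ord/= !big_ord_recr/= D2 D4.
rewrite (eq_bigr (fun j : 'I_N => r1 ^+ 2 * de ^+ 2 + (- (2 * a1)) * complex.Re (E * ((ze - 1) * ze ^+ (2 * j))))); last first.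
  by move=> j _; rewrite D1//; ring.
rewrite [X in _ + (X + _)](eq_bigr (fun j : 'I_N => r2 ^+ 2 * de ^+ 2 + (- (2 * a2)) * complex.Re (E * ((1 - ze) * ze ^+ (2 * (N - j)).-1)))); last first.
  by move=> j _; rewrite D3//; ring.
have split (c k : R) (F : 'I_N -> R) :
    \sum_(j < N) (c + k * F j) = N%:R * c + k * \sum_(j < N) F j.
  by rewrite big_split/= sumr_const card_ord mulr_sumr -[c *+ N]mulr_natl.
rewrite !split.
have Resum (F : 'I_N -> R[i]) : \sum_(j < N) complex.Re (F j) = complex.Re (\sum_(j < N) F j).
  by elim/big_rec2: _ => // j x y _ ->; rewrite ReD.
rewrite !Resum -!mulr_sumr -/S1.
have -> : (1 - ze) * \sum_(j < N) ze ^+ (2 * (N - j)).-1 = - ze * S1.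
  have -> : \sum_(j < N) ze ^+ (2 * (N - j)).-1 = ze * \sum_(j < N) ze ^+ (2 * j).
    rewrite (reindex_inj rev_ord_inj)/= mulr_sumr; apply: eq_bigr => j _.
    by rewrite subKn// mulnS/= exprS.
  by rewrite /S1; ring.
move: Re_S1 Re_S2; rewrite -/E.
set A := complex.Re (E * S1); set B := complex.Re (E * _); set e := complex.Re E.
move=> hA hB H.
have hA' := ler_wpM2l a10 hA; have hB' := ler_wpM2l a20 hB.
have t0 := modc_ge0 t; have d0 : 0 <= de := modc_ge0 _.
have p : 0 <= N%:R * de ^+ 2 * (r1 ^+ 2 + r2 ^+ 2).
  by rewrite !mulr_ge0 ?addr_ge0 ?sqr_ge0.
have -> : r1 * a2 / r2 - r2 * a1 / r1 = a2 - a1 - (r2 - r1) * (a1 / r1) - (r2 - r1) * (a2 / r2).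
  by field; rewrite !gt_eqF.
move: H p hA' hB'; set x := a1 / r1; set y := a2 / r2; lra.
Qed.

End cycle.

End polar_cycle.

Section transport_cycle.
Context {R : realType}.

Lemma small_angle (e : R) : 0 < e -> exists N : nat, exists ze : R[i],
  [/\ modc ze = 1, ze ^+ (2 * N) = -1, 0 <= complex.Re ze,
      modc (ze - 1) <= e & N%:R * modc (ze - 1) ^+ 2 <= e].
Proof.
(* With the angle [th = pi / 2 / n], the bound [1 - cos th <= e1 * th] gives
   [n * de ^ 2 <= pi * e1], where [de] is the chord [modc (ze - 1)]. The two arguments of the
   minimum serve the last two claims, as [de ^ 2 <= n * de ^ 2]. *)
move=> e0; pose e1 := Num.min e (e ^+ 2) / pi.
have pi0 := @pi_gt0 R.
have e10 : 0 < e1 by rewrite divr_gt0// lt_min e0 exprn_gt0.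
have [d d0 Hd] := derive_quotient (@derivable_cos R 0) e10.
have [n n0] : exists n, pi / 2 / d < n%:R.
  by exists (Num.bound (pi / 2 / d)); apply: archi_boundP; rewrite !divr_ge0// ltW.
have np : (0 < n%:R :> R).
  by apply: le_lt_trans n0; rewrite !divr_ge0// ltW.
have n1 : 1 <= n%:R :> R by rewrite ler1n -(ltr0n R).
pose th : R := pi / 2 / n%:R.
have th0 : 0 < th by rewrite !divr_gt0.
have thd : th < d by move: n0; rewrite /th !ltr_pdivrMr// [d * _]mulrC.
exists n, (expi th).
have cosb : 1 - cos th <= e1 * th.
  have := Hd th; rewrite gt_eqF// gtr0_norm// => /(_ isT thd).
  rewrite add0r cos0 derive1E derive_val sin0 oppr0 subr0 ltr_norml => /andP[+ _].
  by rewrite ltr_pdivlMr// => h; lra.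
have dE : modc (expi th - 1) ^+ 2 = 2 * (1 - cos th).
  rewrite sqr_modc ReD ImD ReN ImN /=; have := cos2Dsin2 th; nra.
have nd : n%:R * modc (expi th - 1) ^+ 2 <= Num.min e (e ^+ 2).
  rewrite dE; apply: (@le_trans _ _ (n%:R * (2 * (e1 * th)))).
    by rewrite ler_pM2l// ler_pM2l.
  rewrite le_eqVlt; apply/orP; left; apply/eqP; rewrite /th /e1.
  have : (pi : R) != 0 by rewrite gt_eqF.
  by move: (pi : R) => q qn; field; rewrite qn (gt_eqF np).
split.
- exact: modc_expi.
- rewrite mulnC exprM -expiMn (_ : n%:R * th = pi / 2); last by rewrite /th mulrC divfK// gt_eqF.
  by rewrite expi_pihalf sqr_i.
- rewrite /expi/=; apply: cos_ge0_pihalf; apply/andP; split.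
    by apply: le_trans (ltW th0); rewrite oppr_le0 divr_ge0// ltW.
  by rewrite /th ler_pdivrMr// ler_peMr// divr_ge0// ltW.
- rewrite -(ler_pXn2r (n := 2)) ?nnegrE ?modc_ge0 ?(ltW e0)//.
  apply: le_trans (_ : _ <= n%:R * modc (expi th - 1) ^+ 2) _.
    by rewrite ler_peMl// sqr_ge0.
  by apply: le_trans nd _; rewrite ge_min lexx orbT.
- by apply: le_trans nd _; rewrite ge_min lexx.
Qed.

Variables (mu : probability (R * R)%type R) (t : R[i]) (a : R -> R) (T : R * R -> R * R).
Hypotheses (mur : rotation_invariant mu) (mu0 : mu [set 0] = 0%E).
Hypothesis mT : measurable_fun setT T.
Hypothesis a0 : forall r, 0 <= a r.
Hypothesis TE : forall x, toC (T x) = toC x + t * (a (modc (toC x)))%:C / toC x.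
Variable C : R.
Hypothesis costC : (\int[mu]_x (qcost x (T x))%:E = C%:E)%E.
Hypothesis optimal : forall q, coupling mu (law mu mT) q -> (C%:E <= transport_cost q)%E.

Let P : probability ((R * R) * (R * R))%type R := (mu \x mu)%E.

(** The vertices as functions of two independent points of law [mu]: [circ] rotates the first point,
    [circ'] joins the direction of the first to the modulus of the second. Rotation invariance and
    the polar decomposition give each of them the law [mu]. *)
Let circ (v : R[i]) (p : (R * R) * (R * R)) : R * R := rot v p.1.
Let circ' (v : R[i]) (p : (R * R) * (R * R)) : R * R := rot (v * sgnc (toC p.1)) (modp p.2).

Let mcirc v : measurable_fun setT (circ v).
Proof. exact: measurableT_comp (measurable_rot v) _. Qed.

Let mcirc' v : measurable_fun setT (circ' v).
Proof.
apply: cmeasurableM.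
  apply: (@cmeasurableM _ _ _ (fun=> v)); first exact: cmeasurable_cst.
  exact: measurableT_comp (@cmeasurable_sgnc R) _.
under eq_fun do rewrite ofCK.
apply: cmeasurableC; exact: measurableT_comp (@measurable_modc_toC R) _.
Qed.

Let circ_law v A : modc v = 1 -> measurable A -> P (circ v @^-1` A) = mu A.
Proof.
move=> v1 mA; have mB : measurable (rot v @^-1` A).
  by rewrite -[X in measurable X]setTI; exact: measurable_rot.
have -> : circ v @^-1` A = (rot v @^-1` A) `*` setT by apply/seteqP; split => x //= [].
rewrite /P/= product_measure1E// [X in (_ * X)%E]probability_setT mule1.
exact: rotation_invariant_preimage.
Qed.

Let circ'_law v A : modc v = 1 -> measurable A -> P (circ' v @^-1` A) = mu A.
Proof.
move=> v1 mA; pose F (y : R * R) : \bar R := (\1_A (rot v y))%:E.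
have mF : measurable_fun setT F.
  by apply/measurable_EFinP; apply: measurableT_comp => //; exact: measurable_rot.
have F0 y : (0 <= F y)%E by rewrite lee_fin.
have mB : measurable (rot v @^-1` A).
  by rewrite -[X in measurable X]setTI; exact: measurable_rot.
have E1 : (\int[mu]_y F y = mu A)%E.
  rewrite -(rotation_invariant_preimage mur v1 mA).
  transitivity (\int[mu]_y (\1_(rot v @^-1` A) y)%:E)%E; last by rewrite integral_indic// setIT.
  apply: eq_integral => y _; rewrite /F !indicE.
  by rewrite (_ : (rot v y \in A) = (y \in rot v @^-1` A))//; apply/idP/idP; rewrite !in_setE.
have mG : measurable_fun setT (fun p : (R * R) * (R * R) => F (rot (sgnc (toC p.1)) (modp p.2))).
  have := mcirc' 1; rewrite /circ'; under eq_fun do rewrite mul1r.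
  exact: measurableT_comp.
rewrite -E1 (integral_polar_modc mur mu0 mF F0).
have mC : measurable (circ' v @^-1` A).
  by rewrite -[X in measurable X]setTI; exact: mcirc'.
transitivity (\int[mu \x mu]_p (\1_(circ' v @^-1` A) p)%:E)%E.
  by rewrite integral_indic// setIT.
transitivity (\int[mu \x mu]_p F (rot (sgnc (toC p.1)) (modp p.2)))%E.
  apply: eq_integral => p _; rewrite /F !indicE (_ : rot v _ = circ' v p); last by rewrite /circ' /rot !ofCK mulrA.
  by rewrite (_ : (circ' v p \in A) = (p \in circ' v @^-1` A))//; apply/idP/idP; rewrite !in_setE.
rewrite fubini_tonelli2//.
apply: eq_integral => x _; rewrite integral_law//.
  by apply: eq_integral => y _; rewrite ofCK.
apply: measurableT_comp => //; apply: cmeasurableM; first exact: cmeasurable_toC.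
exact: cmeasurable_cst.
Qed.

(** This is [r1 * r2 * (k r2 - k r1)] with [k r = a r / r ^ 2]. *)
Let ratio (r1 r2 : R) := r1 * a r2 / r2 - r2 * a r1 / r1.

Lemma ae_cycle_bound (u ze : R[i]) (N : nat) : modc u = 1 -> modc ze = 1 ->
  ze ^+ (2 * N) = -1 -> 0 <= complex.Re ze ->
  {ae P, forall p, 0 < modc (toC p.1) -> 0 < modc (toC p.2) ->
    let r1 := modc (toC p.1) in let r2 := modc (toC p.2) in
    complex.Re (conjc t * (u * sgnc (toC p.1)) ^+ 2) * ratio r1 r2 <=
    (r2 - r1) ^+ 2 + N%:R * modc (ze - 1) ^+ 2 * (r1 ^+ 2 + r2 ^+ 2) +
      modc t * modc (ze - 1) * (a r1 + 2 * a r2)}.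
Proof.
move=> u1 ze1 zeN zeRe.
(* The indices up to [N] follow the circle through the first point, those from [N + 1] to [2 N + 1]
   return on the other circle, and [2 N + 2] closes the cycle. *)
pose W (j : nat) : (R * R) * (R * R) -> R * R :=
  if (j < N.+1)%N then circ (u * ze ^+ j)
  else if (j < N.+1 + N.+1)%N then circ' (u * ze ^+ (N - (j - N.+1)))
  else circ u.
have up k : modc (u * ze ^+ k) = 1 by rewrite modcM modcX u1 ze1 expr1n mulr1.
have mW j : measurable_fun setT (W j) by rewrite /W; case: ifP => // _; case: ifP.
have lW j A : measurable A -> P (W j @^-1` A) = mu A.
  move=> mA; rewrite /W; case: ifP => _; first exact: circ_law.
  by case: ifP => _; [exact: circ'_law|exact: circ_law].
have WK : W (N + N.+1).+1 = W 0%N.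
  by rewrite /W -addSn ltnNge leq_addr/= ltnn/= expr0 mulr1.
have := cyclic_monotone costC optimal mW lW WK.
apply: filterS => p H p1 p2 /=.
set r1 := modc (toC p.1) in p1 *; set r2 := modc (toC p.2) in p2 *.
set s := u * sgnc (toC p.1).
have s1 : modc s = 1 by rewrite modcM u1 modc_sgnc mulr1.
have zX v : toC (circ v p) = r1%:C * (sgnc (toC p.1) * v).
  by rewrite /circ /rot ofCK {1}(sgncE (toC p.1)); ring.
have zY v : toC (circ' v p) = r2%:C * (sgnc (toC p.1) * v).
  by rewrite /circ' /rot !ofCK; ring.
apply: (@polar_cycle_bound _ t s ze r1 r2 (a r1) (a r2) N s1 ze1 zeN zeRe p1 p2 (a0 _) (a0 _)
  (fun j => toC (W j p)) (fun j => a (modc (toC (W j p))))).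
- by move=> j jN; rewrite /W jN zX /s; ring.
- by move=> j jN; rewrite /W ltnNge leq_addr/= ltn_add2l jN addKn zY /s; ring.
- by rewrite /W ltnNge leq_addr/= ltnn zX /s; ring.
- move=> j jN; rewrite /W jN zX !modcM modcC modc_sgnc modcX u1 ze1 expr1n !mulr1.
  by rewrite gtr0_norm.
- move=> j jN; rewrite /W ltnNge leq_addr/= ltn_add2l jN zY !modcM modcC modc_sgnc modcX u1 ze1 expr1n !mulr1.
  by rewrite gtr0_norm.
move: H; rewrite /qcost.
have EL j : modc (toC (W j p) - toC (T (W j p))) ^+ 2 =
    modc (t * (a (modc (toC (W j p))))%:C / toC (W j p)) ^+ 2.
  by rewrite TE opprD addrA subrr sub0r modcN.
have ER j : modc (toC (W j.+1 p) - toC (T (W j p))) ^+ 2 =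
    modc (toC (W j.+1 p) - toC (W j p) - t * (a (modc (toC (W j p))))%:C / toC (W j p)) ^+ 2.
  by rewrite TE opprD addrA.
by rewrite (eq_bigr _ (fun (j : 'I_(N + N.+1).+1) _ => EL j)) (eq_bigr _ (fun (j : 'I_(N + N.+1).+1) _ => ER j)).
Qed.

(** The exceptional null set depends on the subdivision. One subdivision for each error
    [1 / (n + 1)] suffices, so countably many null sets are discarded before the limit. *)
Lemma ae_cycle_limit (u : R[i]) : modc u = 1 ->
  {ae P, forall p, 0 < modc (toC p.1) -> 0 < modc (toC p.2) ->
    let r1 := modc (toC p.1) in let r2 := modc (toC p.2) in
    complex.Re (conjc t * (u * sgnc (toC p.1)) ^+ 2) * ratio r1 r2 <= (r2 - r1) ^+ 2}.
Proof.
move=> u1.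
have H (n : nat) : {ae P, forall p, 0 < modc (toC p.1) -> 0 < modc (toC p.2) ->
    let r1 := modc (toC p.1) in let r2 := modc (toC p.2) in
    complex.Re (conjc t * (u * sgnc (toC p.1)) ^+ 2) * ratio r1 r2 <=
    (r2 - r1) ^+ 2 + n.+1%:R^-1 * ((r1 ^+ 2 + r2 ^+ 2) + modc t * (a r1 + 2 * a r2))}.
  have en : 0 < (n.+1%:R : R)^-1 by rewrite invr_gt0.
  have [N [ze [ze1 zeN zeRe h1 h2]]] := small_angle en.
  have := ae_cycle_bound u1 ze1 zeN zeRe; apply: filterS => p hp p1 p2 /=.
  move: (hp p1 p2) => /= h; apply: le_trans h _.
  rewrite -[leLHS]addrA lerD2l [leRHS]mulrDr; apply: lerD.
    by rewrite ler_wpM2r// addr_ge0// sqr_ge0.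
  rewrite [modc t * _]mulrC -mulrA ler_wpM2r//.
  by rewrite mulr_ge0 ?modc_ge0// addr_ge0// mulr_ge0.
have := ae_foralln H; apply: filterS => p hp p1 p2 /=.
set r1 := modc (toC p.1) in p1 *; set r2 := modc (toC p.2) in p2 *.
set B := (r1 ^+ 2 + r2 ^+ 2) + modc t * (a r1 + 2 * a r2).
have B0 : 0 <= B.
  by rewrite !addr_ge0 ?sqr_ge0// mulr_ge0 ?modc_ge0// addr_ge0// mulr_ge0.
apply/ler_addgt0Pr => e e0.
pose n := Num.bound (B / e).
have hn : B / e < n.+1%:R.
  have := archi_boundP (divr_ge0 B0 (ltW e0)); rewrite -/n => h.
  by apply: lt_le_trans h _; rewrite ler_nat.
apply: le_trans (hp n p1 p2) _ => /=; rewrite lerD2l -/r1 -/r2 -/B mulrC.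
by rewrite ler_pdivrMr// mulrC -ler_pdivrMr// ltW.
Qed.

(** Starting the cycle at an angle [k * pi / 4] multiplies [conjc t * s ^ 2] by ['i ^ k],
so that its real part may be replaced by its modulus, up to the factor 2. *)
Lemma ae_radial_bound :
  {ae P, forall p, 0 < modc (toC p.1) -> 0 < modc (toC p.2) ->
    let r1 := modc (toC p.1) in let r2 := modc (toC p.2) in
    modc t * `|ratio r1 r2| <= 2 * (r2 - r1) ^+ 2}.
Proof.
pose v : R[i] := expi (pi / 4).
have v1 k : modc (v ^+ k) = 1 by rewrite modcX modc_expi expr1n.
have v2 : v ^+ 2 = 'i.
  by rewrite -expiMn -expi_pihalf; congr expi; field.
have H0 := ae_cycle_limit (v1 0%N); have H1 := ae_cycle_limit (v1 1%N).
have H2 := ae_cycle_limit (v1 2%N); have H3 := ae_cycle_limit (v1 3%N).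
apply: filterS2 (filterI H0 H1) (filterI H2 H3) => p [h0 h1] [h2 h3] p1 p2 /=.
move: (h0 p1 p2) (h1 p1 p2) (h2 p1 p2) (h3 p1 p2) => {h0 h1 h2 h3} /=.
set r1 := modc (toC p.1) in p1 *; set r2 := modc (toC p.2) in p2 *.
set Q := ratio r1 r2; set s := sgnc (toC p.1).
have powE k : conjc t * (v ^+ k * s) ^+ 2 = 'i ^+ k * (conjc t * s ^+ 2).
  by rewrite exprMn -exprM mulnC exprM v2; ring.
rewrite !powE; set E := conjc t * s ^+ 2.
have Et : modc t = modc E by rewrite modcM modcJ modcX modc_sgnc expr1n mulr1.
have -> : 'i ^+ 3 = - 'i :> R[i] by rewrite exprS sqr_i; ring.
rewrite Et expr0 expr1 sqr_i !mulNr mul1r !ReN.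
have -> : complex.Re ('i * E) = - complex.Im E by case: (E) => x y /=; ring.
move=> h0 h1 h2 h3.
have EB : modc E <= `|complex.Re E| + `|complex.Im E|.
  rewrite -(ler_pXn2r (n := 2)) ?nnegrE ?modc_ge0 ?addr_ge0// sqr_modc sqrrD !real_normK ?num_real//.
  by rewrite -addrA lerD2l addrC lerDl mulrn_wge0// mulr_ge0.
apply: le_trans (ler_wpM2r (normr_ge0 _) EB) _.
have -> : 2 * (r2 - r1) ^+ 2 = (r2 - r1) ^+ 2 + (r2 - r1) ^+ 2 by ring.
rewrite mulrDl -!normrM; apply: lerD; rewrite ler_norml; apply/andP; split; lra.
Qed.

End transport_cycle.

Section plane_borel.
Context {R : realType}.

(** An open set is the union of the squares with rational centers and half sides [1 / (n + 1)] that
    it contains; [unpickle] enumerates them. *)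
Lemma open_measurable_plane (U : set (R * R)) : open U -> measurable U.
Proof.
move=> oU.
pose I (p : rat) (n : nat) : set R := `](ratr p - n.+1%:R^-1), (ratr p + n.+1%:R^-1)[%classic.
pose F (k : nat) : set (R * R) := match @unpickle (rat * rat * nat)%type k with
  | Some (p, q, n) => if `[< I p n `*` I q n `<=` U >] then I p n `*` I q n else set0
  | None => set0 end.
have -> : U = \bigcup_k F k.
  apply/seteqP; split => x; last first.
    move=> [k _]; rewrite /F; case: unpickle => [[[p q] n]|]//.
    by case: asboolP => // h; exact: h.
  move=> Ux; have /nbhs_ballP[e /= e0 He] : nbhs x U by exact: open_nbhs_nbhs.
  have [n ne] : exists n : nat, n.+1%:R^-1 < e / 2.
    exists (Num.bound (2 / e)); rewrite -[e / 2]invrK invf_div ltf_pV2 ?posrE ?divr_gt0//.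
    have := archi_boundP (divr_ge0 (ler0n R 2) (ltW e0)) => h.
    by apply: lt_le_trans h _; rewrite ler_nat.
  have d0 : 0 < (n.+1%:R : R)^-1 by rewrite invr_gt0.
  have near (y : R) : exists p : rat, I p n y /\ forall z, I p n z -> ball y e z.
    have [p] := @rat_in_itvoo R (y - n.+1%:R^-1) (y + n.+1%:R^-1) (ltac:(move: d0; set d := _^-1; lra)).
    rewrite in_itv/= => /andP[h1 h2]; exists p; rewrite /I; split => [|z]; rewrite /= in_itv/=.
      by move: h1 h2; set d := _^-1; move=> *; apply/andP; split; lra.
    rewrite /ball/= ltr_norml => /andP[h3 h4].
    move: ne h1 h2 h3 h4; set d := _^-1; move=> *; apply/andP; split; lra.
  have [p [xp hp]] := near x.1; have [q [xq hq]] := near x.2.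
  exists (pickle (p, q, n)); first exact: Logic.I.
  rewrite /F (@pickleK (rat * rat * nat)%type); case: asboolP => [_|[]]; first by split.
  by move=> y [yp yq]; apply: He; split; [exact: hp|exact: hq].
apply: bigcupT_measurable => k; rewrite /F; case: unpickle => [[[p q] n]|]//.
by case: asboolP => // _; apply: measurableX; exact: measurable_itv.
Qed.

Lemma compactly_supported_bound (nu : probability (R * R)%type R) :
  compactly_supported nu ->
  exists2 B : R, 0 <= B & nu [set x | B < modc (toC x)] = 0%E.
Proof.
move=> [K cK K0].
have cK1 : compact (fst @` K) by apply: continuous_compact => //; apply: continuous_subspaceT => x; exact: cvg_fst.
have cK2 : compact (snd @` K) by apply: continuous_compact => //; apply: continuous_subspaceT => x; exact: cvg_snd.
have [M1 [_ H1]] := compact_bounded cK1; have [M2 [_ H2]] := compact_bounded cK2.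
pose B1 := Num.max M1 0 + 1; pose B2 := Num.max M2 0 + 1.
have B10 : 0 <= B1 by rewrite addr_ge0// le_max lexx orbT.
have B20 : 0 <= B2 by rewrite addr_ge0// le_max lexx orbT.
exists (B1 + B2); first exact: addr_ge0.
have mK : measurable (~` K).
  apply: open_measurable_plane; apply: closed_openC; apply: compact_closed => //.
apply: subset_measure0 K0 => //.
  rewrite (_ : [set _ | _] = ~` [set x | modc (toC x) <= B1 + B2]).
    apply: measurableC; rewrite (_ : [set _ | _] = (fun x => modc (toC x)) @^-1` `]-oo, B1 + B2]).
      by rewrite -[X in measurable X]setTI; exact: measurable_modc_toC.
    by apply/seteqP; split => x /=; rewrite in_itv.
  by apply/seteqP; split => x /=; [rewrite ltNge => /negP|move/negP; rewrite -ltNge].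
move=> x /= hx Kx; move: hx; apply/negP; rewrite -leNgt.
have h1 : `|x.1| <= B1.
  apply: (H1 B1 _ x.1); last by exists x.
  by rewrite /B1 (le_lt_trans (_ : _ <= Num.max M1 0)) ?le_max ?lexx// ltrDl.
have h2 : `|x.2| <= B2.
  apply: (H2 B2 _ x.2); last by exists x.
  by rewrite /B2 (le_lt_trans (_ : _ <= Num.max M2 0)) ?le_max ?lexx// ltrDl.
have s0 : 0 <= B1 + B2 by exact: addr_ge0.
have : modc (toC x) ^+ 2 <= (B1 + B2) ^+ 2.
  rewrite sqr_modc -[complex.Re (toC x)]/x.1 -[complex.Im (toC x)]/x.2.
  rewrite -(real_normK (num_real x.1)) -(real_normK (num_real x.2)).
  have := normr_ge0 x.1; have := normr_ge0 x.2; nra.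
by rewrite ler_pXn2r ?nnegrE ?modc_ge0.
Qed.

End plane_borel.

(** * From optimality to a constant density *)

Section optimal_implies_uniform.
Context {R : realType}.
Variables (g : R -> R) (mu nut : probability (R * R)%type R) (t : R[i]).
Hypotheses (mur : rotation_invariant mu).
Hypothesis a0E : forall r : R, 0 <= r -> mu (disk r) = (alpha0 g r)%:E.
Hypothesis gcont : {within `[0, 1], continuous g}.
Hypothesis gconc : concave_on01 g.
Hypothesis gd1 : forall x, 0 < x < 1 -> derivable g x 1.
Hypothesis gd2 : forall x, 0 < x < 1 -> derive1n 2 g x < 0.
Hypotheses (t0 : 0 < modc t) (nutK : compactly_supported nut).
Hypothesis opt : optimal_transport_map (transport_map g t) mu nut.

Local Notation al := (alpha0 g).

Let al_ge0 r : 0 <= al r.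
Proof. by rewrite /alpha0; case: xgetP => // x _ [/andP[]]. Qed.

Let al_le1 r : al r <= 1.
Proof. by rewrite /alpha0; case: xgetP => // x _ [/andP[]]. Qed.

Let mono r s : 0 < r -> r <= s -> al r <= al s.
Proof. exact: alpha0_mono. Qed.

Let surj x : 0 < x < 1 -> exists2 r, 0 < r & al r = x.
Proof. exact: alpha0_surj. Qed.

Let origin : mu [set 0] = 0%E.
Proof.
apply/eqP; rewrite eq_le measure_ge0 andbT; apply/lee_addgt0Pr => e e0; rewrite add0e.
have m01 : 0 < Num.min e (2^-1) < 1.
  by rewrite lt_min e0 invr_gt0 ltr0n/= gt_min; apply/orP; right; lra.
have [r r0 rE] := surj m01.
apply: (@le_trans _ _ (mu (disk r))); last by rewrite (a0E (ltW r0)) rE lee_fin ge_min lexx.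
apply: le_measure; rewrite ?inE; [exact: measurable_origin|exact: measurable_disk|].
by move=> x ->; rewrite /disk/= -[X in toC X]/(ofC 0) ofCK modc0.
Qed.

Let T (x : R * R) : R * R := ofC (transport_map g t (toC x)).

Let mT : measurable_fun setT T.
Proof. by have [/measurable_fun_pairP[_ ?]] := opt. Qed.

Let TE x : toC (T x) = toC x + t * (al (modc (toC x)))%:C / toC x.
Proof. by rewrite /T ofCK transport_mapE. Qed.

Let qcost_law : exists2 q, transport_cost q = W2sq mu nut &
  transport_cost q = (\int[mu]_x (qcost x (T x))%:E)%E /\
  forall A, measurable A -> nut A = law mu mT A.
Proof.
have [midT [q [qE qc qopt]]] := opt; exists q => //; split.
  transitivity (\int[law mu midT]_x (qcost x.1 x.2)%:E)%E.
    by apply: eq_probability_integral => A mA; rewrite lawE qE.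
  rewrite integral_law//; last by move=> y; rewrite lee_fin sqr_ge0.
  by apply/measurable_EFinP; exact: measurable_qcost.
move=> A mA; rewrite -qc.2// qE; last exact: measurableX.
by rewrite lawE; congr (mu _); apply/seteqP; split => x //= [].
Qed.

(** The displacement [t * al / x] carries no a priori bound near the origin. Instead the image is
    bounded almost everywhere by the compact support of [nut], while [x] either lies in the unit
    disk or differs from its image by at most [modc t]. *)
Let finite_cost : exists C : R, (\int[mu]_x (qcost x (T x))%:E = C%:E)%E.
Proof.
have [q _ [_ nutE]] := qcost_law.
have [B B0 HB] := compactly_supported_bound nutK.
have mB : measurable [set x : R * R | B < modc (toC x)].
  rewrite (_ : [set _ | _] = (fun x => modc (toC x)) @^-1` `]B, +oo[).
    by rewrite -[X in measurable X]setTI; exact: measurable_modc_toC.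
  by apply/seteqP; split => x /=; rewrite in_itv/= andbT.
pose M := B + (1 + (B + modc t)).
have M0 : 0 <= M by rewrite !addr_ge0// modc_ge0.
apply: (@finite_integral_ae_bounded _ _ (fun x => qcost x (T x)) (M ^+ 2)
  (T @^-1` [set x | B < modc (toC x)])).
- exact: measurable_qcost.
- by move=> x; exact: qcost_ge0.
- by rewrite -[X in measurable X]setTI; exact: mT.
- by rewrite -(lawE mu mT) -nutE.
move=> x /= /negP; rewrite -leNgt => TB; rewrite /qcost ler_pXn2r ?nnegrE ?modc_ge0//.
apply: le_trans (modcD _ _) _; rewrite modcN /M addrC; apply: lerD => //.
have [x1|x1] := ltP (modc (toC x)) 1.
  by apply: le_trans (ltW x1) _; rewrite lerDl addr_ge0// modc_ge0.
have -> : toC x = toC (T x) - t * (al (modc (toC x)))%:C / toC x by rewrite TE addrK.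
apply: le_trans (modcD _ _) _; rewrite modcN.
apply: (@le_trans _ _ (B + modc t)); last by rewrite lerDr.
apply: lerD => //; rewrite !modcM modcC modcV ger0_norm//.
rewrite ler_pdivrMr ?(lt_le_trans ltr01)// ler_wpM2l ?modc_ge0//.
exact: le_trans x1.
Qed.

Let ae_bound : {ae (mu \x mu)%E, forall p : (R * R) * (R * R),
  0 < modc (toC p.1) -> 0 < modc (toC p.2) ->
  let r1 := modc (toC p.1) in let r2 := modc (toC p.2) in
  modc t * `|r1 * al r2 / r2 - r2 * al r1 / r1| <= 2 * (r2 - r1) ^+ 2}.
Proof.
have [C hC] := finite_cost.
apply: (ae_radial_bound mur origin al_ge0 TE hC) => q qc.
have [q' q'opt [q'C nutE]] := qcost_law.
rewrite -hC -q'C q'opt; apply: ereal_inf_lbound; exists q => //.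
by split=> A mA; [exact: qc.1|rewrite nutE//; exact: qc.2].
Qed.

Let annulus r s : set (R * R) := disk s `\` disk r.

Let measurable_annulus r s : measurable (annulus r s).
Proof. by apply: measurableD; exact: measurable_disk. Qed.

Let annulus_gt0 r s : 0 < r -> r < s -> 0 < al s -> al r < 1 -> (0 < mu (annulus r s))%E.
Proof.
move=> r0 rs s1 r1; rewrite measureD; [|exact: measurable_disk|exact: measurable_disk|].
  rewrite setIidr; last by move=> x /= /lt_trans; apply.
  have : (0 < (al s)%:E - (al r)%:E)%E by rewrite sube_gt0 lte_fin; exact: alpha0_strict.
  by rewrite -(a0E (ltW r0)) -(a0E (ltW (lt_trans r0 rs))).
by rewrite -ge0_fin_numE ?fin_num_measure//; exact: measurable_disk.
Qed.

(** The almost sure bound must hold at some pair of points in any product of two annuli of positive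
    mass. *)
Let good_pair r r' s s' : 0 < r -> r < r' -> 0 < al r' -> al r < 1 ->
  0 < s -> s < s' -> 0 < al s' -> al s < 1 ->
  exists u v, [/\ r <= u < r', s <= v < s' &
    modc t * `|u * al v / v - v * al u / u| <= 2 * (v - u) ^+ 2].
Proof.
move=> r0 rr ar ar1 s0 ss as_ as1.
have p1 := annulus_gt0 r0 rr ar ar1; have p2 := annulus_gt0 s0 ss as_ as1.
have [N [mN N0 HN]] := ae_bound.
have [p [[p1' p2'] pN]] : exists p, (annulus r r' `*` annulus s s') p /\ ~ N p.
  apply: contrapT => H.
  have sub : annulus r r' `*` annulus s s' `<=` N.
    by move=> p Ap; apply: contrapT => Np; apply: H; exists p.
  have : (mu \x mu)%E (annulus r r' `*` annulus s s') = 0%E.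
    exact: subset_measure0 (measurableX (measurable_annulus r r') (measurable_annulus s s')) mN sub N0.
  rewrite product_measure1E//.
  by move=> /eqP; apply/negP; rewrite gt_eqF// mule_gt0.
exists (modc (toC p.1)), (modc (toC p.2)).
move: p1' p2' => [d1 /negP]; rewrite -leNgt => e1 [d2 /negP]; rewrite -leNgt => e2.
split; [by rewrite e1|by rewrite e2|].
have := contrapT (contra_not (HN p) pN); apply.
- exact: lt_le_trans e1.
- exact: lt_le_trans e2.
Qed.

(** A monotone function attaining every value in []0, 1[] has no jump there. Continuity from the
    left is what the annuli [disk r] minus [disk r'] call for. *)
Let left_approx r (e : R) : 0 < al r < 1 -> 0 < r -> 0 < e -> exists r', [/\ 0 < r', r' < r, r - e <= r', al r' < 1 &
  forall u, r' <= u < r -> al r - e <= al u <= al r].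
Proof.
move=> /andP[a0 a1] r0 e0.
have m01 : 0 < Num.max (al r - e) (al r / 2) < 1.
  by rewrite lt_max gt_max divr_gt0//= orbT/=; apply/andP; split; lra.
have [r1 r10 r1E] := surj m01.
have r1r : r1 < r.
  rewrite ltNge; apply/negP => /(mono r0); rewrite r1E => h.
  by move: h; rewrite leNgt gt_max; apply/negP; rewrite negbK; apply/andP; split; lra.
exists (Num.max r1 (r - e)); split.
- by rewrite lt_max r10.
- by rewrite gt_max r1r/=; lra.
- by rewrite le_max lexx orbT.
- apply: le_lt_trans a1; apply: mono; first by rewrite lt_max r10.
  by rewrite ge_max (ltW r1r)/=; lra.
move=> u /andP[]; rewrite ge_max => /andP[ru _] ur; have u0 := lt_le_trans r10 ru.
rewrite mono ?(ltW ur)// andbT; apply: le_trans (mono r10 ru).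
by rewrite r1E le_max lexx.
Qed.

(** The bound holds at pairs that approach [(r, s)] from the left. Multiplying it by [u * v] clears
    the denominators, and both sides converge. *)
Let pointwise_bound r s : 0 < r -> 0 < s -> 0 < al r < 1 -> 0 < al s < 1 ->
  modc t * `|r ^+ 2 * al s - s ^+ 2 * al r| <= 2 * (r * s) * (s - r) ^+ 2.
Proof.
move=> r0 s0 ar as_.
have ex (n : nat) : exists q : R * R, [/\ r - n.+1%:R^-1 <= q.1 <= r, s - n.+1%:R^-1 <= q.2 <= s,
    al r - n.+1%:R^-1 <= al q.1 <= al r, al s - n.+1%:R^-1 <= al q.2 <= al s &
    modc t * `|q.1 ^+ 2 * al q.2 - q.2 ^+ 2 * al q.1| <= 2 * (q.1 * q.2) * (q.2 - q.1) ^+ 2].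
  have en : 0 < (n.+1%:R : R)^-1 by rewrite invr_gt0.
  have [r' [r'0 r'r r'e r'1 Hr]] := left_approx ar r0 en.
  have [s' [s'0 s's s'e s'1 Hs]] := left_approx as_ s0 en.
  have [u [v [ur vs H]]] := good_pair r'0 r'r (andP ar).1 r'1 s'0 s's (andP as_).1 s'1.
  exists (u, v) => /=; split; rewrite ?Hr ?Hs//.
  - by have /andP[h1 h2] := ur; rewrite (le_trans r'e h1) ltW.
  - by have /andP[h1 h2] := vs; rewrite (le_trans s'e h1) ltW.
  have u0 : 0 < u by have /andP[h1 _] := ur; exact: lt_le_trans h1.
  have v0 : 0 < v by have /andP[h1 _] := vs; exact: lt_le_trans h1.
  have -> : u ^+ 2 * al v - v ^+ 2 * al u = (u * v) * (u * al v / v - v * al u / u).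
    by field; rewrite !gt_eqF.
  rewrite normrM (gtr0_norm (mulr_gt0 u0 v0)).
  by have := ler_wpM2l (ltW (mulr_gt0 u0 v0)) H; lra.
have [q Hq] := choice ex.
have hc : (n.+1%:R : R)^-1 @[n --> \oo] --> (0 : R) by exact: cvg_harmonic.
have lim (x : R) (w : nat -> R) : (forall n, x - n.+1%:R^-1 <= w n <= x) -> w @ \oo --> x.
  move=> H; apply: (@squeeze_cvgr _ _ _ _ (fun n => x - n.+1%:R^-1) (fun=> x)).
  - exact: nearW.
  - by rewrite -[X in _ --> X]subr0; apply: cvgB => //; exact: cvg_cst.
  - exact: cvg_cst.
have c1 : (fun n => (q n).1) @ \oo --> r by apply: lim => n; have [] := Hq n.
have c2 : (fun n => (q n).2) @ \oo --> s by apply: lim => n; have [] := Hq n.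
have c3 : (fun n => al (q n).1) @ \oo --> al r by apply: lim => n; have [] := Hq n.
have c4 : (fun n => al (q n).2) @ \oo --> al s by apply: lim => n; have [] := Hq n.
have cl : (fun n => modc t * `|(q n).1 ^+ 2 * al (q n).2 - (q n).2 ^+ 2 * al (q n).1|) @ \oo -->
    modc t * `|r ^+ 2 * al s - s ^+ 2 * al r|.
  apply: cvgM; first exact: cvg_cst.
  by apply: cvg_norm; apply: cvgB; apply: cvgM => //; rewrite expr2; apply: cvgM.
have cr : (fun n => 2 * ((q n).1 * (q n).2) * ((q n).2 - (q n).1) ^+ 2) @ \oo -->
    2 * (r * s) * (s - r) ^+ 2.
  apply: cvgM; first by apply: cvgM; [exact: cvg_cst|exact: cvgM].
  by rewrite expr2; apply: cvgM; apply: cvgB.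
by apply: (ler_cvg_to cl cr); apply: nearW => n; have [] := Hq n.
Qed.

(** After division by [(x * y) ^ 2] the increments of the density are at most
    [2 * (y - x) ^ 2 / (modc t * r ^ 2)]. A quadratic modulus of continuity forces a constant. *)
Let density_const r s : 0 < r -> r <= s -> 0 < al r -> al s < 1 ->
  al r / r ^+ 2 = al s / s ^+ 2.
Proof.
move=> r0 rs ar as_.
apply: (@eq_of_variation_bound _ (fun x => al x / x ^+ 2)
  (fun x => 2 / (modc t * r ^+ 2) * x) _ _ rs) => x y rx xy ys.
have x0 := lt_le_trans r0 rx; have y0 := lt_le_trans x0 xy.
have ax : 0 < al x < 1.
  by rewrite (lt_le_trans ar (mono r0 rx)) (le_lt_trans (mono x0 (le_trans xy ys))).
have ay : 0 < al y < 1.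
  by rewrite (lt_le_trans ar (mono r0 (le_trans rx xy))) (le_lt_trans (mono y0 ys)).
have := pointwise_bound x0 y0 ax ay.
have -> : al y / y ^+ 2 - al x / x ^+ 2 = (x ^+ 2 * al y - y ^+ 2 * al x) / (x * y) ^+ 2.
  by field; rewrite !gt_eqF.
have xy0 : 0 < x * y by exact: mulr_gt0.
rewrite normrM normfV (gtr0_norm (exprn_gt0 2 xy0)); set Q := `|_|.
move=> h; rewrite ler_pdivrMr ?exprn_gt0//.
have h' : Q <= 2 * (x * y) * (y - x) ^+ 2 / modc t by rewrite ler_pdivlMr// mulrC.
apply: le_trans h' _.
have -> : (y - x) * (2 / (modc t * r ^+ 2) * y - 2 / (modc t * r ^+ 2) * x) * (x * y) ^+ 2 =
    2 * (x * y) * (y - x) ^+ 2 / modc t * (x * y / r ^+ 2).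
  by field; rewrite !gt_eqF.
apply: ler_peMr.
  by rewrite divr_ge0 ?modc_ge0// mulr_ge0 ?sqr_ge0// mulr_ge0// ltW.
by rewrite ler_pdivlMr ?exprn_gt0// mul1r expr2 ler_pM// ?(ltW r0)// (le_trans rx).
Qed.

Lemma optimal_uniform : uniform_on_centered_disk mu.
Proof.
have h01 : 0 < (2^-1 : R) < 1 by apply/andP; split; lra.
have [r r0 rE] := surj h01.
pose c := al r / r ^+ 2; have c0 : 0 < c by rewrite divr_gt0 ?exprn_gt0// rE invr_gt0.
have const s : 0 < s -> 0 < al s < 1 -> al s = c * s ^+ 2.
  move=> s0 /andP[a0 a1]; have : al s / s ^+ 2 = c.
    have [rs|/ltW sr] := leP r s.
      by apply/esym/density_const => //; rewrite rE; lra.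
    by apply: density_const => //; rewrite rE; lra.
  by move=> <-; rewrite divfK// expf_eq0/= gt_eqF.
(* The radius at which [c * s ^ 2] reaches 1. *)
pose b := Num.sqrt c^-1; have b0 : 0 < b by rewrite sqrtr_gt0 invr_gt0.
have bE : b ^+ 2 = c^-1 by rewrite sqr_sqrtr// invr_ge0 ltW.
(* It is not yet known that [al s] lies in []0, 1[]. Instead the value [s ^ 2 / b ^ 2] is attained
   at some radius, which [const] identifies as [s]. *)
have below s : 0 < s -> s < b -> al s = s ^+ 2 / b ^+ 2.
  move=> s0 sb; have s01 : 0 < s ^+ 2 / b ^+ 2 < 1.
    rewrite divr_gt0 ?exprn_gt0//= ltr_pdivrMr ?exprn_gt0// mul1r.
    by rewrite ltr_pXn2r ?nnegrE ?ltW.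
  have [s' s'0 s'E] := surj s01.
  have := const s' s'0; rewrite s'E => /(_ s01); rewrite bE invrK mulrC => /(mulfI (lt0r_neq0 c0)).
  move=> /eqP; rewrite eqrXn2 ?ltW// => /eqP ss.
  by rewrite {1}ss s'E bE invrK mulrC.
(* A value in []0, 1[] would be [c * b ^ 2 = 1] by [const]; monotonicity from [b / 2] excludes 0. *)
have at_b : al b = 1.
  have h : al (b / 2) = 4^-1.
    rewrite below; [|by rewrite divr_gt0|by have := b0; lra].
    by field; rewrite gt_eqF.
  have bp : 0 < al b.
    by apply: lt_le_trans (mono (divr_gt0 b0 _) (_ : b / 2 <= b)); rewrite ?h ?invr_gt0//; have := b0; lra.
  apply/eqP; rewrite eq_le al_le1 leNgt; apply/negP => b1.
  have := const b b0; rewrite bp b1 bE mulfV ?gt_eqF// => /(_ isT) e1.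
  by move: b1; rewrite e1 ltxx.
apply: (radial_uniform mur b0) => s /andP[].
rewrite le_eqVlt => /orP[/eqP<- _|s0].
  rewrite expr0n mul0r (_ : disk 0 = set0) ?measure0//.
  by apply/seteqP; split => // x; rewrite /disk/= ltNge modc_ge0.
rewrite le_eqVlt => /orP[/eqP->|sb]; rewrite a0E ?ltW//; last by rewrite below.
by rewrite at_b divff// expf_eq0/= gt_eqF.
Qed.

End optimal_implies_uniform.

Theorem theorem5p6 (R : realType) (d : measure_display)
    (Omega : measurableType d) (P : probability Omega R)
    (xi : nat -> Omega -> R[i]) (a : nat -> nat -> R[i]) (g : R -> R)
    (nu : R[i] -> probability (R * R)%type R) (t : R[i])
    (hA1 : assumption_A1 P xi)
    (hA2 : assumption_A2 a g)
    (hA3 : assumption_A3 g)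
    (hnu : limiting_zero_distributions P xi a g nu)
    (ht0 : 0 < modc t)
    (ht : ((modc t)%:E < t_sing g)%E) :
  (optimal_transport_map (transport_map g t) (nu 0) (nu t) <->
     uniform_on_centered_disk (nu 0))
  /\ (uniform_on_centered_disk (nu 0) ->
        wasserstein_geodesic (fun s : R => nu (s%:C * t))
        /\ ((1%:E <= t_sing g)%E ->
              wasserstein_geodesic (fun s : R => nu (s%:C)))).
Proof.
have [gcont _ gconc _] := hA2; have [gd gd2 _] := hA3.
have gd1 x : 0 < x < 1 -> derivable g x 1 by exact: (gd 0%N).
have [_ mur a0E hpot nuU] := hnu.
have tn : t != 0 by rewrite -modc_gt0.
have [nutK _] := hpot t tn.
have uniform : uniform_on_centered_disk (nu 0) -> exists b, [/\ 0 < b,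
    forall r, 0 <= r <= b -> nu 0 (disk r) = (r ^+ 2 / b ^+ 2)%:E,
    forall al, 0 <= al <= 1 -> g al = g 0 + halfent al - al * ln b &
    (t_sing g <= (b ^+ 2)%:E)%E].
  move=> [b b0 /= H]; exists b.
  have rad r : 0 <= r <= b -> nu 0 (disk r) = (r ^+ 2 / b ^+ 2)%:E.
    exact: (uniform_radial b0 H).
  have aE r : 0 < r <= b -> alpha0 g r = r ^+ 2 / b ^+ 2.
    move=> /andP[r0 rb]; apply: EFin_inj.
    by rewrite -(rad r) ?(ltW r0)// -(a0E r (ltW r0)).
  split=> //.
  - exact: (profile_of_quadratic_maximizer b0 gcont aE).
  - exact: (quadratic_maximizer_tsing b0 gcont aE gd1).
split.
  split; first exact: (optimal_uniform mur a0E gcont gconc gd1 gd2 ht0 nutK).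
  move=> /uniform[b [b0 rad gE tb]].
  apply: (uniform_optimal b0 mur rad a0E nuU gE ht0).
  by rewrite -lee_fin ltW// (lt_le_trans ht).
move=> /uniform[b [b0 rad gE tb]]; split.
  apply: (uniform_geodesic b0 mur rad nuU gE ht0).
  by rewrite -lee_fin ltW// (lt_le_trans ht).
(* The curve with real times in [0, 1] is the segment in direction 1, and [1 <= t_sing g <= b ^ 2]
   takes the place of the bound on [t]. *)
move=> h1; have -> : (fun s : R => nu s%:C) = (fun s => nu (s%:C * 1)).
  by apply/funext => s; rewrite mulr1.
apply: (uniform_geodesic b0 mur rad nuU gE); rewrite modc1//.
by rewrite -lee_fin (le_trans h1).
Qed.
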